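(* Let $\theta\in[0,2\pi)$, $\alpha,\beta,\chi,\xi\in\mathbb C$, and let $\Omega,\Xi\subset\mathbb C^2\cong\mathbb H$ be domains with $T(\Xi)=\Omega$, where $T(z)=(az+b)d^{-1}$ with $a,b\in\mathbb H$, $a\neq0$, and $d\in\mathbb C$, $d\ne0$. Let $A_T=\bar d$, $B_T=\bar a$, $C_T=\frac{|a|^2}{|d|}d^{-1}$, $\rho_T=1$, $$\delta_T=(B_T)^{-1}(\chi+ie^{i\theta}j\xi)(A_T\circ T^{-1})=\delta_1+ie^{i\theta}j\,\delta_2\quad(\delta_1,\delta_2:\Omega\to\mathbb C),$$ $$\gamma_T(z)=e^{-2\,\mathrm{Re}\left(\overline{(\chi-\alpha)}z_1+\overline{(\xi-\beta)}z_2\right)}\rho_T(z),\qquad z=z_1+ie^{i\theta}jz_2\in\Xi .$$ Let ${}_{\delta_1,\delta_2}A(\Omega)={}_{\delta_1,\delta_2}Hol(\Omega,\mathbb C)\cap\mathcal L_2(\Omega,\mathbb C)$ and ${}_{\alpha,\beta}A_{\gamma_T}(\Xi)={}_{\alpha,\beta}Hol(\Xi,\mathbb C)\cap\mathcal L_{2,\gamma_T}(\Xi,\mathbb C)$. Then the operator $$J_T[f](z)=e^{\mathrm{Re}\left(\overline{(\chi-\alpha)}z_1+\overline{(\xi-\beta)}z_2\right)}\,C_T\,f(T(z)),\qquad z=z_1+ie^{i\theta}jz_2\in\Xi,$$ restricts to an isometric isomorphism ${}_{\delta_1,\delta_2}A(\Omega)\to{}_{\alpha,\beta}A_{\gamma_T}(\Xi)$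 of complex Hilbert spaces. In addition, for $z=z_1+ie^{i\theta}jz_2,\ \zeta=\zeta_1+ie^{i\theta}j\zeta_2\in\Xi$, $${}_{\alpha,\beta}B_{\Xi,\gamma_T}(z,\zeta)=e^{\mathrm{Re}\left(\overline{(\chi-\alpha)}(z_1+\zeta_1)+\overline{(\xi-\beta)}(z_2+\zeta_2)\right)}\,C_T(z)\;{}_{\delta_1,\delta_2}B_\Omega(T(z),T(\zeta))\;\overline{C_T(\zeta)},$$ $${}_{\alpha,\beta}\mathbf B_{\Xi,\gamma_T}=J_T\circ{}_{\delta_1,\delta_2}\mathbf B_\Omega\circ(J_T)^{-1},$$ where ${}_{\alpha,\beta}B_{\Xi,\gamma_T}$, ${}_{\delta_1,\delta_2}B_\Omega$ are the Bergman kernels and ${}_{\alpha,\beta}\mathbf B_{\Xi,\gamma_T}$, ${}_{\delta_1,\delta_2}\mathbf B_\Omega$ the Bergman projections of ${}_{\alpha,\beta}A_{\gamma_T}(\Xi)$ and ${}_{\delta_1,\delta_2}A(\Omega)$, respectively.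
   Context: $\mathbb H$ denotes the real quaternions with units $i,j,k$; $\mathbb C=\mathrm{span}_{\mathbb R}\{1,i\}\subset\mathbb H$, so $wj=j\bar w$ for $w\in\mathbb C$; $|q|$ is the Euclidean norm and $d\mu$ Lebesgue measure. $\mathbb C^2$ is identified with $\mathbb H$ via $(z_1,z_2)\leftrightarrow z=z_1+ie^{i\theta}jz_2$. With $z_1=x_0+ix_1$, $z_2=x_2+ix_3$ ($x_k\in\mathbb R$), put $\bar\partial_{z_1}=\frac{\partial}{\partial x_0}+i\frac{\partial}{\partial x_1}$, $\bar\partial_{z_2}=\frac{\partial}{\partial x_2}+i\frac{\partial}{\partial x_3}$ (that is, $\bar\partial_{z_k}=2\,\partial/\partial\bar z_k$). For $\alpha,\beta$ constants (or complex-valued functions on $U$), ${}_{\alpha,\beta}Hol(U,\mathbb C)$ is the set of $f\in C^1(U,\mathbb C)$ with $\bar\partial_{z_1}f=-\alpha f$ and $\bar\partial_{z_2}f=-\beta f$ on $U$. The functions $A_T,B_T,C_T,\rho_T$ are here constant. $\mathcal L_{2,\gamma}(U,\mathbb C)$ carries the inner product $\int_U\bar fg\,\gamma\,d\mu$ (with $\gamma=1$ for $\mathcal L_2(\Omega,\mathbb C)$), and the Bergman spaces carry the induced inner products. The Bergman kernel of such a space $A\subset\mathcal L_{2,\gamma}(U,\mathbb C)$ is its reproducing kernel $B:U\times U\to\mathbb C$, i.e. $\overline{B(z,\cdot)}\in A$ and $f(z)=\int_UB(z,w)f(w)\gamma(w)\,d\mu_w$ for all $f\in A$, $z\in U$;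 the Bergman projection is $\mathbf B[f](z)=\int_UB(z,w)f(w)\gamma(w)\,d\mu_w$ for $f\in\mathcal L_{2,\gamma}(U,\mathbb C)$. In the identity for projections, $J_T$ acts from $\mathcal L_2(\Omega,\mathbb C)$ onto $\mathcal L_{2,\gamma_T}(\Xi,\mathbb C)$. *)

(* Defs.v *)
From HB Require Import structures.
From mathcomp Require Import all_boot all_order all_algebra.
From mathcomp Require Import complex ring.
From mathcomp Require Import all_classical all_reals all_analysis.

Set Implicit Arguments.
Unset Strict Implicit.
Unset Printing Implicit Defensive.

Import Order.TTheory GRing.Theory Num.Theory.
Import numFieldNormedType.Exports.

Local Open Scope classical_set_scope.
Local Open Scope ring_scope.
Local Open Scope complex_scope.

(** * Real quaternions *)

(* [Quat q0 q1 q2 q3] is q0 + q1 i + q2 j + q3 k. *)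
Record quat (R : realType) := Quat { q0 : R; q1 : R; q2 : R; q3 : R }.

Section QuatRing.
Context {R : realType}.
Implicit Types p q r : quat R.

Definition quat_to (q : quat R) : R * R * R * R := (q0 q, q1 q, q2 q, q3 q).
Definition quat_of (x : R * R * R * R) : quat R :=
  Quat x.1.1.1 x.1.1.2 x.1.2 x.2.

Lemma quat_toK : cancel quat_to quat_of. Proof. by case. Qed.

HB.instance Definition _ := Choice.copy (quat R) (can_type quat_toK).

Definition quat_add p q : quat R :=
  Quat (q0 p + q0 q) (q1 p + q1 q) (q2 p + q2 q) (q3 p + q3 q).
Definition quat_opp p : quat R := Quat (- q0 p) (- q1 p) (- q2 p) (- q3 p).
Definition quat_mul p q : quat R :=
  Quat (q0 p * q0 q - q1 p * q1 q - q2 p * q2 q - q3 p * q3 q)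
       (q0 p * q1 q + q1 p * q0 q + q2 p * q3 q - q3 p * q2 q)
       (q0 p * q2 q - q1 p * q3 q + q2 p * q0 q + q3 p * q1 q)
       (q0 p * q3 q + q1 p * q2 q - q2 p * q1 q + q3 p * q0 q).

Lemma quat_eq p q :
  q0 p = q0 q -> q1 p = q1 q -> q2 p = q2 q -> q3 p = q3 q -> p = q.
Proof. by case: p q => ? ? ? ? [? ? ? ?] /= -> -> -> ->. Qed.

Fact quat_addqA : associative quat_add.
Proof. by move=> p q r; apply: quat_eq => /=; ring. Qed.
Fact quat_addqC : commutative quat_add.
Proof. by move=> p q; apply: quat_eq => /=; ring. Qed.
Fact quat_add0q : left_id (Quat 0 0 0 0) quat_add.
Proof. by move=> p; apply: quat_eq => /=; ring. Qed.
Fact quat_addNq : left_inverse (Quat 0 0 0 0) quat_opp quat_add.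
Proof. by move=> p; apply: quat_eq => /=; ring. Qed.

HB.instance Definition _ :=
  GRing.isZmodule.Build (quat R) quat_addqA quat_addqC quat_add0q quat_addNq.

Fact quat_mulqA : associative quat_mul.
Proof. by move=> p q r; apply: quat_eq => /=; ring. Qed.
Fact quat_mul1q : left_id (Quat 1 0 0 0) quat_mul.
Proof. by move=> p; apply: quat_eq => /=; ring. Qed.
Fact quat_mulq1 : right_id (Quat 1 0 0 0) quat_mul.
Proof. by move=> p; apply: quat_eq => /=; ring. Qed.
Fact quat_mulqDl : left_distributive quat_mul quat_add.
Proof. by move=> p q r; apply: quat_eq => /=; ring. Qed.
Fact quat_mulqDr : right_distributive quat_mul quat_add.
Proof. by move=> p q r; apply: quat_eq => /=; ring. Qed.
Fact quat_oneq_neq0 : Quat 1 0 0 0 != 0 :> quat R.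
Proof. by apply/eqP => -[] /eqP; rewrite oner_eq0. Qed.

HB.instance Definition _ := GRing.Zmodule_isNzRing.Build (quat R)
  quat_mulqA quat_mul1q quat_mulq1 quat_mulqDl quat_mulqDr quat_oneq_neq0.

Definition quat_norm q : R :=
  Num.sqrt (q0 q ^+ 2 + q1 q ^+ 2 + q2 q ^+ 2 + q3 q ^+ 2).
Definition quat_conj q : quat R := Quat (q0 q) (- q1 q) (- q2 q) (- q3 q).

Definition quat_inv q : quat R :=
  let n := quat_norm q ^+ 2 in Quat (q0 q / n) (- q1 q / n) (- q2 q / n) (- q3 q / n).

Lemma quat_norm_sqr q :
  quat_norm q ^+ 2 = q0 q ^+ 2 + q1 q ^+ 2 + q2 q ^+ 2 + q3 q ^+ 2.
Proof. by rewrite sqr_sqrtr// !addr_ge0// sqr_ge0. Qed.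

Lemma quat_norm_neq0 q : q != 0 -> quat_norm q ^+ 2 != 0.
Proof.
apply: contra_neq => /eqP; rewrite quat_norm_sqr.
rewrite !paddr_eq0 ?addr_ge0 ?sqr_ge0// !sqrf_eq0.
by move=> /andP[/andP[/andP[/eqP h0 /eqP h1] /eqP h2] /eqP h3]; apply: quat_eq.
Qed.

Fact quat_mulVq : {in [pred q : quat R | q != 0], left_inverse 1 quat_inv *%R}.
Proof.
move=> q; rewrite inE => /quat_norm_neq0 n0.
by apply: quat_eq; rewrite /= quat_norm_sqr in n0 *; field.
Qed.
Fact quat_mulqV : {in [pred q : quat R | q != 0], right_inverse 1 quat_inv *%R}.
Proof.
move=> q; rewrite inE => /quat_norm_neq0 n0.
by apply: quat_eq; rewrite /= quat_norm_sqr in n0 *; field.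
Qed.
Fact quat_unitqP p q : q * p = 1 /\ p * q = 1 -> p \in [pred q : quat R | q != 0].
Proof.
case=> + _; rewrite inE; apply: contra_eq_neq => ->.
by rewrite mulr0 eq_sym oner_eq0.
Qed.
Fact quat_invq0 : {in [predC [pred q : quat R | q != 0]], quat_inv =1 id}.
Proof.
move=> q; rewrite !inE negbK => /eqP ->.
by apply: quat_eq; rewrite /= ?oppr0 mul0r.
Qed.

HB.instance Definition _ := GRing.NzRing_hasMulInverse.Build (quat R)
  quat_mulVq quat_mulqV quat_unitqP quat_invq0.

Lemma quat_unitqE q : (q \is a GRing.unit) = (q != 0). Proof. by []. Qed.

End QuatRing.

(** * Lebesgue measure on R^2 and R^4 *)

(* The library only makes the product of two sigma-finite measures canonically
   a measure, not a sigma-finite one. *)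
Lemma sigma_finite_prod d1 d2 (T1 : measurableType d1) (T2 : measurableType d2)
    (R : realType) (m1 : {sigma_finite_measure set T1 -> \bar R})
    (m2 : {sigma_finite_measure set T2 -> \bar R}) :
  sigma_finite setT (m1 \x m2)%E.
Proof.
have /sigma_finiteP[F [TF ndF Foo]] := sigma_finiteT m1.
have /sigma_finiteP[G [TG ndG Goo]] := sigma_finiteT m2.
exists (fun n => F n `*` G n).
  rewrite -setXTT TF TG predeqE => -[x y]; split.
    move=> [/= [n _ Fnx] [k _ Gky]]; exists (maxn n k) => //; split.
    - by move: x Fnx; exact/subsetPset/ndF/leq_maxl.
    - by move: y Gky; exact/subsetPset/ndG/leq_maxr.
  by move=> [n _ []/= ? ?]; split; exists n.
move=> k; have [? ?] := Foo k; have [? ?] := Goo k.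
split; first exact: measurableX.
by rewrite product_measure1E// lte_mul_pinfty// ge0_fin_numE.
Qed.

Section Lebesgue.
Context {R : realType}.

Definition lebR2 := (@lebesgue_measure R \x @lebesgue_measure R)%E.
HB.instance Definition _ :=
  Measure.copy lebR2 (@lebesgue_measure R \x @lebesgue_measure R)%E.
HB.instance Definition _ := Measure_isSigmaFinite.Build _ _ _ lebR2
  (sigma_finite_prod lebesgue_measure lebesgue_measure).

Definition lebC2 := (lebR2 \x lebR2)%E.
HB.instance Definition _ := Measure.copy lebC2 (lebR2 \x lebR2)%E.
HB.instance Definition _ := Measure_isSigmaFinite.Build _ _ _ lebC2
  (sigma_finite_prod lebR2 lebR2).

End Lebesgue.

(** * The identification of C^2 with H *)

Section BergmanSpaces.
Context {R : realType}.

Local Notation Re := (@complex.Re R).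
Local Notation Im := (@complex.Im R).

(* [C2] is C^2 in real coordinates: ((x0, x1), (x2, x3)) stands for
   (z1, z2) = (x0 + i x1, x2 + i x3); the topology, the norm and the Lebesgue
   measure are the library's ones on the product. *)
Definition C2 : Type := ((R * R) * (R * R))%type.

Definition z1 (x : C2) : R[i] := x.1.1 +i* x.1.2.
Definition z2 (x : C2) : R[i] := x.2.1 +i* x.2.2.
Definition mkC2 (w1 w2 : R[i]) : C2 := ((Re w1, Im w1), (Re w2, Im w2)).

Definition CtoH (w : R[i]) : quat R := Quat (Re w) (Im w) 0 0.
Definition jH : quat R := Quat 0 0 1 0.

Definition expi (theta : R) : R[i] := cos theta +i* sin theta.

(* i e^{i theta} j *)
Definition unitH (theta : R) : quat R := CtoH ('i * expi theta) * jH.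

Definition toH (theta : R) (x : C2) : quat R :=
  CtoH (z1 x) + unitH theta * CtoH (z2 x).

(* Inverse of [toH theta]: if q = w1 + w2 j with w1, w2 complex, then
   i e^{i theta} j z2 = i e^{i theta} conj(z2) j gives
   z2 = i e^{i theta} conj(w2). *)
Definition ofH (theta : R) (q : quat R) : C2 :=
  mkC2 (q0 q +i* q1 q) ('i * expi theta * (q2 q +i* q3 q)^*).

Lemma ofHK theta : cancel (ofH theta) (toH theta).
Proof.
move=> [a b c d]; have h := cos2Dsin2 theta.
rewrite /toH /ofH /unitH /mkC2 /z1 /z2 /CtoH /expi /jH.
apply: quat_eq => /=; rewrite ?(mul0r, mulr0, mul1r, mulr1); try ring.
- by rewrite -[RHS]mulr1 -h; ring.
- by rewrite -[RHS]mulr1 -h; ring.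
Qed.

Lemma toHK theta : cancel (toH theta) (ofH theta).
Proof.
move=> [[a b] [c d]]; have h := cos2Dsin2 theta.
rewrite /toH /ofH /unitH /mkC2 /z1 /z2 /CtoH /expi /jH /=.
congr ((_, _), (_, _)); rewrite ?(mul0r, mulr0, mul1r, mulr1); try ring.
- by rewrite -[RHS]mulr1 -h; ring.
- by rewrite -[RHS]mulr1 -h; ring.
Qed.

(** * (alpha, beta)-holomorphic functions *)

Implicit Types (U : set C2) (f g : C2 -> R[i]) (gamma : C2 -> R).

Definition e0 : C2 := ((1, 0), (0, 0)).
Definition e1 : C2 := ((0, 1), (0, 0)).
Definition e2 : C2 := ((0, 0), (1, 0)).
Definition e3 : C2 := ((0, 0), (0, 1)).

Definition C1real U (g : C2 -> R) : Prop :=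
  (forall x, U x -> differentiable (g : C2 -> R^o) x) /\
  (forall v : C2, {within U, continuous (fun x => 'D_v (g : C2 -> R^o) x)}).

Definition C1 U f : Prop :=
  C1real U (fun x => Re (f x)) /\ C1real U (fun x => Im (f x)).

Definition partialC (v : C2) f (x : C2) : R[i] :=
  ('D_v (fun y => Re (f y) : R^o) x) +i* ('D_v (fun y => Im (f y) : R^o) x).

Definition dbar1 f (x : C2) : R[i] := partialC e0 f x + 'i * partialC e1 f x.
Definition dbar2 f (x : C2) : R[i] := partialC e2 f x + 'i * partialC e3 f x.

Definition Hol (alpha beta : C2 -> R[i]) U : set (C2 -> R[i]) :=
  [set f | C1 U f /\ forall x, U x ->
     dbar1 f x = - (alpha x * f x) /\ dbar2 f x = - (beta x * f x)].

Definition domain U : Prop := [/\ U !=set0, open U & connected U].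

(** * Weighted L2 and Bergman spaces *)

Definition integralC U f : R[i] :=
  (\int[lebC2]_(x in U) Re (f x)) +i* (\int[lebC2]_(x in U) Im (f x)).

Definition L2 gamma U : set (C2 -> R[i]) :=
  [set f | [/\ measurable_fun U (fun x => Re (f x)),
               measurable_fun U (fun x => Im (f x)) &
               (\int[lebC2]_(x in U) (ComplexField.Normc.normc (f x) ^+ 2 * gamma x)%:E < +oo)%E ]].

Definition inner gamma U f g : R[i] :=
  integralC U (fun x => (f x)^* * g x * (gamma x)%:C).

Definition Bergman (alpha beta : C2 -> R[i]) gamma U : set (C2 -> R[i]) :=
  Hol alpha beta U `&` L2 gamma U.

(* Functions on U are represented by total functions, of which only the values
   on U matter: elements of a Bergman space are identified when they agree on
   U, elements of L2 when they agree almost everywhere on U. *)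
Definition eq_on U f g : Prop := forall x, U x -> f x = g x.
Definition ae_eq_on U f g : Prop := f = g %[ae lebC2 in U].

Definition ipnorm (ip : (C2 -> R[i]) -> (C2 -> R[i]) -> R[i]) f : R :=
  Num.sqrt (Re (ip f f)).

(* The functions in E, modulo equality on U, form a complex Hilbert space for
   the inner product ip (linear in the second variable). *)
Record hilbert_space U (E : set (C2 -> R[i]))
    (ip : (C2 -> R[i]) -> (C2 -> R[i]) -> R[i]) : Prop := HilbertSpace {
  hilbert0 : E (fun=> 0);
  hilbert_lin : forall (c : R[i]) f g, E f -> E g -> E (fun x => c * f x + g x);
  hilbert_ip_lin : forall (c : R[i]) f g h, E f -> E g -> E h ->
    ip h (fun x => c * f x + g x) = c * ip h f + ip h g;
  hilbert_ip_herm : forall f g, E f -> E g -> ip g f = (ip f g)^*;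
  hilbert_ip_ge0 : forall f, E f -> 0 <= ip f f;
  hilbert_ip_def : forall f, E f -> ip f f = 0 <-> eq_on U f (fun=> 0);
  hilbert_complete : forall u : nat -> C2 -> R[i], (forall n, E (u n)) ->
    (forall eps : R, 0 < eps -> exists N, forall m n, (N <= m)%N -> (N <= n)%N ->
       ipnorm ip (fun x => u m x - u n x) < eps) ->
    exists2 f, E f & forall eps : R, 0 < eps -> exists N, forall n, (N <= n)%N ->
       ipnorm ip (fun x => u n x - f x) < eps }.

(* J induces a bijection from E modulo eqE onto F modulo eqF. *)
Definition bijective_mod (E : set (C2 -> R[i])) (eqE : (C2 -> R[i]) -> _ -> Prop)
    (F : set (C2 -> R[i])) (eqF : (C2 -> R[i]) -> _ -> Prop)
    (J : (C2 -> R[i]) -> C2 -> R[i]) : Prop :=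
  [/\ forall f, E f -> F (J f),
      forall f g, E f -> E g -> eqE f g <-> eqF (J f) (J g) &
      forall h, F h -> exists2 f, E f & eqF (J f) h].

Definition inverse_mod (E : set (C2 -> R[i]))
    (eqF : (C2 -> R[i]) -> (C2 -> R[i]) -> Prop)
    (J : (C2 -> R[i]) -> C2 -> R[i]) (h : C2 -> R[i]) : C2 -> R[i] :=
  xget (fun=> 0) [set f | E f /\ eqF (J f) h].

Definition isometric_isomorphism
    U (E : set (C2 -> R[i])) (ipE : (C2 -> R[i]) -> (C2 -> R[i]) -> R[i])
    V (F : set (C2 -> R[i])) (ipF : (C2 -> R[i]) -> (C2 -> R[i]) -> R[i])
    (J : (C2 -> R[i]) -> C2 -> R[i]) : Prop :=
  [/\ bijective_mod E (eq_on U) F (eq_on V) J,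
      forall (c : R[i]) f g, E f -> E g ->
        eq_on V (J (fun x => c * f x + g x)) (fun x => c * J f x + J g x) &
      forall f g, E f -> E g -> ipF (J f) (J g) = ipE f g].

(** * Bergman kernel and Bergman projection *)

Definition is_Bergman_kernel gamma U (A : set (C2 -> R[i]))
    (B : C2 -> C2 -> R[i]) : Prop :=
  (forall z, U z -> A (fun w => (B z w)^*)) /\
  (forall f z, A f -> U z ->
     f z = integralC U (fun w => B z w * f w * (gamma w)%:C)).

(* Such a kernel is unique on U x U. *)
Definition Bergman_kernel gamma U (A : set (C2 -> R[i])) : C2 -> C2 -> R[i] :=
  xget (fun _ _ => 0) [set B | is_Bergman_kernel gamma U A B].

Definition Bergman_projection gamma U (A : set (C2 -> R[i])) f : C2 -> R[i] :=
  fun z => integralC U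
    (fun w => Bergman_kernel gamma U A z w * f w * (gamma w)%:C).

(** * Affine quaternionic maps *)

Definition affH (a b : quat R) (d : R[i]) (q : quat R) : quat R :=
  (a * q + b) * (CtoH d)^-1.
Definition affH_inv (a b : quat R) (d : R[i]) (q : quat R) : quat R :=
  a^-1 * (q * CtoH d - b).

Lemma CtoH_neq0 (d : R[i]) : d != 0 -> CtoH d != 0.
Proof. by apply: contra_neq; case: d => x y [-> ->]. Qed.

Lemma affHK a b d : a != 0 -> d != 0 -> cancel (affH a b d) (affH_inv a b d).
Proof.
move=> a0 /CtoH_neq0 d0 q.
by rewrite /affH /affH_inv divrK ?quat_unitqE// addrK mulKr ?quat_unitqE.
Qed.

Lemma affH_invK a b d : a != 0 -> d != 0 -> cancel (affH_inv a b d) (affH a b d).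
Proof.
move=> a0 /CtoH_neq0 d0 q.
by rewrite /affH /affH_inv mulVKr ?quat_unitqE// subrK mulrK ?quat_unitqE.
Qed.

(* The same maps, read on C^2. *)
Definition affC2 theta a b d (x : C2) : C2 := ofH theta (affH a b d (toH theta x)).
Definition affC2_inv theta a b d (x : C2) : C2 :=
  ofH theta (affH_inv a b d (toH theta x)).

Lemma affC2K theta a b d : a != 0 -> d != 0 ->
  cancel (affC2 theta a b d) (affC2_inv theta a b d).
Proof. by move=> a0 d0 x; rewrite /affC2 /affC2_inv ofHK affHK// toHK. Qed.

Lemma affC2_invK theta a b d : a != 0 -> d != 0 ->
  cancel (affC2_inv theta a b d) (affC2 theta a b d).
Proof. by move=> a0 d0 x; rewrite /affC2 /affC2_inv ofHK affH_invK// toHK. Qed.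

End BergmanSpaces.

Arguments C2 R : clear implicits.

(* Main.v *)
Require Import Defs.
From HB Require Import structures.
From mathcomp Require Import all_boot all_order all_algebra.
From mathcomp Require Import complex ring lra.
From mathcomp Require Import all_classical all_reals all_analysis.
From mathcomp Require Import measurable_realfun.
Set Implicit Arguments.
Unset Strict Implicit.
Unset Printing Implicit Defensive.
Import Order.TTheory GRing.Theory Num.Theory.
Import numFieldNormedType.Exports.
Local Open Scope classical_set_scope.
Local Open Scope ring_scope.
Local Open Scope complex_scope.

(** Write T x = L x + v for the affine map, with L x = a x d^-1. Multiplication
    by quaternions on either side scales the Euclidean norm, so L is a
    similarity of ratio s = |a| / |d|, T multiplies Lebesgue measure by s^4, and
    the constant C_T is chosen so that |C_T|^2 = s^4. The factor gamma_T cancels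
    the square of the exponential in J_T, hence J_T is a weighted composition
    operator that preserves the inner product, with an inverse of the same form
    ([wcomp_inner], [wcomp_L2]).

    J_T also respects the differential equations. In quaternionic notation the
    pair of dbar derivatives of f is grad (Re f) + grad (Im f) i ([toH_dbar]);
    composing with T applies to each gradient the adjoint of L, which is
    x |-> conj(a) x conj(d)^-1 ([quatmap_adjoint]). As d is complex, the right
    factor commutes with i and with the values of f, so a
    (delta_1, delta_2)-holomorphic f becomes a (chi, xi)-holomorphic f o T
    exactly for the given delta_T ([quataff_Hol]). Multiplication by the
    exponential then turns (chi, xi) into (alpha, beta) ([Hol_expw]).

    What remains is that a Bergman space on an open set U is a Hilbert space
    with a reproducing kernel; all three conclusions then follow by transport
    along J_T ([wcomp_transfer]). By Riesz representation ([riesz]) this needs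
    bounded point evaluations and completeness. Multiplying f by the exponential
    weight [expw] reduces to functions that satisfy the Cauchy-Riemann equations
    in both variables. Such functions have the mean value property on circles
    ([circle_mean], by Fubini applied to the radial derivative), and integrating
    it against a bump function invariant under w |-> e^(is) w gives a
    reproducing formula ([reproducing]): the function is, near each point, its
    own convolution with the bump, up to a constant. The formula bounds point
    evaluations by the L2 norm ([Bergman_eval_bound]); Cauchy sequences therefore
    converge pointwise, and the limit inherits the reproducing formula
    ([limit_rep]), hence is C^1 and satisfies the same equations
    ([limit_Hol]), because convolutions with the bump may be differentiated
    under the integral sign ([conv_differentiable]). *)

(** * Open subsets of the plane and of C^2 are Borel *)

(** A countable base of neighbourhoods, indexed by [nat] so that unions over it
    are countable. *)
Definition nbhs_basis (T : topologicalType) (B : nat -> set T) : Prop :=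
  forall x (U : set T), nbhs x U -> exists n, B n x /\ B n `<=` U.

Definition rat_itv (R : realType) (n : nat) : set R :=
  if @unpickle (rat * rat)%type n is Some p
  then [set` `]ratr p.1, ratr p.2[%R] else set0.

Lemma nbhs_basis_rat (R : realType) : @nbhs_basis R (@rat_itv R).
Proof.
move=> x U /(@nbhs_ballP R)[e /= e0 eU].
have /rat_in_itvoo[p pP] : x - e < x by lra.
have /rat_in_itvoo[q qP] : x < x + e by lra.
exists (pickle (p, q)); rewrite /rat_itv pickleK /=; split.
  by rewrite in_itv /=; move: pP qP; rewrite !in_itv /= => /andP[_ ->] /andP[->].
move=> y; rewrite /= in_itv /= => /andP[py yq]; apply: eU => /=.
move: pP qP; rewrite !in_itv /= => /andP[xp _] /andP[_ qx].
by rewrite /ball /= ltr_distlC; apply/andP; split; lra.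
Qed.

Lemma nbhs_basis_prod (T1 T2 : topologicalType) B1 B2 :
  nbhs_basis B1 -> nbhs_basis B2 ->
  @nbhs_basis (T1 * T2)%type
    (fun n => if @unpickle (nat * nat)%type n is Some k
              then B1 k.1 `*` B2 k.2 else set0).
Proof.
move=> b1 b2 [x y] U [[A1 A2] /= [/b1[m [mx mA]] /b2[n [ny nA]]] AU].
exists (pickle (m, n)); rewrite pickleK /=; split; first by split.
by move=> [u v] [/= mu nv]; apply: AU; split; [exact: mA|exact: nA].
Qed.

Lemma open_bigcup_basis (T : topologicalType) (B : nat -> set T) (U : set T) :
  nbhs_basis B -> open U ->
  U = \bigcup_n (if `[< B n `<=` U >] then B n else set0).
Proof.
move=> bB oU; rewrite eqEsubset; split=> x.
  move=> Ux; have [n [nx nU]] := bB x U (open_nbhs_nbhs (conj oU Ux)).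
  by exists n => //; case: asboolP.
by move=> [n _]; case: asboolP => // nU; apply: nU.
Qed.

(** The product sigma-algebra is generated by rectangles, so open sets are
    measurable because they are countable unions of rational rectangles. *)
Lemma open_measurable_R2 (R : realType) (U : set (R * R)) : open U -> measurable U.
Proof.
move=> oU.
rewrite (open_bigcup_basis (nbhs_basis_prod (@nbhs_basis_rat R) (@nbhs_basis_rat R)) oU).
apply: bigcup_measurable => n _; case: ifP => // _.
case: unpickle => // k; apply: measurableX; rewrite /rat_itv; case: unpickle => // p; exact: measurable_itv.
Qed.

Lemma open_measurable_C2 (R : realType) (U : set (C2 R)) : open U -> measurable U.
Proof.
move=> oU.
have b2 := nbhs_basis_prod (@nbhs_basis_rat R) (@nbhs_basis_rat R).
rewrite (open_bigcup_basis (nbhs_basis_prod b2 b2) oU).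
apply: bigcup_measurable => n _; case: ifP => // _.
by case: unpickle => // k; apply: measurableX; (case: unpickle => // l;
  apply: measurableX; rewrite /rat_itv; case: unpickle => // p; exact: measurable_itv).
Qed.

Lemma open_continuous_measurable_C2 (R : realType) (U : set (C2 R)) (f : C2 R -> R) :
  open U -> {in U, continuous f} -> measurable_fun U f.
Proof.
move=> oU cf mU; apply: (measurability _ (RGenOpens.measurableE R)) => //.
move=> _ [_ [a [b ->] <-]]; apply: open_measurable_C2.
rewrite openE => x [Ux fx]; apply: filterI; first exact: open_nbhs_nbhs.
apply: (cf x); rewrite ?inE//; apply: open_nbhs_nbhs; split => //.
Qed.

Lemma continuous_measurable_C2 (R : realType) (f : C2 R -> R) :
  continuous f -> measurable_fun setT f.
Proof.
by move=> cf; apply: open_continuous_measurable_C2 => [|x _]; [exact: openT|exact: cf].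
Qed.

(** * Translation invariance and uniqueness of Lebesgue measure on C^2 *)

Section ProductMeasure.
Local Open Scope ereal_scope.
Context {d1 d2} {T1 : measurableType d1} {T2 : measurableType d2} {R : realType}.
Context (m1 : {sigma_finite_measure set T1 -> \bar R})
          (m2 : {sigma_finite_measure set T2 -> \bar R}).

(** The product measure integrates the x-sections by definition; integrating the
    y-sections gives a measure with the same values on rectangles, hence the
    same measure. *)
Lemma product_measure_ysection (A : set (T1 * T2)) : measurable A ->
  (m1 \x m2) A = \int[m2]_y m1 (ysection A y).
Proof.
move=> mA; rewrite (@product_measure_unique _ _ _ _ _ m1 m2 (m1 \x^ m2)%E)//.
by move=> B C mB mC; exact: product_measure2E.
Qed.

(** The image of the product measure under f x g takes the right values on
    rectangles, which determine it. *)
Lemma product_measure_invariant (f : T1 -> T1) (g : T2 -> T2) :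
  measurable_fun setT f -> measurable_fun setT g ->
  (forall A, measurable A -> m1 (f @^-1` A) = m1 A) ->
  (forall A, measurable A -> m2 (g @^-1` A) = m2 A) ->
  forall X, measurable X ->
    (m1 \x m2) ((fun p => (f p.1, g p.2)) @^-1` X) = (m1 \x m2) X.
Proof.
move=> mf mg fi gi X mX.
have mfg : measurable_fun setT (fun p : T1 * T2 => (f p.1, g p.2)).
  apply: measurable_fun_pair; apply: measurableT_comp => //.
pose nu : {measure set (T1 * T2) -> \bar R} :=
  measure_function_pushforward__canonical__measure_function_Measure (m1 \x m2) mfg.
apply/esym; apply: (product_measure_unique (m' := nu)) => // A B mA mB.
rewrite -(fi A)// -(gi B)//.
rewrite -product_measure1E//.
- by rewrite -[X in measurable X]setTI; exact: mf.
- by rewrite -[X in measurable X]setTI; exact: mg.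
Qed.

End ProductMeasure.

Section Haar.
Local Open Scope ereal_scope.
Context {R : realType}.

Lemma lebesgue_measure_translation (v : R) (A : set R) : measurable A ->
  lebesgue_measure ((fun x => x + v)%R @^-1` A) = lebesgue_measure A.
Proof.
move=> mA.
have mf : measurable_fun [set: measurableTypeR R] (fun x => x + v : measurableTypeR R)%R.
  exact: measurable_funD.
pose nu : {measure set (measurableTypeR R) -> \bar R} :=
  measure_function_pushforward__canonical__measure_function_Measure (@lebesgue_measure R) mf.
apply/esym; apply: (lebesgue_measure_unique (mu := nu)) => // _ [[a b] _ <-] /=.
rewrite /nu /= /pushforward.
have -> : (fun x => x + v)%R @^-1` `]a, b] = `](a - v)%R, (b - v)%R]%classic.
  by apply/seteqP; split => x /=; rewrite !in_itv /= ltrBlDr lerBrDr.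
rewrite !lebesgue_measure_itv /= !lte_fin ltrD2r; case: ifP => // _.
by rewrite !EFinD; congr (_%:E); lra.
Qed.

Lemma lebC2_translation (v : C2 R) (A : set (C2 R)) : measurable A ->
  lebC2 ((fun x => x + v)%R @^-1` A) = lebC2 A.
Proof.
move=> mA.
have m1 (w : R) : measurable_fun [set: R] (fun x : R => x + w)%R.
  exact: measurable_funD.
have m2 (w : R * R) : measurable_fun [set: R * R] (fun x : R * R => (x.1 + w.1, x.2 + w.2))%R.
  by apply: measurable_fun_pair; apply: measurable_funD.
have i2 (w : R * R) (B : set (R * R)) : measurable B ->
    lebR2 ((fun x : R * R => (x.1 + w.1, x.2 + w.2))%R @^-1` B) = lebR2 B.
  apply: (@product_measure_invariant _ _ _ _ _ lebesgue_measure lebesgue_measure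
    (fun x => x + w.1)%R (fun x => x + w.2)%R); [exact: m1|exact: m1| |];
    exact: lebesgue_measure_translation.
exact: (@product_measure_invariant _ _ _ _ _ lebR2 lebR2 _ _ (m2 v.1) (m2 v.2) (i2 v.1) (i2 v.2)).
Qed.

Lemma measurable_add_C2 : measurable_fun [set: C2 R * C2 R] (fun p : C2 R * C2 R => p.1 + p.2 : C2 R)%R.
Proof.
apply: measurable_fun_pair; apply: measurable_fun_pair; apply: measurable_funD.
- exact: (measurableT_comp measurable_fst (measurableT_comp measurable_fst measurable_fst)).
- exact: (measurableT_comp measurable_fst (measurableT_comp measurable_fst measurable_snd)).
- exact: (measurableT_comp measurable_snd (measurableT_comp measurable_fst measurable_fst)).
- exact: (measurableT_comp measurable_snd (measurableT_comp measurable_fst measurable_snd)).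
- exact: (measurableT_comp measurable_fst (measurableT_comp measurable_snd measurable_fst)).
- exact: (measurableT_comp measurable_fst (measurableT_comp measurable_snd measurable_snd)).
- exact: (measurableT_comp measurable_snd (measurableT_comp measurable_snd measurable_fst)).
- exact: (measurableT_comp measurable_snd (measurableT_comp measurable_snd measurable_snd)).
Qed.

Lemma measurable_opp_C2 : measurable_fun [set: C2 R] (fun x : C2 R => - x : C2 R)%R.
Proof.
apply: measurable_fun_pair; apply: measurable_fun_pair; apply: measurable_funN;
  by [exact: (measurableT_comp measurable_fst)|exact: (measurableT_comp measurable_snd)].
Qed.

Lemma measurable_sub_C2 : measurable_fun [set: C2 R * C2 R] (fun p : C2 R * C2 R => p.1 - p.2 : C2 R)%R.
Proof.
have : measurable_fun setT (fun p : C2 R * C2 R => (p.1, - p.2 : C2 R)%R).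
  apply: measurable_fun_pair; first exact: measurable_fst.
  exact: (measurableT_comp measurable_opp_C2 measurable_snd).
exact: (measurableT_comp measurable_add_C2).
Qed.

Lemma product_measure_if (d1 d2 : measure_display) (T1 : measurableType d1) (T2 : measurableType d2)
    (m1 : {measure set T1 -> \bar R}) (m2 : {sigma_finite_measure set T2 -> \bar R})
    (B : set T1) (S : set (T1 * T2)) (c : \bar R) :
  measurable B -> 0 <= c ->
  (forall x, m2 (xsection S x) = if x \in B then c else 0) ->
  (m1 \x m2) S = c * m1 B.
Proof.
move=> mB c0 H; rewrite /product_measure1.
rewrite (eq_integral (fun x => c * (\1_B x)%:E)); last first.
  by move=> x _ /=; rewrite H indicE; case: ifP; rewrite ?mule1 ?mule0.
rewrite ge0_integralZl//; first by rewrite integral_indic// setIT.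
exact/measurable_EFinP/measurable_indic.
Qed.

(** Uniqueness of Haar measure. The two sides are the measures of the sets S1
    and S2 of the proof, computed by integrating x-sections; their y-sections
    are translates of each other, so integrating those shows that the measures
    agree. *)
Lemma lebC2_haar (nu : {sigma_finite_measure set (C2 R) -> \bar R}) (E F : set (C2 R)) :
  (forall (v : C2 R) (A : set (C2 R)), measurable A -> nu ((fun x : C2 R => x + v)%R @^-1` A) = nu A) ->
  measurable E -> measurable F -> (forall x, F x -> F (- x)%R) ->
  lebC2 E * nu F = nu E * lebC2 F.
Proof.
move=> nui mE mF sF.
pose S1 : set (C2 R * C2 R) := (fun p : C2 R * C2 R => p.1) @^-1` E `&` (fun p : C2 R * C2 R => p.1 - p.2)%R @^-1` F.
pose S2 : set (C2 R * C2 R) := (fun p : C2 R * C2 R => p.1 + p.2)%R @^-1` E `&` (fun p : C2 R * C2 R => p.1) @^-1` F.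
have mS1 : measurable S1.
  by apply: measurableI; rewrite -[X in measurable X]setTI; [exact: measurable_fst|exact: measurable_sub_C2].
have mS2 : measurable S2.
  by apply: measurableI; rewrite -[X in measurable X]setTI; [exact: measurable_add_C2|exact: measurable_fst].
have e1 : (lebC2 \x nu) S1 = nu F * lebC2 E.
  apply: product_measure_if => // x; case: ifPn; rewrite ?inE ?notin_setE => Ex.
    rewrite -(nui (- x)%R)//; congr (nu _); apply/seteqP; split => y /=.
      by rewrite /xsection /= inE => -[_ /= /sF]; rewrite opprB.
    by rewrite /xsection /= inE => /sF; rewrite opprB.
  rewrite (_ : xsection S1 x = set0) ?measure0// -subset0 => y.
  by rewrite /xsection /= inE => -[].
have e2 : (lebC2 \x nu) S2 = nu E * lebC2 F.
  apply: product_measure_if => // x; case: ifPn; rewrite ?inE ?notin_setE => Fx.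
    rewrite -(nui x)//; congr (nu _); apply/seteqP; split => y /=.
      by rewrite /xsection /= inE => -[/=]; rewrite addrC.
    by rewrite /xsection /= inE => Exy; split => //=; rewrite addrC.
  rewrite (_ : xsection S2 x = set0) ?measure0// -subset0 => y.
  by rewrite /xsection /= inE => -[].
rewrite muleC -e1 -e2.
rewrite (product_measure_ysection lebC2 nu mS1) (product_measure_ysection lebC2 nu mS2).
apply: eq_integral => y _.
have -> : ysection S2 y = (fun x => x + y)%R @^-1` ysection S1 y.
  by apply/seteqP; split => x; rewrite /ysection /= !inE /S1 /S2 /= addrK.
apply/esym; apply: lebC2_translation; exact: measurable_ysection.
Qed.

End Haar.

(** * Lebesgue measure under similarities *)

Section Similarity.
Context {R : realType}.
Implicit Types (x y v : C2 R) (s r : R).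

Definition sqnormC2 (x : C2 R) : R := x.1.1 ^+ 2 + x.1.2 ^+ 2 + (x.2.1 ^+ 2 + x.2.2 ^+ 2).

Definition cubeC2 (r : R) : set (C2 R) :=
  (`[- r, r] `*` `[- r, r]) `*` (`[- r, r] `*` `[- r, r]).

Lemma measurable_cubeC2 r : measurable (cubeC2 r).
Proof. by do !apply: measurableX. Qed.

Lemma lebC2_cube r : 0 <= r -> lebC2 (cubeC2 r) = ((r *+ 2) ^+ 4)%:E.
Proof.
move=> r0.
have e1 : lebesgue_measure (`[- r, r]%classic : set R) = (r *+ 2)%:E.
  rewrite lebesgue_measure_itv /= lte_fin; case: ltP => h.
    by rewrite -EFinB opprK mulr2n.
  by have -> : r = 0; [lra|rewrite mul0rn].
have e2 : lebR2 (`[- r, r]%classic `*` `[- r, r]%classic : set (R * R)) = ((r *+ 2) ^+ 2)%:E.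
  by rewrite /lebR2 product_measure1E// [X in (X * _)%E]e1 [X in (_ * X)%E]e1 -EFinM.
rewrite /lebC2 product_measure1E//; [|exact: measurableX..].
by rewrite [X in (X * _)%E]e2 [X in (_ * X)%E]e2 -EFinM -exprD.
Qed.

Lemma measurable_sqnormC2 : measurable_fun [set: C2 R] sqnormC2.
Proof.
by apply: measurable_funD; apply: measurable_funD; apply: measurable_funX;
  repeat (apply: measurableT_comp => //).
Qed.

Definition eballC2 r : set (C2 R) := [set x | sqnormC2 x <= r].

Lemma measurable_eballC2 r : measurable (eballC2 r).
Proof.
have -> : eballC2 r = [set: C2 R] `&` sqnormC2 @^-1` `]-oo, r].
  by apply/seteqP; split => x /=; rewrite in_itv /=; [split|case].
exact: measurable_sqnormC2.
Qed.

Lemma sqnormC2Z s x : sqnormC2 (s *: x) = s ^+ 2 * sqnormC2 x.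
Proof.
case: x => [[a b] [c d]].
have -> : s *: ((a, b), (c, d)) = ((s * a, s * b), (s * c, s * d)) :> C2 R by [].
by rewrite /sqnormC2 /=; ring.
Qed.

Lemma lebC2_eball_gt0 : (0 < lebC2 (eballC2 1))%E.
Proof.
apply: (@lt_le_trans _ _ (lebC2 (cubeC2 2^-1))).
  by rewrite lebC2_cube// lte_fin exprn_gt0// pmulrn_lgt0.
apply: le_measure; rewrite ?inE; [exact: measurable_cubeC2|exact: measurable_eballC2|].
move=> [[a b] [c d]] [[/=]]; rewrite !in_itv /= => /andP[a1 a2] /andP[b1 b2] [].
move=> /andP[c1 c2] /andP[d1 d2].
rewrite /eballC2 /= /sqnormC2 /=.
have h (t : R) : - 2^-1 <= t -> t <= 2^-1 -> t ^+ 2 <= 4^-1 by move=> *; nra.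
by have := h _ a1 a2; have := h _ b1 b2; have := h _ c1 c2; have := h _ d1 d2; lra.
Qed.

Lemma eballC2_cubeC2 r : 0 <= r -> eballC2 (r ^+ 2) `<=` cubeC2 r.
Proof.
move=> r0; have h (t k : R) : 0 <= k -> t ^+ 2 + k <= r ^+ 2 -> (- r <= t) && (t <= r).
  by move=> *; apply/andP; split; nra.
move=> [[a b] [c d]]; rewrite /eballC2 /= /sqnormC2 /= => H.
have := sqr_ge0 a; have := sqr_ge0 b; have := sqr_ge0 c; have := sqr_ge0 d => *.
split; split; rewrite /= in_itv /=.
- by apply: (h _ (b ^+ 2 + (c ^+ 2 + d ^+ 2))); lra.
- by apply: (h _ (a ^+ 2 + (c ^+ 2 + d ^+ 2))); lra.
- by apply: (h _ (b ^+ 2 + (a ^+ 2 + d ^+ 2))); lra.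
- by apply: (h _ (b ^+ 2 + (c ^+ 2 + a ^+ 2))); lra.
Qed.

Lemma lebC2_eball_fin r : 0 <= r -> (lebC2 (eballC2 (r ^+ 2)) < +oo)%E.
Proof.
move=> r0; apply: (@le_lt_trans _ _ (lebC2 (cubeC2 r))); last by rewrite lebC2_cube// ltry.
by apply: le_measure; rewrite ?inE; [exact: measurable_eballC2|exact: measurable_cubeC2|exact: eballC2_cubeC2].
Qed.

(* Unification would otherwise unfold the product measure. *)
Opaque lebC2.
(** The image of Lebesgue measure under a linear bijection is translation
    invariant, so [lebC2_haar] compares it with Lebesgue measure. *)
Lemma lebC2_linear_haar (L Linv : C2 R -> C2 R) (E F : set (C2 R)) :
  measurable_fun setT L -> measurable_fun setT Linv ->
  cancel L Linv -> cancel Linv L -> {morph L : x y / x + y} ->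
  measurable E -> measurable F -> (forall x, F x -> F (- x)) ->
  (lebC2 E * lebC2 (L @^-1` F) = lebC2 (L @^-1` E) * lebC2 F)%E.
Proof.
move=> mL mLi LK KL Lm mE mF sF.
pose nu0 : {measure set (C2 R) -> \bar R} :=
  measure_function_pushforward__canonical__measure_function_Measure (@lebC2 R) mL.
have sf : sigma_finite setT nu0.
  have [G GT Gf] := sigma_finiteT (@lebC2 R).
  exists (fun n => Linv @^-1` G n).
    by rewrite -preimage_bigcup -GT preimage_setT.
  move=> n; have [mG Gn] := Gf n; split.
    by rewrite -[X in measurable X]setTI; exact: mLi.
  rewrite /nu0 /= /pushforward (_ : L @^-1` _ = G n)//.
  by apply/seteqP; split => x /=; rewrite LK.
pose nu1 := Measure_isSigmaFinite.Build _ _ _ nu0 sf.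
pose nu : {sigma_finite_measure set (C2 R) -> \bar R} := HB.pack (Measure.sort nu0) (Measure.class nu0) nu1.
refine (@lebC2_haar R nu E F _ mE mF sF) => v A mA.
have mLA : measurable (L @^-1` A) by rewrite -[X in measurable X]setTI; exact: (mL measurableT _ mA).
have := lebC2_translation (Linv v) mLA.
rewrite (_ : _ @^-1` (L @^-1` A) = L @^-1` ((fun x : C2 R => x + v) @^-1` A))//.
by apply/seteqP; split => x /=; rewrite Lm KL.
Qed.

Lemma cubeC2_preimageZ s : 0 < s ->
  (fun x : C2 R => s *: x : C2 R) @^-1` cubeC2 1 = cubeC2 s^-1.
Proof.
move=> s0.
have h (t : R) : (-1 <= s * t <= 1) = (- s^-1 <= t <= s^-1).
  by rewrite -(ler_pM2l s0 (- s^-1) t) -(ler_pM2l s0 t) mulrN mulfV// gt_eqF.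
by apply/seteqP; split => -[[a b] [c d]]; rewrite /cubeC2 /GRing.scale /= !in_itv /= !h.
Qed.

(** The image of Lebesgue measure under L is a multiple of it. The factor can be
    read off on the unit ball, whose preimage under L is also its preimage under
    the homothety x |-> s x; for the homothety the factor is computed on cubes.
    *)
Lemma lebC2_similarity (L Linv : C2 R -> C2 R) (s : R) (E : set (C2 R)) :
  measurable_fun setT L -> measurable_fun setT Linv ->
  cancel L Linv -> cancel Linv L -> {morph L : x y / x + y} -> 0 < s ->
  (forall x, sqnormC2 (L x) = s ^+ 2 * sqnormC2 x) ->
  measurable E ->
  lebC2 (L @^-1` E) = (((s ^+ 4)^-1)%:E * lebC2 E)%E.
Proof.
move=> mL mLi LK KL Lm s0 nL mE.
have mD (t : R) : measurable_fun setT (fun x : C2 R => t *: x : C2 R).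
  by apply: measurable_fun_pair; apply: measurable_fun_pair;
    (apply: measurable_funM => //; repeat (apply: measurableT_comp => //)).
have symB x : eballC2 1 x -> eballC2 1 (- x).
  by rewrite /eballC2 /= -scaleN1r sqnormC2Z sqrrN expr1n mul1r.
have symQ x : cubeC2 1 x -> cubeC2 1 (- x).
  by case: x => [[a b] [c d]]; rewrite /cubeC2 /= !in_itv /= => -[[]] /andP[? ?] /andP[? ?] [] /andP[? ?] /andP[? ?];
   do !split; apply/andP; split; lra.
have s1 : s^-1 * s = 1 by rewrite mulVf// gt_eqF.
have H1 : (lebC2 (eballC2 1) * lebC2 ((fun x : C2 R => s *: x : C2 R) @^-1` cubeC2 1) =
   lebC2 ((fun x : C2 R => s *: x : C2 R) @^-1` eballC2 1) * lebC2 (cubeC2 1))%E.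
  apply: (@lebC2_linear_haar (fun x : C2 R => s *: x : C2 R) (fun x : C2 R => s^-1 *: x : C2 R)) => //.
  - by move=> x; rewrite scalerA s1 scale1r.
  - by move=> x; rewrite scalerA mulrC s1 scale1r.
  - by move=> x y; rewrite scalerDr.
  - exact: measurable_eballC2.
  - exact: measurable_cubeC2.
have H2 := lebC2_linear_haar mL mLi LK KL Lm mE (measurable_eballC2 1) symB.
have EB : L @^-1` eballC2 1 = (fun x : C2 R => s *: x : C2 R) @^-1` eballC2 1.
  by apply/seteqP; split => x; rewrite /eballC2 /= nL sqnormC2Z.
have EQ := cubeC2_preimageZ s0.
have si0 : 0 <= s^-1 by rewrite invr_ge0 ltW.
rewrite EB in H2; rewrite EQ (lebC2_cube ler01) (lebC2_cube si0) in H1.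
move: H1 H2; have := lebC2_eball_gt0; have := lebC2_eball_fin ler01; rewrite expr1n.
case: (lebC2 (eballC2 1)) => // b _; rewrite lte_fin => b0.
case: (lebC2 (_ @^-1` eballC2 1)) => [c| |].
- rewrite -!EFinM => -[cE] H2.
  have {}cE : c = b * (s ^+ 4)^-1.
    apply: (@mulIf _ ((1 *+ 2) ^+ 4)); first by rewrite expf_neq0// pnatr_eq0.
    rewrite -cE -mulrA; congr (b * _); rewrite -[s^-1 *+ 2]mulr_natr exprMn exprVn.
    by [].
  have bn0 : b != 0 by rewrite gt_eqF.
  have bK (x : \bar R) : (x = x * b%:E * b^-1%:E)%E.
    by rewrite -muleA -EFinM mulfV// mule1.
  rewrite [LHS]bK -H2 cE -muleA -EFinM muleC; congr (_%:E * _)%E.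
  by rewrite mulrAC mulfV// mul1r.
- by rewrite gt0_mulye ?lte_fin ?exprn_gt0// -EFinM.
- by rewrite gt0_mulNye ?lte_fin ?exprn_gt0// -EFinM.
Qed.

End Similarity.

(** * Riesz representation *)

Section Hilbert.
Context {R : realType}.
Local Notation Re := (@complex.Re R).
Local Notation Im := (@complex.Im R).
Implicit Types (f g h : C2 R -> R[i]) (U : set (C2 R)).

Lemma ReD (x y : R[i]) : Re (x + y) = Re x + Re y. Proof. by case: x y => [? ?] [? ?]. Qed.
Lemma ImD (x y : R[i]) : Im (x + y) = Im x + Im y. Proof. by case: x y => [? ?] [? ?]. Qed.
Lemma ReN (x : R[i]) : Re (- x) = - Re x. Proof. by case: x. Qed.
Lemma ImN (x : R[i]) : Im (- x) = - Im x. Proof. by case: x. Qed.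
Lemma ReJ (x : R[i]) : Re x^* = Re x. Proof. by case: x. Qed.
Lemma ImJ (x : R[i]) : Im x^* = - Im x. Proof. by case: x. Qed.
Lemma ReZ (t : R) (x : R[i]) : Re (t%:C * x) = t * Re x.
Proof. by case: x => a b /=; rewrite mul0r subr0. Qed.
Lemma ImZ (t : R) (x : R[i]) : Im (t%:C * x) = t * Im x.
Proof. by case: x => a b /=; rewrite mul0r addr0. Qed.
Lemma ReM (x y : R[i]) : Re (x * y) = Re x * Re y - Im x * Im y.
Proof. by case: x y => [? ?] [? ?]. Qed.
Lemma ImM (x y : R[i]) : Im (x * y) = Re x * Im y + Im x * Re y.
Proof. by case: x y => [? ?] [? ?]. Qed.
Lemma ReI (x : R[i]) : Re ('i * x) = - Im x.
Proof. by rewrite ReM /= mul0r mul1r sub0r. Qed.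
Lemma ImI (x : R[i]) : Im ('i * x) = Re x.
Proof. by rewrite ImM /= mul0r mul1r add0r. Qed.
Lemma complexE (x y : R[i]) : Re x = Re y -> Im x = Im y -> x = y.
Proof. by case: x y => [? ?] [? ?] /= -> ->. Qed.

Lemma quadratic_ge0_sqr_le (p q r : R) : 0 <= p ->
  (forall t, 0 <= t ^+ 2 * p + 2 * t * q + r) -> q ^+ 2 <= p * r.
Proof.
move=> p0 H; have [p_gt0|p_le0] := ltP 0 p.
  have := H (- q / p).
  have -> : (- q / p) ^+ 2 * p + 2 * (- q / p) * q + r = (p * r - q ^+ 2) / p.
    by field; rewrite gt_eqF.
  by rewrite pmulr_lge0 ?invr_gt0// subr_ge0.
have p_eq0 : p = 0 by apply/eqP; rewrite eq_le p0 p_le0.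
have [->|q0] := eqVneq q 0; first by rewrite expr0n /= p_eq0 mul0r.
(* a point at which the affine function t |-> 2 t q + r equals -1 *)
have := H (- (r + 1) / (2 * q)).
suff -> : (- (r + 1) / (2 * q)) ^+ 2 * p + 2 * (- (r + 1) / (2 * q)) * q + r = -1 by lra.
by rewrite p_eq0; field.
Qed.

Section Riesz.
Context (U : set (C2 R)) (E : set (C2 R -> R[i])).
Context (ip : (C2 R -> R[i]) -> (C2 R -> R[i]) -> R[i]).
Context (HE : hilbert_space U E ip).

Let N f := Re (ip f f).
Let r f g := Re (ip f g).

Lemma hilbert_mul (c : R[i]) f : E f -> E (fun x => c * f x).
Proof.
move=> Ef; have := hilbert_lin HE c Ef (hilbert0 HE).
by rewrite (_ : (fun x => _) = (fun x => c * f x))//; apply/funext => x; rewrite addr0.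
Qed.

Lemma hilbert_sub f g : E f -> E g -> E (fun x => f x - g x).
Proof.
move=> Ef Eg; have := hilbert_lin HE (-1) Eg Ef.
by rewrite (_ : (fun x => _) = (fun x => f x - g x))//; apply/funext => x; rewrite mulN1r addrC.
Qed.

Lemma hilbert_ip_sub f g h : E f -> E g -> E h ->
  ip h (fun x => f x - g x) = ip h f - ip h g.
Proof.
move=> Ef Eg Eh; have := hilbert_ip_lin HE (-1) Eg Ef Eh.
rewrite (_ : (fun x => _) = (fun x => f x - g x)); first by rewrite mulN1r addrC.
by apply/funext => x; rewrite mulN1r addrC.
Qed.

Lemma hilbert_ip_mul (c : R[i]) f h : E f -> E h ->
  ip h (fun x => c * f x) = c * ip h f.
Proof.
move=> Ef Eh; have := hilbert_ip_lin HE c Ef (hilbert0 HE) Eh.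
have : ip h (fun=> 0) = 0.
  have := hilbert_ip_sub (hilbert0 HE) (hilbert0 HE) Eh.
  rewrite (_ : (fun x => _) = (fun=> 0)); first by rewrite subrr.
  by apply/funext => x; rewrite subrr.
move=> ->; rewrite addr0 (_ : (fun x => _) = (fun x => c * f x))//.
by apply/funext => x; rewrite addr0.
Qed.

Let r_sym f g : E f -> E g -> r f g = r g f.
Proof. by move=> Ef Eg; rewrite /r (hilbert_ip_herm HE Eg Ef) ReJ. Qed.

Let r_lin (t : R) f g h : E f -> E g -> E h ->
  r h (fun x => t%:C * f x + g x) = t * r h f + r h g.
Proof. by move=> *; rewrite /r (hilbert_ip_lin HE)// ReD ReZ. Qed.

Let r_sub f g h : E f -> E g -> E h ->
  r h (fun x => f x - g x) = r h f - r h g.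
Proof. by move=> *; rewrite /r hilbert_ip_sub// ReD ReN. Qed.

Let N_ge0 f : E f -> 0 <= N f.
Proof.
by move=> /(hilbert_ip_ge0 HE); rewrite /N; case: (ip f f) => a b; rewrite lecE /= => /andP[].
Qed.

Let N_lin (t : R) f g : E f -> E g ->
  N (fun x => t%:C * f x + g x) = t ^+ 2 * N f + 2 * t * r f g + N g.
Proof.
move=> Ef Eg; have Eh := hilbert_lin HE t%:C Ef Eg.
rewrite /N -/(r _ _) r_lin// r_sym// (r_sym Eh Eg) !r_lin// (r_sym Eg Ef) /r; ring.
Qed.

Lemma hilbert_cauchy_schwarz f g : E f -> E g -> r f g ^+ 2 <= N f * N g.
Proof.
move=> Ef Eg; apply: quadratic_ge0_sqr_le => [|t]; first exact: N_ge0.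
by rewrite -N_lin//; apply: N_ge0; exact: (hilbert_lin HE).
Qed.

Let N_ipnorm f (e : R) : E f -> 0 < e -> (ipnorm ip f < e) = (N f < e ^+ 2).
Proof.
move=> Ef e0; rewrite /ipnorm -[X in _ < X](ger0_norm (ltW e0)) -sqrtr_sqr ltr_sqrt//.
by rewrite exprn_gt0.
Qed.

(** The representing vector is the minimizer f of Phi g = |g|^2 - 2 Re (l g), at
    which the differential of Phi vanishes. A minimizing sequence u is Cauchy by
    convexity of Phi; as its limit is only known in norm, the differential is
    tested on Phi (t k + u n) with an error that tends to 0. This determines Re
    l, and then Im (l h) = - Re (l (i h)). *)
Lemma riesz (l : (C2 R -> R[i]) -> R[i]) (C : R) :
  (forall c f g, E f -> E g -> l (fun x => c * f x + g x) = c * l f + l g) ->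
  (forall f, E f -> Re (l f) ^+ 2 <= C * Re (ip f f)) ->
  exists2 g, E g & forall f, E f -> l f = ip g f.
Proof.
move=> l_lin lC.
have E0 := hilbert0 HE.
pose Phi f := N f - 2 * Re (l f).
have PhiC f : E f -> - `|C| <= Phi f.
  move=> Ef; have := lC _ Ef; have := N_ge0 Ef; rewrite /Phi -/(N f) => N0 h.
  have {}h : Re (l f) ^+ 2 <= `|C| * N f by apply: (le_trans h); rewrite ler_wpM2r// ler_norm.
  rewrite lerNl opprB lerBlDr leNgt; apply/negP => h2.
  have := normr_ge0 C => h3.
  have : (`|C| + N f) ^+ 2 < (2 * Re (l f)) ^+ 2 by rewrite ltr_sqr ?nnegrE//; lra.
  rewrite exprMn; have := sqr_ge0 (`|C| - N f); lra.
pose d := inf (Phi @` E).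
have Phi_inf : has_inf (Phi @` E).
  split; first by exists (Phi (fun=> 0)); exists (fun=> 0).
  by exists (- `|C|) => _ [f Ef <-]; exact: PhiC.
have dPhi f : E f -> d <= Phi f.
  by move=> Ef; apply: ge_inf; [exact: Phi_inf.2|exists f].
have /choice[u uP] : forall n : nat, exists g, E g /\ Phi g < d + n.+1%:R^-1.
  move=> n; have [_ [g Eg <-] gd] := inf_adherent (ltac:(by rewrite invr_gt0) : 0 < n.+1%:R^-1 :> R) Phi_inf.
  by exists g.
have uE n := (uP n).1; have ud n := (uP n).2.
have Phi_lin (t : R) f g : E f -> E g ->
    Phi (fun x => t%:C * f x + g x) = t ^+ 2 * N f + 2 * t * (r f g - Re (l f)) + Phi g.
  by move=> Ef Eg; rewrite /Phi N_lin// l_lin// ReD ReZ; ring.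
have small (e : R) : 0 < e -> exists N0, forall n, (N0 <= n)%N -> n.+1%:R^-1 < e :> R.
  move=> e0; have [N0 _ H] := near_infty_natSinv_lt (PosNum e0).
  by exists N0 => n; exact: H.
have ucauchy m n : N (fun x => u m x - u n x) <= 2 * m.+1%:R^-1 + 2 * n.+1%:R^-1.
  have Ed := hilbert_sub (uE m) (uE n).
  (* Phi at the midpoint of u m and u n is at least d *)
  have := dPhi _ (hilbert_lin HE (- 2^-1)%:C Ed (uE m)).
  rewrite Phi_lin//; have := dPhi _ (uE m); have := dPhi _ (uE n); have := ud m; have := ud n.
  have : Phi (u n) = Phi (fun x => (-1)%:C * (u m x - u n x) + u m x).
    by congr Phi; apply/funext => x; rewrite rmorphN1 mulN1r opprB subrK.
  rewrite Phi_lin//.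
  have -> : (- 2^-1) ^+ 2 = 4^-1 :> R by field.
  rewrite sqrrN expr1n mul1r.
  set ND := N _; set q := r _ _ - _; set a := _^-1; set b := _^-1.
  rewrite -/d; lra.
have [f Ef fP] : exists2 f, E f & forall eps : R, 0 < eps -> exists N, forall n, (N <= n)%N ->
       ipnorm ip (fun x => u n x - f x) < eps.
  apply: (hilbert_complete HE) => // e e0.
  have [N0 H] := small (e ^+ 2 / 4) (ltac:(by rewrite divr_gt0// exprn_gt0)).
  exists N0 => m n mN nN; rewrite N_ipnorm//; last exact: hilbert_sub.
  by apply: (le_lt_trans (ucauchy m n)); have := H _ mN; have := H _ nN; move: (m.+1%:R^-1) (n.+1%:R^-1) => a b0; lra.
exists f => // h Eh.
have key k : E k -> Re (l k) = r f k.
  move=> Ek; have Nk0 := N_ge0 Ek; pose q := r f k - Re (l k).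
  have H t : 0 <= t ^+ 2 * N k + 2 * t * q.
    suff H (e : R) : 0 < e -> - e <= t ^+ 2 * N k + 2 * t * q.
      by apply/ler_addgt0Pr => e e0; rewrite -lerBlDr sub0r; exact: H.
    move=> e0.
    (* keeps 2 |t| |r k (u n) - r k f| below e / 2 *)
    pose e2 := e / 2 / (1 + 2 * `|t| * (N k + 1)).
    have D0 : 0 < 1 + 2 * `|t| * (N k + 1).
      by rewrite ltr_pwDl// !mulr_ge0// addr_ge0.
    have e20 : 0 < e2 by rewrite divr_gt0// divr_gt0.
    have [N1 H1] := small (e / 2) (ltac:(by rewrite divr_gt0)).
    have [N2 H2] := fP _ e20.
    pose n := maxn N1 N2.
    have {}H1 := H1 n (leq_maxl _ _); have {}H2 := H2 n (leq_maxr _ _).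
    have Eun := hilbert_sub (uE n) Ef.
    rewrite N_ipnorm// in H2.
    have := dPhi _ (hilbert_lin HE t%:C Ek (uE n)).
    rewrite Phi_lin// => H3; have H4 := ud n.
    have CS := hilbert_cauchy_schwarz Ek Eun; rewrite r_sub// in CS.
    have : `|r k (u n) - r k f| <= e2 * (N k + 1).
      have Nk1 : 0 <= N k + 1 by rewrite addr_ge0.
      have Nk2 : 0 <= e2 * (N k + 1) by exact: mulr_ge0 (ltW e20) Nk1.
      rewrite -(@ler_pXn2r _ 2) ?nnegrE// real_normK ?num_real//.
      rewrite (le_trans CS)// exprMn mulrC ler_pM//; [exact: N_ge0|exact: ltW|].
      rewrite -/(N k) sqrrD expr1n mulr1; nra.
    move=> H5.
    have H6 : `|2 * t * (r k (u n) - r k f)| <= e / 2.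
      rewrite normrM (le_trans (ler_wpM2l (normr_ge0 _) H5))//.
      rewrite normrM ger0_norm// /e2.
      have -> : 2 * `|t| * (e / 2 / (1 + 2 * `|t| * (N k + 1)) * (N k + 1)) =
         (e / 2) * ((2 * `|t| * (N k + 1)) / (1 + 2 * `|t| * (N k + 1))).
        by field; rewrite gt_eqF.
      by rewrite ler_piMr ?divr_ge0 ?ltW// ltr_pdivrMr// mul1r ltrDr.
    rewrite /q (r_sym Ef Ek).
    have := ler_norm (2 * t * (r k (u n) - r k f)).
    move: H1 H4 H6 H3; move: (n.+1%:R^-1) => a H1 H4 H6 H3; lra.
  have : q ^+ 2 <= N k * 0 by apply: quadratic_ge0_sqr_le => // t; rewrite addr0.
  rewrite mulr0 => q2; have : q == 0 by rewrite -sqrf_eq0 eq_le q2 sqr_ge0.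
  by rewrite subr_eq0 => /eqP.
apply: complexE; first exact: key.
have Eih := hilbert_mul 'i Eh.
have := key _ Eih; rewrite /r hilbert_ip_mul// ReI.
have -> : l (fun x => 'i * h x) = 'i * l h.
  have -> : (fun x => 'i * h x) = (fun x => 'i * h x + (fun=> 0) x) by apply/funext => x; rewrite addr0.
  rewrite l_lin//.
  suff -> : l (fun=> 0) = 0 by rewrite addr0.
  have := l_lin 1 _ _ E0 E0; rewrite (_ : (fun x => _) = (fun=> 0)).
    by rewrite mul1r -[LHS]addr0 => /addrI.
  by apply/funext => x; rewrite mulr0 addr0.
by rewrite ReI => /oppr_inj.
Qed.

End Riesz.
End Hilbert.

(** * Weighted L2 spaces *)

Section L2theory.
Context {R : realType}.
Local Notation Re := (@complex.Re R).
Local Notation Im := (@complex.Im R).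
Local Notation mu := (@lebC2 R).
Implicit Types (f g h : C2 R -> R[i]) (U : set (C2 R)).

Definition sqn (z : R[i]) : R := Re z ^+ 2 + Im z ^+ 2.

Lemma sqn_ge0 z : 0 <= sqn z. Proof. by rewrite addr_ge0 ?sqr_ge0. Qed.

Lemma sqnM z w : sqn (z * w) = sqn z * sqn w.
Proof. by rewrite /sqn ReM ImM; ring. Qed.

Lemma normc_sqn (z : R[i]) : ComplexField.Normc.normc z ^+ 2 = sqn z.
Proof. by case: z => a b; rewrite /= sqr_sqrtr// addr_ge0 ?sqr_ge0. Qed.

Lemma mulJ_sqn (z : R[i]) : z^* * z = (sqn z)%:C.
Proof. by apply: complexE; rewrite ?ReM ?ImM ?ReJ ?ImJ /sqn /=; ring. Qed.

Lemma dot_sqr_le (a b c d : R) :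
  `|a * b + c * d| <= a ^+ 2 + c ^+ 2 + (b ^+ 2 + d ^+ 2).
Proof.
rewrite ler_norml; have := sqr_ge0 (a - b); have := sqr_ge0 (a + b).
have := sqr_ge0 (c - d); have := sqr_ge0 (c + d); have := sqr_ge0 a.
have := sqr_ge0 b; have := sqr_ge0 c; have := sqr_ge0 d.
by move=> *; apply/andP; split; nra.
Qed.

Section Weighted.
Context (U : set (C2 R)) (gamma : C2 R -> R).
Context (mU : measurable U) (mg : measurable_fun U gamma)
  (g0 : forall x, U x -> 0 <= gamma x).

Lemma measurable_sqn f : measurable_fun U (fun x => Re (f x)) ->
  measurable_fun U (fun x => Im (f x)) -> measurable_fun U (fun x => sqn (f x) * gamma x).
Proof.
by move=> mr mi; apply: measurable_funM => //; apply: measurable_funD; exact: measurable_funX.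
Qed.

Lemma L2P f : L2 gamma U f <->
  [/\ measurable_fun U (fun x => Re (f x)), measurable_fun U (fun x => Im (f x)) &
    mu.-integrable U (EFin \o (fun x => sqn (f x) * gamma x))].
Proof.
have eqint : (\int[mu]_(x in U) (ComplexField.Normc.normc (f x) ^+ 2 * gamma x)%:E =
              \int[mu]_(x in U) `| (sqn (f x) * gamma x)%:E |)%E.
  apply: eq_integral => x /[!inE] Ux; rewrite normc_sqn gee0_abs// lee_fin.
  by rewrite mulr_ge0// ?sqn_ge0// g0.
split=> [[mr mi]|[mr mi] /integrableP[_ fi]]; last by split => //; rewrite eqint.
rewrite eqint => fi; split => //; apply/integrableP; split => //.
by apply/measurable_EFinP; exact: measurable_sqn.
Qed.

Lemma integrable_dominated (k l : C2 R -> R) : measurable_fun U k ->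
  mu.-integrable U (EFin \o l) -> (forall x, U x -> `|k x| <= l x) ->
  mu.-integrable U (EFin \o k).
Proof.
move=> mk il kl; refine (@le_integrable _ _ _ mu U mU _ _ _ _ il); first exact/measurable_EFinP.
move=> x Ux; rewrite lee_fin; apply: (le_trans (kl x Ux)).
exact: ler_norm.
Qed.

Lemma lebC2_integrableD (k l : C2 R -> R) : mu.-integrable U (EFin \o k) ->
  mu.-integrable U (EFin \o l) -> mu.-integrable U (EFin \o (fun x => k x + l x)).
Proof. by move=> ik il; exact: (integrableD (mu:=mu) mU ik il). Qed.

Lemma lebC2_integrableB (k l : C2 R -> R) : mu.-integrable U (EFin \o k) ->
  mu.-integrable U (EFin \o l) -> mu.-integrable U (EFin \o (fun x => k x - l x)).
Proof. by move=> ik il; exact: (integrableB (mu:=mu) mU ik il). Qed.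

Lemma lebC2_integrableZ (c : R) (k : C2 R -> R) : mu.-integrable U (EFin \o k) ->
  mu.-integrable U (EFin \o (fun x => c * k x)).
Proof. by move=> ik; exact: (integrableZl (mu:=mu) mU c ik). Qed.

Lemma L2_integrable_Re f g : L2 gamma U f -> L2 gamma U g ->
  mu.-integrable U (EFin \o (fun x => Re ((f x)^* * g x * (gamma x)%:C))).
Proof.
move=> /L2P[fr fi f2] /L2P[gr gi g2].
apply: (integrable_dominated _ (lebC2_integrableD f2 g2)).
  rewrite (_ : (fun x => _) = fun x => (Re (f x) * Re (g x) + Im (f x) * Im (g x)) * gamma x).
    by apply: measurable_funM => //; apply: measurable_funD; exact: measurable_funM.
  by apply/funext => x; rewrite !(ReM, ImM) ?ReJ ?ImJ /=; ring.
move=> x Ux; have := g0 Ux => gx.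
have -> : Re ((f x)^* * g x * (gamma x)%:C) = (Re (f x) * Re (g x) + Im (f x) * Im (g x)) * gamma x.
  by rewrite !(ReM, ImM) ?ReJ ?ImJ /=; ring.
rewrite normrM (ger0_norm gx) /= -mulrDl ler_wpM2r//.
exact: dot_sqr_le.
Qed.

Lemma L2_integrable_Im f g : L2 gamma U f -> L2 gamma U g ->
  mu.-integrable U (EFin \o (fun x => Im ((f x)^* * g x * (gamma x)%:C))).
Proof.
move=> /L2P[fr fi f2] /L2P[gr gi g2].
apply: (integrable_dominated _ (lebC2_integrableD f2 g2)).
  rewrite (_ : (fun x => _) = fun x => (Re (f x) * Im (g x) - Im (f x) * Re (g x)) * gamma x).
    by apply: measurable_funM => //; apply: measurable_funB; exact: measurable_funM.
  by apply/funext => x; rewrite !(ReM, ImM) ?ReJ ?ImJ /=; ring.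
move=> x Ux; have := g0 Ux => gx.
have -> : Im ((f x)^* * g x * (gamma x)%:C) = (Re (f x) * Im (g x) - Im (f x) * Re (g x)) * gamma x.
  by rewrite !(ReM, ImM) ?ReJ ?ImJ /=; ring.
rewrite normrM (ger0_norm gx) /= -mulrDl ler_wpM2r// -mulNr.
by rewrite (le_trans (dot_sqr_le _ _ _ _))// /sqn sqrrN; lra.
Qed.

Lemma L2_0 : L2 gamma U (fun=> 0).
Proof.
apply/L2P; split => //=; apply: (@integrable_dominated _ (fun=> 0)).
- exact: (@measurable_sqn (fun=> 0)).
- exact: integrable0.
- by move=> x Ux /=; rewrite /sqn /= expr0n /= addr0 mul0r normr0.
Qed.

Lemma L2_lin (c : R[i]) f g : L2 gamma U f -> L2 gamma U g ->
  L2 gamma U (fun x => c * f x + g x).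
Proof.
move=> /L2P[fr fi f2] /L2P[gr gi g2].
have mr : measurable_fun U (fun x => Re (c * f x + g x)).
  rewrite (_ : (fun x => _) = fun x => (Re c * Re (f x) - Im c * Im (f x)) + Re (g x)).
    apply: measurable_funD => //; apply: measurable_funB; exact: measurable_funM.
  by apply/funext => x; rewrite ReD ReM.
have mi : measurable_fun U (fun x => Im (c * f x + g x)).
  rewrite (_ : (fun x => _) = fun x => (Re c * Im (f x) + Im c * Re (f x)) + Im (g x)).
    apply: measurable_funD => //; apply: measurable_funD; exact: measurable_funM.
  by apply/funext => x; rewrite ImD ImM.
apply/L2P; split => //.
apply: (integrable_dominated _ (lebC2_integrableD
  (lebC2_integrableZ (2 * sqn c) f2) (lebC2_integrableZ 2 g2))).
  exact: measurable_sqn.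
move=> x Ux; have := g0 Ux => gx; rewrite ger0_norm ?mulr_ge0 ?sqn_ge0//=.
rewrite !mulrA -mulrDl ler_wpM2r// -mulrA -sqnM.
rewrite /sqn !ReD !ImD; move: (c * f x) (g x) => [a b] [a' b'] /=.
have := sqr_ge0 (a - a'); have := sqr_ge0 (b - b'); nra.
Qed.

Lemma integralC_lin (c : R[i]) (u v : C2 R -> R[i]) :
  mu.-integrable U (EFin \o (fun x => Re (u x))) -> mu.-integrable U (EFin \o (fun x => Im (u x))) ->
  mu.-integrable U (EFin \o (fun x => Re (v x))) -> mu.-integrable U (EFin \o (fun x => Im (v x))) ->
  integralC U (fun x => c * u x + v x) = c * integralC U u + integralC U v.
Proof.
move=> ur ui vr vi.
apply: complexE; rewrite ?ReD ?ImD ?ReM ?ImM /=.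
- rewrite -!RintegralZl// -RintegralB//; [|exact: lebC2_integrableZ..].
  rewrite -RintegralD//; last exact: (lebC2_integrableB (lebC2_integrableZ _ ur) (lebC2_integrableZ _ ui)).
  by apply: eq_Rintegral => x _; rewrite ReD ReM.
- rewrite -!RintegralZl// -RintegralD//; [|exact: lebC2_integrableZ..].
  rewrite -RintegralD//; last exact: (lebC2_integrableD (lebC2_integrableZ _ ui) (lebC2_integrableZ _ ur)).
  by apply: eq_Rintegral => x _; rewrite ImD ImM.
Qed.

Lemma inner_lin (c : R[i]) f g h : L2 gamma U f -> L2 gamma U g -> L2 gamma U h ->
  inner gamma U h (fun x => c * f x + g x) = c * inner gamma U h f + inner gamma U h g.
Proof.
move=> Lf Lg Lh; rewrite /inner -integralC_lin; last first.
- exact: L2_integrable_Im.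
- exact: L2_integrable_Re.
- exact: L2_integrable_Im.
- exact: L2_integrable_Re.
by congr integralC; apply/funext => x; ring.
Qed.

Lemma inner_herm f g : L2 gamma U f -> L2 gamma U g ->
  inner gamma U g f = (inner gamma U f g)^*.
Proof.
move=> Lf Lg; apply: complexE; rewrite ?ReJ ?ImJ /inner /integralC /=.
  by apply: eq_Rintegral => x _; rewrite !(ReM, ImM) !ReJ !ImJ /=; ring.
rewrite -[RHS]mulN1r -RintegralZl//; last exact: L2_integrable_Im.
by apply: eq_Rintegral => x _; rewrite !(ReM, ImM) !ReJ !ImJ /=; ring.
Qed.

Lemma inner_self f : inner gamma U f f = (\int[mu]_(x in U) (sqn (f x) * gamma x))%:C.
Proof.
apply: complexE; rewrite /inner /integralC /=.
  by apply: eq_Rintegral => x _; rewrite mulJ_sqn ReM /=; ring.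
rewrite (@eq_Rintegral _ _ _ _ _ (fun=> 0)); first by rewrite Rintegral_cst// mul0r.
by move=> x _; rewrite mulJ_sqn ImM /=; ring.
Qed.

Lemma inner_ge0 f : 0 <= inner gamma U f f.
Proof.
rewrite inner_self ler0c; apply: Rintegral_ge0 => x Ux.
by rewrite mulr_ge0 ?sqn_ge0// g0.
Qed.

Lemma eq_on_inner f f' g g' : eq_on U f f' -> eq_on U g g' ->
  inner gamma U f g = inner gamma U f' g'.
Proof.
move=> ff gg; rewrite /inner /integralC; congr (_ +i* _);
  by apply: eq_Rintegral => x /[!inE] Ux; rewrite ff// gg.
Qed.

End Weighted.
End L2theory.

(** * Reproducing kernels and transport of Hilbert space structures *)

Section Kernel.
Context {R : realType}.
Local Notation Re := (@complex.Re R).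
Local Notation Im := (@complex.Im R).
Implicit Types (f g h : C2 R -> R[i]) (U V : set (C2 R)).

Lemma inner_kernel gamma U (B : C2 R -> R[i]) f :
  inner gamma U (fun w => (B w)^*) f = integralC U (fun w => B w * f w * (gamma w)%:C).
Proof. by rewrite /inner; congr integralC; apply/funext => w; congr (_ * _ * _); exact: conjcK. Qed.

(** Riesz representation of the evaluation at each point. *)
Lemma Bergman_kernelP gamma U (A : set (C2 R -> R[i])) :
  hilbert_space U A (inner gamma U) ->
  (forall z, U z -> exists C : R, forall f, A f ->
     sqn (f z) <= C * Re (inner gamma U f f)) ->
  is_Bergman_kernel gamma U A (Bergman_kernel gamma U A).
Proof.
move=> HA bA; apply: (@xgetPex _ (fun _ _ => 0) [set B | is_Bergman_kernel gamma U A B]).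
have /choice[k kP] : forall z, exists k, U z -> A k /\ forall f, A f -> f z = inner gamma U k f.
  move=> z; have [Uz|nUz] := pselect (U z); last by exists (fun=> 0).
  have [C CP] := bA z Uz.
  have [//|f Af|k Ak kP] := @riesz R U A _ HA (fun f => f z) C.
    by apply: le_trans (CP f Af); rewrite /sqn lerDl sqr_ge0.
  by exists k.
exists (fun z w => (k z w)^*); split=> [z Uz|f z Af Uz].
  rewrite (_ : (fun w => _) = k z); first by have [] := kP z Uz.
  by apply/funext => w; exact: conjcK.
have [Ak ->//] := kP z Uz; rewrite -inner_kernel; congr inner.
Qed.

(** The difference of two kernels at the same point is an element of A
    orthogonal to all of A. *)
Lemma Bergman_kernel_unique gamma U (A : set (C2 R -> R[i])) B B' :
  hilbert_space U A (inner gamma U) ->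
  is_Bergman_kernel gamma U A B -> is_Bergman_kernel gamma U A B' ->
  forall z w, U z -> U w -> B z w = B' z w.
Proof.
move=> HA [BA Br] [BA' Br'] z w Uz Uw.
have Ah := hilbert_sub HA (BA z Uz) (BA' z Uz).
have /(hilbert_ip_def HA Ah) : inner gamma U
    (fun x => (B z x)^* - (B' z x)^*) (fun x => (B z x)^* - (B' z x)^*) = 0.
  rewrite (hilbert_ip_sub HA)//; [|exact: BA|exact: BA'].
  rewrite (hilbert_ip_herm HA (BA z Uz) Ah) (hilbert_ip_herm HA (BA' z Uz) Ah).
  rewrite !inner_kernel -Br// -Br'// subrr//.
by move/(_ w Uw)/eqP; rewrite subr_eq0 => /eqP/(can_inj (@conjcK _)).
Qed.

(** Completeness and definiteness are carried over by J. As J is surjective only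
    modulo equality on V, the inner product on F has to depend only on the
    values on V. *)
Lemma hilbert_transport U E ipE V F ipF (J : (C2 R -> R[i]) -> C2 R -> R[i]) :
  hilbert_space U E ipE -> isometric_isomorphism U E ipE V F ipF J ->
  F (fun=> 0) -> (forall (c : R[i]) f g, F f -> F g -> F (fun x => c * f x + g x)) ->
  (forall (c : R[i]) f g h, F f -> F g -> F h ->
    ipF h (fun x => c * f x + g x) = c * ipF h f + ipF h g) ->
  (forall f g, F f -> F g -> ipF g f = (ipF f g)^*) ->
  (forall f, F f -> 0 <= ipF f f) ->
  (forall f f' g g', eq_on V f f' -> eq_on V g g' -> ipF f g = ipF f' g') ->
  hilbert_space V F ipF.
Proof.
move=> HE [[JF Jinj Jsurj] Jlin Jip] F0 Flin ipl iph ipg ipe.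
have E0 := hilbert0 HE.
have J0 : eq_on V (J (fun=> 0)) (fun=> 0).
  move=> x Vx; have := Jlin 1 _ _ E0 E0 x Vx.
  rewrite (_ : (fun x0 : C2 R => _) = (fun=> 0)).
    by rewrite mul1r -[LHS]addr0 => /addrI.
  by apply/funext => y; rewrite mulr0 addr0.
have Fsub f g : F f -> F g -> F (fun x => f x - g x).
  move=> Ff Fg; have := Flin (-1) _ _ Fg Ff.
  rewrite (_ : (fun x => _) = (fun x => f x - g x))//.
  by apply/funext => x; rewrite mulN1r addrC.
have Jsub f g : E f -> E g -> eq_on V (J (fun x => f x - g x)) (fun x => J f x - J g x).
  move=> Ef Eg x Vx; have := Jlin (-1) _ _ Eg Ef x Vx; rewrite mulN1r addrC => <-.
  by congr (J _ x); apply/funext => y; rewrite mulN1r addrC.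
have eqsub f f' g g' : eq_on V f f' -> eq_on V g g' ->
    eq_on V (fun x => f x - g x) (fun x => f' x - g' x).
  by move=> ff gg x Vx; rewrite ff// gg.
have nJ f : E f -> ipnorm ipF (J f) = ipnorm ipE f by move=> Ef; rewrite /ipnorm Jip.
split => //.
- move=> h Fh; have [f Ef fh] := Jsurj h Fh.
  rewrite -(ipe _ _ _ _ fh fh) Jip// (hilbert_ip_def HE Ef); split.
    by move=> /(Jinj _ _ Ef E0) H x Vx; rewrite -fh// H// J0.
  by move=> H; apply/(Jinj _ _ Ef E0) => x Vx; rewrite fh// J0// H.
- move=> u uF uC.
  have /choice[v vP] : forall n, exists f, E f /\ eq_on V (J f) (u n).
    by move=> n; have [f Ef fu] := Jsurj _ (uF n); exists f.
  have dist f g n : E f -> E g -> eq_on V (J g) n -> forall m, eq_on V (J f) m ->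
      ipnorm ipF (fun x => m x - n x) = ipnorm ipE (fun x => f x - g x).
    move=> Ef Eg gn m fm; rewrite -nJ; last exact: (hilbert_sub HE).
    rewrite /ipnorm; congr (Num.sqrt (Re _)); apply: ipe => x Vx;
      by rewrite Jsub// fm// gn.
  have [|f Ef fP] := hilbert_complete HE (fun n => (vP n).1).
    move=> e e0; have [N NP] := uC e e0; exists N => m n mN nN.
    by rewrite -(dist _ _ _ (vP m).1 (vP n).1 (vP n).2 _ (vP m).2); exact: NP.
  exists (J f); first exact: JF.
  move=> e e0; have [N NP] := fP e e0; exists N => n nN.
  by rewrite (dist (v n) f (J f) (vP n).1 Ef _ (u n) (vP n).2)//; exact: NP.
Qed.

End Kernel.

(** * Fubini and changes of variables for real-valued integrals *)

Lemma bounded_integral_fin_num (d : measure_display) (T : measurableType d)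
    (R : realType) (m : {measure set T -> \bar R}) (B : set T) (g : T -> R) (M : R) :
  measurable B -> (m B < +oo)%E -> measurable_fun B g ->
  (forall y, B y -> `|g y| <= M) -> (\int[m]_(y in B) (g y)%:E)%E \is a fin_num.
Proof.
move=> mB fB mg gM; apply: integrable_fin_num => //.
apply: measurable_bounded_integrable => //; exists M; split; first exact: num_real.
by move=> K MK y By; apply: le_trans (ltW MK); exact: gM.
Qed.

Section BoundedFubini.
Context {d1 d2 : measure_display} {T1 : measurableType d1} {T2 : measurableType d2} {R : realType}.
Context (m1 : {sigma_finite_measure set T1 -> \bar R})
          (m2 : {sigma_finite_measure set T2 -> \bar R}).

(** A bounded function on a rectangle of finite measure has finite inner
    integrals, so the theorem for extended-real integrals can be read in R. *)
Lemma Rintegral_Fubini_bounded (A : set T1) (B : set T2) (G : T1 * T2 -> R) (M : R) :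
  measurable A -> measurable B -> (m1 A < +oo)%E -> (m2 B < +oo)%E ->
  measurable_fun (A `*` B) G -> (forall p, (A `*` B) p -> `|G p| <= M) ->
  \int[m1]_(x in A) \int[m2]_(y in B) G (x, y) =
  \int[m2]_(y in B) \int[m1]_(x in A) G (x, y).
Proof.
move=> mA mB fA fB mG GM.
have mAB : measurable (A `*` B) by exact: measurableX.
have fAB : ((m1 \x m2) (A `*` B) < +oo)%E.
  by rewrite product_measure1E// lte_mul_pinfty// ge0_fin_numE.
have F1 x : A x -> (\int[m2]_(y in B) (G (x, y))%:E)%E \is a fin_num.
  move=> Ax; apply: (@bounded_integral_fin_num _ _ _ m2 B (fun y => G (x, y)) M mB fB).
    apply: (measurable_comp (F := A `*` B) (f := G) (g := pair x) mAB _ mG).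
      by move=> _ [y By <-].
    exact: measurable_funTS (measurable_pair1 x).
  by move=> y By; exact: GM.
have F2 y : B y -> (\int[m1]_(x in A) (G (x, y))%:E)%E \is a fin_num.
  move=> By; apply: (@bounded_integral_fin_num _ _ _ m1 A (fun x => G (x, y)) M mA fA).
    apply: (measurable_comp (F := A `*` B) (f := G) (g := pair^~ y) mAB _ mG).
      by move=> _ [x Ax <-].
    exact: measurable_funTS (measurable_pair2 y).
  by move=> x Ax; exact: GM.
have iG : (m1 \x m2)%E.-integrable (A `*` B) (EFin \o G).
  apply: measurable_bounded_integrable => //.
  exists M; split; first exact: num_real.
  by move=> K MK p ABp; apply: (le_trans (GM p ABp)); exact: ltW.
have iGT : (m1 \x m2)%E.-integrable setT ((EFin \o G) \_ (A `*` B)).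
  exact: (integrable_mkcond _ mAB).1.
have := Fubini iGT.
have E1 : (\int[m1]_x \int[m2]_y ((EFin \o G) \_ (A `*` B)) (x, y) =
   \int[m1]_(x in A) \int[m2]_(y in B) (G (x, y))%:E)%E.
  rewrite [RHS]integral_mkcond; apply: eq_integral => x _; rewrite patchE.
  case: ifPn => xA.
    rewrite [RHS]integral_mkcond; apply: eq_integral => y _; rewrite !patchE.
    by rewrite in_setX /= xA /=.
  by apply: integral0_eq => y _; rewrite patchE in_setX /= (negbTE xA).
have E2 : (\int[m2]_y \int[m1]_x ((EFin \o G) \_ (A `*` B)) (x, y) =
   \int[m2]_(y in B) \int[m1]_(x in A) (G (x, y))%:E)%E.
  rewrite [RHS]integral_mkcond; apply: eq_integral => y _; rewrite patchE.
  case: ifPn => yB.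
    rewrite [RHS]integral_mkcond; apply: eq_integral => x _; rewrite !patchE.
    by rewrite in_setX /= yB andbT.
  by apply: integral0_eq => x _; rewrite patchE in_setX /= (negbTE yB) andbF.
rewrite E1 E2 => H.
rewrite /Rintegral; congr fine.
transitivity (\int[m1]_(x in A) \int[m2]_(y in B) (G (x, y))%:E)%E.
  by apply: eq_integral => x /[!inE] Ax; rewrite fineK//; exact: F1.
rewrite H; apply: eq_integral => y /[!inE] By; rewrite fineK//; exact: F2.
Qed.

End BoundedFubini.

Section ChangeOfVariables.
Context {R : realType}.
Local Notation mu := (@lebC2 R).
Let C2M : measurableType _ := (((measurableTypeR R * measurableTypeR R) *
  (measurableTypeR R * measurableTypeR R))%type : measurableType _).
Context (tau : C2 R -> C2 R) (k : {posnum R}).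
Context (mtau : measurable_fun setT tau)
  (tauk : forall A, measurable A -> mu (tau @^-1` A) = (k%:num%:E * mu A)%E).

(** The image of [mu] under tau is k times [mu]. *)
Lemma ge0_integral_change_of_variables (D : set (C2 R)) (f : C2 R -> \bar R) :
  measurable D -> measurable_fun D f -> (forall x, D x -> 0 <= f x)%E ->
  (\int[mu]_(x in tau @^-1` D) f (tau x) = k%:num%:E * \int[mu]_(x in D) f x)%E.
Proof.
move=> mD mf f0.
pose k' := NngNum (ltW [gt0 of k%:num]).
pose nu : {measure set C2M -> \bar R} :=
  @measure_function_pushforward__canonical__measure_function_Measure _ _ C2M C2M R mu tau mtau.
pose ms : {measure set C2M -> \bar R} := mscale k' mu.
have H : (\int[nu]_(x in D) f x = \int[ms]_(x in D) f x)%E.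
  by apply: eq_measure_integral => A mA _; exact: tauk.
have f0' : {in D, forall y, (0 <= f y)%E} by move=> x /[!inE]; exact: f0.
have e1 := @ge0_integral_pushforward _ _ C2M C2M R tau mtau mu D f mD mf f0'.
have e2 := @ge0_integral_mscale _ C2M R mu D mD k' f mf f0.
exact: etrans (esym e1) (etrans H e2).
Qed.


(** Scaling by k > 0 commutes with the difference of the positive and negative
    parts even when they are infinite. *)
Lemma integral_change_of_variables (D : set (C2 R)) (f : C2 R -> \bar R) :
  measurable D -> measurable_fun D f ->
  (\int[mu]_(x in tau @^-1` D) f (tau x) = k%:num%:E * \int[mu]_(x in D) f x)%E.
Proof.
move=> mD mf; rewrite [in LHS]integralE [in RHS]integralE.
have e1 : (\int[mu]_(x in tau @^-1` D) (fun x => f (tau x))^\+ x =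
    k%:num%:E * \int[mu]_(x in D) f^\+ x)%E.
  have -> : ((fun x => f (tau x))^\+ = fun x => f^\+ (tau x))%E by exact: (funepos_comp f tau).
  have H := @ge0_integral_change_of_variables D (f^\+)%E mD (measurable_funepos mf).
  exact: (H (fun x _ => funepos_ge0 f x)).
have e2 : (\int[mu]_(x in tau @^-1` D) (fun x => f (tau x))^\- x =
    k%:num%:E * \int[mu]_(x in D) f^\- x)%E.
  have -> : ((fun x => f (tau x))^\- = fun x => f^\- (tau x))%E by exact: (funeneg_comp f tau).
  have H := @ge0_integral_change_of_variables D (f^\-)%E mD (measurable_funeneg mf).
  exact: (H (fun x _ => funeneg_ge0 f x)).
rewrite e1 e2.
have i1 : (0 <= \int[mu]_(x in D) f^\+ x)%E by apply: integral_ge0.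
have i2 : (0 <= \int[mu]_(x in D) f^\- x)%E by apply: integral_ge0.
have k0 : (0 < k%:num%:E)%E by rewrite lte_fin.
move: (\int[mu]_(x in D) f^\+ x)%E (\int[mu]_(x in D) f^\- x)%E i1 i2 => [a| |] [b| |] // a0 b0.
- by rewrite -!EFinN -!EFinD -!EFinM mulrBr.
- by rewrite gt0_muley//= gt0_muleNy.
- by rewrite gt0_muley//= gt0_muley.
- by rewrite gt0_muley//= gt0_muleNy.
Qed.

Lemma Rintegral_change_of_variables (D : set (C2 R)) (f : C2 R -> R) :
  measurable D -> measurable_fun D f ->
  \int[mu]_(x in tau @^-1` D) f (tau x) = k%:num * \int[mu]_(x in D) f x.
Proof.
move=> mD mf; rewrite /Rintegral.
have mf' : measurable_fun D (EFin \o f) by exact/measurable_EFinP.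
have -> := @integral_change_of_variables D (EFin \o f) mD mf'.
have k0 : (0 < k%:num%:E)%E by rewrite lte_fin.
case: integral => [a| |] //=; first by rewrite gt0_muley//= mulr0.
by rewrite gt0_muleNy//= mulr0.
Qed.

End ChangeOfVariables.

(** * Bounds, measurability and calculus along curves *)

Section RealAnalysis.
Context {R : realType}.
Local Notation leb := (@lebesgue_measure R).

Lemma compact_bounded_fun (T : topologicalType) (K : set T) (f : T -> R) :
  compact K -> (forall x, K x -> {for x, continuous f}) ->
  exists M : R, forall x, K x -> `|f x| <= M.
Proof.
move=> cK cf.
have cfK : {within K, continuous f}.
  by apply: continuous_in_subspaceT => x /[!inE] Kx; exact: cf.
have /compact_bounded[M [_ HM]] := continuous_compact cfK cK.
exists (M + 1) => x Kx; apply: HM; first by rewrite ltrDl.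
by exists x.
Qed.

Lemma measurable_fun_opens (d : measure_display) (T : measurableType d) (D : set T) (f : T -> R) :
  (forall V : set R, open V -> measurable (D `&` f @^-1` V)) -> measurable_fun D f.
Proof.
move=> H mD; apply: (measurability _ (RGenOpens.measurableE R)) => //.
by move=> _ [_ [a [b ->] <-]]; apply: H; exact: interval_open.
Qed.

Lemma open_continuous_measurable_R2 (U : set (R * R)) (f : R * R -> R) :
  open U -> (forall x, U x -> {for x, continuous f}) -> measurable_fun U f.
Proof.
move=> oU cf; apply: measurable_fun_opens => V oV; apply: open_measurable_R2.
rewrite openE => x [Ux fx]; apply: filterI; first exact: open_nbhs_nbhs.
by apply: (cf x Ux); exact: open_nbhs_nbhs.
Qed.

Lemma Rintegral_FTC2 (f F : R -> R) (a b : R) : a < b ->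
  (forall x, a <= x <= b -> is_derive x (1 : R) F (f x)) ->
  (forall x, a <= x <= b -> {for x, continuous f}) ->
  \int[leb]_(x in `[a, b]) f x = F b - F a.
Proof.
move=> ab dF cf; rewrite /Rintegral (@continuous_FTC2 R f F a b ab)//.
- by apply: continuous_in_subspaceT => x /[!inE] /=; rewrite in_itv /=; exact: cf.
- have cF x : a <= x <= b -> {for x, continuous F}.
    by move=> xab; have [+ _] := dF x xab; move/derivable1_diffP; exact: differentiable_continuous.
  split.
  + by move=> x; rewrite in_itv /= => /andP[ax xb]; have [] := dF x; rewrite ?ltW.
  + by apply: cvg_at_right_filter; apply: cF; rewrite lexx ltW.
  + by apply: cvg_at_left_filter; apply: cF; rewrite lexx ltW.
- move=> x; rewrite in_itv /= => /andP[ax xb]; rewrite derive1E.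
  by have dx := dF x (ltac:(by rewrite !ltW)); rewrite derive_val.
Qed.

Lemma is_derive_curve (u : C2 R -> R) (z w w' : C2 R) (p q : R -> R) (t p' q' : R) :
  let c := fun t => z + p t *: w + q t *: w' in
  differentiable (u : C2 R -> R^o) (c t) ->
  is_derive t (1 : R) p p' -> is_derive t (1 : R) q q' ->
  is_derive t (1 : R) (fun t => u (c t))
    (p' * 'D_w (u : C2 R -> R^o) (c t) + q' * 'D_w' (u : C2 R -> R^o) (c t)).
Proof.
move=> c du dp dq.
have Dp : differentiable p t by apply/derivable1_diffP; have [] := dp.
have Dq : differentiable q t by apply/derivable1_diffP; have [] := dq.
have Dpw := differentiableZl w Dp.
have Dqw := differentiableZl w' Dq.
have Dz : differentiable (cst z : R -> C2 R) t by exact: differentiable_cst.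
have Dc : differentiable c t.
  exact: (differentiableD (differentiableD Dz Dpw) Dqw).
have dc1 : 'd c t 1 = p' *: w + q' *: w'.
  have e1 := congr1 (fun h : R -> C2 R => h 1) (diffD (differentiableD Dz Dpw) Dqw).
  have e2 := congr1 (fun h : R -> C2 R => h 1) (diffD Dz Dpw).
  have e3 := congr1 (fun h : R -> C2 R => h 1) (diffZl w Dp).
  have e4 := congr1 (fun h : R -> C2 R => h 1) (diffZl w' Dq).
  have e5 := congr1 (fun h : R -> C2 R => h 1) (diff_cst z t).
  have E : 'd c t 1 = 'd (cst z : R -> C2 R) t 1 + 'd p t 1 *: w + 'd q t 1 *: w'.
    apply: etrans e1 _; rewrite /=; congr (_ + _); last exact: e4.
    by apply: etrans e2 _; rewrite /=; congr (_ + _); exact: e3.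
  rewrite E; have -> : 'd (cst z : R -> C2 R) t 1 = 0 by exact: e5.
  rewrite add0r.
  by congr (_ *: w + _ *: w'); rewrite -derive1E' // derive1E; [case: dp|case: dq].
have Duc : differentiable (u \o c : R -> R^o) t by exact: differentiable_comp.
apply: DeriveDef; first exact/derivable1_diffP.
rewrite -derive1E derive1E'// diff_comp//= dc1 linearD !linearZ /=.
by rewrite -!deriveE.
Qed.

End RealAnalysis.

(** * The mean value property on circles *)

Lemma continuous_pairl (T T' : topologicalType) (t : T) (s : T') : {for t, continuous (fun t => (t, s))}.
Proof. by apply: (@cvg_pair _ _ _ _ (nbhs t) (nbhs s)) => //; exact: cvg_cst. Qed.
Lemma continuous_pairr (T T' : topologicalType) (t : T) (s : T') : {for s, continuous (fun s => (t, s))}.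
Proof. by apply: (@cvg_pair _ _ _ _ (nbhs t) (nbhs s)) => //; exact: cvg_cst. Qed.

Section CircleMean.
Context {R : realType}.
Local Notation leb := (@lebesgue_measure R).
Implicit Types (U : set (C2 R)) (u v : C2 R -> R).

(** Multiplication by i on C^2, in real coordinates. *)
Definition mulI (w : C2 R) : C2 R := ((- w.1.2, w.1.1), (- w.2.2, w.2.1)).

(** The derivative of u + i v along i w is i times its derivative along w: u + i
    v is holomorphic on each complex line. *)
Definition cauchy_riemann U u v : Prop :=
  [/\ C1real U u, C1real U v & forall x w, U x ->
     'D_(mulI w) (u : C2 R -> R^o) x = - 'D_w (v : C2 R -> R^o) x /\
     'D_(mulI w) (v : C2 R -> R^o) x = 'D_w (u : C2 R -> R^o) x].

Lemma cauchy_riemann_sym U u v : cauchy_riemann U u v ->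
  cauchy_riemann U v (fun x => - u x).
Proof.
move=> [[du cu] cv H]; split; [exact: cv| |].
  split=> [x Ux|w]; first exact: (differentiableN (du x Ux)).
  apply: (subspace_eq_continuous (f := fun x => - 'D_w (u : C2 R -> R^o) x)).
    move=> x /[!inE] Ux; apply/esym.
    exact: (@deriveN R (C2 R) R^o u x w (diff_derivable (du x Ux))).
  by move=> x; have := cu w x; exact: cvgN.
move=> x w Ux; have [h1 h2] := H x w Ux.
have N y : 'D_y (fun z => - u z : R^o) x = - 'D_y (u : C2 R -> R^o) x.
  exact: (@deriveN R (C2 R) R^o u x y (diff_derivable (du x Ux))).
by rewrite !N h1 h2 !opprK.
Qed.

Lemma C1real_continuous U u : open U -> C1real U u ->
  forall x, U x -> {for x, continuous u}.
Proof. by move=> _ [du _] x Ux; exact: (differentiable_continuous (du x Ux)). Qed.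

Lemma C1real_continuous_derive U u w : open U -> C1real U u ->
  forall x, U x -> {for x, continuous (fun y => 'D_w (u : C2 R -> R^o) y)}.
Proof.
move=> oU [_ /(_ w)]; rewrite continuous_open_subspace// => cu x Ux.
by apply: cu; rewrite inE.
Qed.

Section Polar.
Context (U : set (C2 R)) (u v : C2 R -> R) (z w : C2 R).
Context (oU : open U) (CR : cauchy_riemann U u v)
  (discU : forall p q : R, p ^+ 2 + q ^+ 2 <= 1 -> U (z + p *: w + q *: mulI w)).

Let c (t s : R) : C2 R := z + (t * cos s) *: w + (t * sin s) *: mulI w.
Let G (ts : R * R) : R := cos ts.2 * 'D_w (u : C2 R -> R^o) (c ts.1 ts.2)
  + sin ts.2 * 'D_(mulI w) (u : C2 R -> R^o) (c ts.1 ts.2).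

Let cU t s : 0 <= t <= 1 -> U (c t s).
Proof.
move=> /andP[t0 t1]; apply: discU; rewrite !exprMn -mulrDr cos2Dsin2 mulr1.
by rewrite expr_le1.
Qed.

Let c_cont (ts : R * R) : {for ts, continuous (fun p : R * R => c p.1 p.2)}.
Proof.
have C : {for ts, continuous (fun p : R * R => p.1 * cos p.2)}.
  apply: continuousM; first exact: cvg_fst.
  by apply: continuous_comp; [exact: cvg_snd|exact: continuous_cos].
have S : {for ts, continuous (fun p : R * R => p.1 * sin p.2)}.
  apply: continuousM; first exact: cvg_fst.
  by apply: continuous_comp; [exact: cvg_snd|exact: continuous_sin].
apply: continuousD; first apply: continuousD; first exact: cst_continuous.
- apply: continuousZr_tmp; exact: C.
- apply: continuousZr_tmp; exact: S.
Qed.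

Let p2 : (0 : R) < 2 * pi. Proof. by rewrite mulr_gt0// pi_gt0. Qed.

Let du x : U x -> differentiable (u : C2 R -> R^o) x.
Proof. by have [[+ _] _ _] := CR; exact. Qed.
Let dv x : U x -> differentiable (v : C2 R -> R^o) x.
Proof. by have [_ [+ _] _] := CR; exact. Qed.

Let G_contU t s : U (c t s) -> {for (t, s), continuous G}.
Proof.
move=> Uc.
have D y : {for (t, s), continuous (fun p : R * R => 'D_y (u : C2 R -> R^o) (c p.1 p.2))}.
  apply: (@continuous_comp _ _ _ (fun p : R * R => c p.1 p.2) (fun x => 'D_y (u : C2 R -> R^o) x)).
    exact: c_cont.
  by have [Cu _ _] := CR; exact: (@C1real_continuous_derive U u y oU Cu _ Uc).
apply: continuousD; apply: continuousM; [|exact: D| |exact: D].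
- by apply: continuous_comp; [exact: cvg_snd|exact: continuous_cos].
- by apply: continuous_comp; [exact: cvg_snd|exact: continuous_sin].
Qed.

Let G_cont t s : 0 <= t <= 1 -> {for (t, s), continuous G}.
Proof. by move=> t01; apply: G_contU; exact: cU. Qed.

Let G_cont1 t s : 0 <= t <= 1 -> {for t, continuous (fun t => G (t, s))}.
Proof.
move=> t01; apply: (@continuous_comp _ _ _ (fun t : R => (t, s)) G); last exact: G_cont.
exact: continuous_pairl.
Qed.

Let G_cont2 t s : 0 <= t <= 1 -> {for s, continuous (fun s => G (t, s))}.
Proof.
move=> t01; apply: (@continuous_comp _ _ _ (fun s : R => (t, s)) G); last exact: G_cont.
exact: continuous_pairr.
Qed.

Let radial s : \int[leb]_(t in `[0, 1]) G (t, s) = u (c 1 s) - u z.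
Proof.
have -> : u (c 1 s) - u z = u (c 1 s) - u (c 0 s).
  by rewrite /c !mul0r !scale0r !addr0.
apply: (@Rintegral_FTC2 R (fun t => G (t, s)) (fun t => u (c t s))) => //.
- move=> t t01; have := @is_derive_curve R u z w (mulI w) (fun t => t * cos s) (fun t => t * sin s)
    t (cos s) (sin s) (du (cU s t01)).
  apply.
    have -> : (fun t : R => t * cos s) = (id : R -> R) * cst (cos s) by [].
    by apply: is_derive_eq; rewrite /GRing.scale /=; ring.
  have -> : (fun t : R => t * sin s) = (id : R -> R) * cst (sin s) by [].
  by apply: is_derive_eq; rewrite /GRing.scale /=; ring.
- by move=> t t01; exact: G_cont1.
Qed.

Let angular t : 0 < t <= 1 -> \int[leb]_(s in `[0, 2 * pi]) G (t, s) = 0.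
Proof.
move=> /andP[t0 t1]; have t01 : 0 <= t <= 1 by rewrite (ltW t0).
have H : \int[leb]_(s in `[0, 2 * pi]) G (t, s) = t^-1 * v (c t (2 * pi)) - t^-1 * v (c t 0).
  apply: (@Rintegral_FTC2 R (fun s => G (t, s)) (fun s => t^-1 * v (c t s))) => //.
    move=> s _; have dc := @is_derive_curve R v z w (mulI w) (fun s => t * cos s) (fun s => t * sin s)
      s (t * - sin s) (t * cos s) (dv (cU s t01)).
    have {}dc : is_derive s (1 : R) (fun s => v (c t s)) (t * - sin s * 'D_w (v : C2 R -> R^o) (c t s) +
       t * cos s * 'D_(mulI w) (v : C2 R -> R^o) (c t s)).
      apply: dc; apply: is_derive_eq.
    have := is_deriveZ t^-1 dc.
    have -> : t^-1 *: (t * - sin s * 'D_w (v : C2 R -> R^o) (c t s) +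
       t * cos s * 'D_(mulI w) (v : C2 R -> R^o) (c t s)) = G (t, s).
      have [_ _ /(_ _ w (cU s t01)) [h1 h2]] := CR.
      rewrite /G /= h1 h2 /GRing.scale /=.
      by field; rewrite gt_eqF.
    by [].
  by move=> s _; exact: G_cont2.
by rewrite H /c mulr_natl cos2pi sin2pi cos0 sin0 subrr.
Qed.

(** With c t s = z + t e^(is) w, the function G (t, s) is the derivative of t
    |-> u (c t s), so its integral over t is u (c 1 s) - u z. By the Cauchy-
    Riemann equations it is also the derivative of s |-> v (c t s) / t, so its
    integral over a full turn is 0. Fubini equates the two iterated integrals.
    *)
Lemma circle_mean : \int[leb]_(s in `[0, 2 * pi]) u (z + cos s *: w + sin s *: mulI w) = 2 * pi * u z.
Proof.
pose A := `](0:R), 1]%classic; pose B := `[(0:R), 2 * pi]%classic.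
have mA : measurable A by exact: measurable_itv.
have mB : measurable B by exact: measurable_itv.
have fA : (leb A < +oo)%E by rewrite /A lebesgue_measure_itv /= lte_fin ltr01 -EFinB ltry.
have lB : leb B = (2 * pi)%:E by rewrite /B lebesgue_measure_itv /= lte_fin p2 -EFinB subr0.
have fB : (leb B < +oo)%E by rewrite lB ltry.
have [M HM] : exists M : R, forall p, (`[(0:R), 1]%classic `*` B) p -> `|G p| <= M.
  apply: compact_bounded_fun.
    by apply: compact_setX; exact: segment_compact.
  by move=> [t s] [/=]; rewrite in_itv /= => t01 _; exact: G_cont.
have subA t : A t -> 0 <= t <= 1 by rewrite /A /= in_itv /= => /andP[/ltW -> ->].
have mG : measurable_fun (A `*` B) G.
  apply: (@measurable_funS _ _ _ _ [set p : R * R | U (c p.1 p.2)]).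
  - apply: open_measurable_R2.
    by apply: (open_comp _ oU) => p _; exact: c_cont.
  - by move=> [t s] [/= At _]; apply: cU; exact: subA.
  - apply: open_continuous_measurable_R2.
      by apply: (open_comp _ oU) => p _; exact: c_cont.
    by move=> [t s]; exact: G_contU.
have GM p : (A `*` B) p -> `|G p| <= M.
  by move=> [/subA h Bp]; apply: HM; split => //=; rewrite in_itv.
have L0 : \int[leb]_(t in A) \int[leb]_(s in B) G (t, s) = 0.
  rewrite (@eq_Rintegral _ _ _ leb A (fun=> 0)).
    by rewrite Rintegral_cst ?mul0r.
  by move=> t /[!inE]; rewrite /A /= in_itv /= => t01; exact: angular.
have L1 s : \int[leb]_(t in A) G (t, s) = u (c 1 s) - u z.
  rewrite -radial /A; apply: Rintegral_itv_obnd_cbnd.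
  have : leb.-integrable `[0, 1] (EFin \o (fun t => G (t, s))).
    apply: continuous_compact_integrable; first exact: segment_compact.
    apply: continuous_in_subspaceT => t /[!inE] /=; rewrite in_itv /= => t01; exact: G_cont1.
  by apply: integrableS; [exact: measurable_itv|exact: measurable_itv|exact: subset_itv_oc_cc].
have := @Rintegral_Fubini_bounded _ _ _ _ R leb leb A B G M mA mB fA fB mG GM.
rewrite L0 (@eq_Rintegral _ _ _ leb B (fun s => u (c 1 s) - u z)) => [Fub|s' _]; last exact: L1.
have iu : leb.-integrable B (EFin \o (fun s => u (c 1 s))).
  apply: continuous_compact_integrable; first exact: segment_compact.
  apply: continuous_in_subspaceT => s _.
  have U1 : U (c 1 s) by apply: cU; rewrite lexx ler01.
  have h1 := @continuous_comp R (R * R)%type (C2 R) (fun s => (1, s))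
    (fun p => c p.1 p.2) s (@continuous_pairr R R 1 s) (@c_cont (1, s)).
  exact: (@continuous_comp R (C2 R) R (fun s => c 1 s) u s h1 (@differentiable_continuous _ _ _ _ _ (du U1))).
move: Fub; rewrite (RintegralB (mu:=leb) mB iu); last first.
  apply: continuous_compact_integrable; first exact: segment_compact.
  by apply: continuous_subspaceT => x; exact: cvg_cst.
have -> : \int[leb]_(x in B) u z = u z * (2 * pi).
  rewrite Rintegral_cst; last exact: mB.
  by congr (_ * _); exact: (congr1 fine lB).
move=> /eqP; rewrite eq_sym subr_eq0 => /eqP E.
rewrite [RHS]mulrC -E; apply: eq_Rintegral => s _.
by rewrite /c !mul1r.
Qed.

End Polar.
End CircleMean.

(** * A bump function invariant under complex rotations *)

Section BallMean.
Context {R : realType}.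
Local Notation mu := (@lebC2 R).
Local Notation leb := (@lebesgue_measure R).
Implicit Types (U V : set (C2 R)) (u v : C2 R -> R) (w z : C2 R) (r s : R).

Lemma sqnormC2_continuous : continuous (@sqnormC2 R).
Proof.
move=> x; rewrite /sqnormC2.
have c11 : {for x, continuous (fun x : C2 R => x.1.1)} by apply: continuous_comp; exact: cvg_fst.
have c12 : {for x, continuous (fun x : C2 R => x.1.2)} by apply: continuous_comp; [exact: cvg_fst|exact: cvg_snd].
have c21 : {for x, continuous (fun x : C2 R => x.2.1)} by apply: continuous_comp; [exact: cvg_snd|exact: cvg_fst].
have c22 : {for x, continuous (fun x : C2 R => x.2.2)} by apply: continuous_comp; exact: cvg_snd.
have q (f : C2 R -> R) : {for x, continuous f} -> {for x, continuous (fun y => f y ^+ 2)}.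
  by move=> cf; exact: (continuousM cf cf).
exact: (continuousD (continuousD (q _ c11) (q _ c12)) (continuousD (q _ c21) (q _ c22))).
Qed.

(** The square makes the function C^1 with a Lipschitz gradient, and it only
    depends on the Euclidean norm, which e^(is) preserves. *)
Definition bump r w : R := Num.max 0 (r ^+ 2 - sqnormC2 w) ^+ 2.

Lemma bump_ge0 r w : 0 <= bump r w. Proof. exact: sqr_ge0. Qed.

Lemma bump_continuous r : continuous (bump r).
Proof.
move=> w.
have c : {for w, continuous (fun w => Num.max 0 (r ^+ 2 - sqnormC2 w))}.
  apply: (@continuous_max _ _ (fun=> 0) (fun w => r ^+ 2 - sqnormC2 w)); first exact: cvg_cst.
  apply: (@continuousB _ _ _ (fun=> r ^+ 2) (@sqnormC2 R)); first exact: cvg_cst.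
  exact: sqnormC2_continuous.
exact: (continuousM c c).
Qed.

Lemma bump_le r w : bump r w <= r ^+ 4.
Proof.
rewrite /bump (exprM r 2 2) ler_pXn2r ?nnegrE ?sqr_ge0 ?le_max ?lexx//.
rewrite ge_max sqr_ge0 /= gerBl /sqnormC2 !addr_ge0 ?sqr_ge0//.
Qed.

Lemma bump_out r w : r ^+ 2 < sqnormC2 w -> bump r w = 0.
Proof. by move=> h; rewrite /bump max_l ?expr0n// subr_le0 ltW. Qed.

(** Multiplication by e^(is). *)
Definition rot s w : C2 R := cos s *: w + sin s *: mulI w.

Lemma sqnorm_rot p q w : sqnormC2 (p *: w + q *: mulI w) = (p ^+ 2 + q ^+ 2) * sqnormC2 w.
Proof.
case: w => [[a b] [c d]].
have -> : p *: ((a, b), (c, d)) + q *: mulI ((a, b), (c, d)) =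
  ((p * a + q * - b, p * b + q * a), (p * c + q * - d, p * d + q * c)) :> C2 R by [].
by rewrite /sqnormC2 /=; ring.
Qed.

Lemma sqnormC2_rot s w : sqnormC2 (rot s w) = sqnormC2 w.
Proof. by rewrite sqnorm_rot cos2Dsin2 mul1r. Qed.

Lemma measurable_coord :
  [/\ measurable_fun [set: C2 R] (fun x : C2 R => x.1.1), measurable_fun [set: C2 R] (fun x : C2 R => x.1.2),
      measurable_fun [set: C2 R] (fun x : C2 R => x.2.1) & measurable_fun [set: C2 R] (fun x : C2 R => x.2.2)].
Proof.
split.
- exact: (measurableT_comp measurable_fst measurable_fst).
- exact: (measurableT_comp measurable_snd measurable_fst).
- exact: (measurableT_comp measurable_fst measurable_snd).
- exact: (measurableT_comp measurable_snd measurable_snd).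
Qed.

Lemma measurable_rot s : measurable_fun [set: C2 R] (rot s).
Proof.
have [m11 m12 m21 m22] := measurable_coord.
by apply: measurable_fun_pair; apply: measurable_fun_pair; apply: measurable_funD;
   apply: measurable_funM => //; apply: measurable_funN.
Qed.

Lemma mulID w z : mulI (w + z) = mulI w + mulI z.
Proof.
by case: w z => [[a b] [c d]] [[a' b'] [c' d']]; congr ((_, _), (_, _)); exact: opprD.
Qed.

Lemma rotE s (a b c d : R) : rot s ((a, b), (c, d)) =
  ((cos s * a + sin s * - b, cos s * b + sin s * a),
   (cos s * c + sin s * - d, cos s * d + sin s * c)).
Proof. by []. Qed.

Lemma rotK s : cancel (rot s) (rot (- s)).
Proof.
move=> [[a b] [c d]]; rewrite !rotE cosN sinN.
have h := cos2Dsin2 s; move: (cos s) (sin s) h => p q h.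
by congr ((_, _), (_, _)); rewrite -[RHS]mul1r -h; ring.
Qed.

(** Rotations are similarities of ratio 1. *)
Lemma lebC2_rot s (A : set (C2 R)) : measurable A -> mu (rot s @^-1` A) = mu A.
Proof.
move=> mA; have := @lebC2_similarity R (rot s) (rot (- s)) 1 A; rewrite !expr1n invr1 mul1e; apply => //.
- exact: measurable_rot.
- exact: measurable_rot.
- exact: rotK.
- by move=> w; have := rotK (- s) w; rewrite opprK.
- by move=> x y; rewrite /rot mulID !scalerDr addrACA.
- by move=> x; rewrite sqnormC2_rot mul1r.
Qed.

Lemma open_measurable_RC2 (U : set (R * C2 R)) : open U -> measurable U.
Proof.
move=> oU.
have b2 := nbhs_basis_prod (@nbhs_basis_rat R) (@nbhs_basis_rat R).
rewrite (open_bigcup_basis (nbhs_basis_prod (@nbhs_basis_rat R) (nbhs_basis_prod b2 b2)) oU).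
have mr n : measurable (@rat_itv R n).
  by rewrite /rat_itv; case: unpickle => // p; exact: measurable_itv.
apply: bigcup_measurable => n _; case: ifP => // _.
case: unpickle => // k; apply: measurableX; first exact: mr.
case: unpickle => // l; apply: measurableX; (case: unpickle => // m; apply: measurableX; exact: mr).
Qed.

Lemma cubeC2_compact r : compact (@cubeC2 R r).
Proof. by do !apply: compact_setX; exact: segment_compact. Qed.

Definition bump_mass r : R := \int[mu]_(w in eballC2 (r ^+ 2)) bump r w.

Lemma continuous_translate z : continuous (fun w : C2 R => w + z : C2 R).
Proof. by move=> w; apply: (@cvgD _ _ _ _ _ id (cst z)); [exact: cvg_id|exact: cvg_cst]. Qed.

Lemma continuous_rot_pair z (p : R * C2 R) :
  {for p, continuous (fun p : R * C2 R => z + cos p.1 *: p.2 + sin p.1 *: mulI p.2)}.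
Proof.
have C : {for p, continuous (fun p : R * C2 R => cos p.1)}.
  by apply: continuous_comp; [exact: cvg_fst|exact: continuous_cos].
have S : {for p, continuous (fun p : R * C2 R => sin p.1)}.
  by apply: continuous_comp; [exact: cvg_fst|exact: continuous_sin].
have I : continuous (@mulI R).
  move=> x.
  have c11 : {for x, continuous (fun x : C2 R => x.1.1)} by apply: continuous_comp; exact: cvg_fst.
  have c12 : {for x, continuous (fun x : C2 R => - x.1.2)}.
    by apply: continuousN; apply: continuous_comp; [exact: cvg_fst|exact: cvg_snd].
  have c21 : {for x, continuous (fun x : C2 R => x.2.1)} by apply: continuous_comp; [exact: cvg_snd|exact: cvg_fst].
  have c22 : {for x, continuous (fun x : C2 R => - x.2.2)}.
    by apply: continuousN; apply: continuous_comp; [exact: cvg_snd|exact: cvg_snd].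
  by apply: (@cvg_pair _ _ _ _ (nbhs (- x.1.2, x.1.1)) (nbhs (- x.2.2, x.2.1)));
    [apply: (@cvg_pair _ _ _ _ (nbhs (- x.1.2)) (nbhs x.1.1))
    |apply: (@cvg_pair _ _ _ _ (nbhs (- x.2.2)) (nbhs x.2.1))].
have D : {for p, continuous (fun p : R * C2 R => p.2)} by exact: cvg_snd.
have E : {for p, continuous (fun p : R * C2 R => mulI p.2)}.
  by apply: (@continuous_comp _ _ _ (fun p : R * C2 R => p.2) (@mulI R)); [exact: D|exact: I].
have h1 := continuousZ C D.
have h2 := continuousZ S E.
have h3 : {for p, continuous (fun _ : R * C2 R => z)} by exact: cvg_cst.
exact: (continuousD (continuousD h3 h1) h2).
Qed.

End BallMean.

(** * The reproducing formula *)

Section Reproducing.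
Context {R : realType}.
Local Notation mu := (@lebC2 R).
Local Notation leb := (@lebesgue_measure R).
Implicit Types (U V : set (C2 R)) (u v : C2 R -> R) (w z : C2 R) (r s : R).

Lemma bump_rot r s w : bump r (rot s w) = bump r w.
Proof. by rewrite /bump sqnormC2_rot. Qed.

Lemma bump_integrable r (D : set (C2 R)) : measurable D -> (mu D < +oo)%E ->
  mu.-integrable D (EFin \o bump r).
Proof.
move=> mD fD; apply: measurable_bounded_integrable => //.
  by apply: measurable_funTS; apply: continuous_measurable_C2; exact: bump_continuous.
exists (r ^+ 4); split; first exact: num_real.
move=> K MK w _; apply: le_trans (ltW MK).
by rewrite ger0_norm ?bump_ge0// bump_le.
Qed.

Section Mean.
Context (U : set (C2 R)) (u v : C2 R -> R) (z : C2 R) (r : R).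
Context (oU : open U) (CR : cauchy_riemann U u v) (r0 : 0 <= r)
  (cubeU : forall w, cubeC2 r w -> U (z + w)).

Let EB : set (C2 R) := eballC2 (r ^+ 2).
Let B : set R := `[0, 2 * pi]%classic.

Let mEB : measurable EB. Proof. exact: measurable_eballC2. Qed.
Let mB : measurable B. Proof. exact: measurable_itv. Qed.
Let fEB : (mu EB < +oo)%E. Proof. exact: lebC2_eball_fin. Qed.

Let cu x : U x -> {for x, continuous u}.
Proof. by have [Cu _ _] := CR; exact: C1real_continuous. Qed.

Let ballU w : EB w -> U (z + w).
Proof. by move=> /(eballC2_cubeC2 r0); exact: cubeU. Qed.

Let EBrot s w : EB w -> EB (rot s w).
Proof. by rewrite /EB /eballC2 /= sqnormC2_rot. Qed.

Let G (p : R * C2 R) : R := u (z + cos p.1 *: p.2 + sin p.1 *: mulI p.2) * bump r p.2.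

Let rotz s w : z + cos s *: w + sin s *: mulI w = z + rot s w.
Proof. by rewrite /rot addrA. Qed.

Let G_cont p : U (z + rot p.1 p.2) -> {for p, continuous G}.
Proof.
rewrite -rotz => Up; have h1 := @continuous_rot_pair R z p.
have h2 := @continuous_comp _ _ _ _ u p h1 (cu Up).
have h3 : {for p, continuous (fun p : R * C2 R => bump r p.2)}.
  apply: (@continuous_comp _ _ _ (fun p : R * C2 R => p.2) (bump r)); first exact: cvg_snd.
  exact: bump_continuous.
exact: (continuousM h2 h3).
Qed.

Let mean_measurable : measurable_fun (B `*` EB) G.
Proof.
pose W := [set p : R * C2 R | U (z + cos p.1 *: p.2 + sin p.1 *: mulI p.2)].
have oW : open W by apply: (open_comp _ oU) => p _; exact: continuous_rot_pair.
apply: (@measurable_funS _ _ _ _ W).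
- exact: open_measurable_RC2.
- by move=> [s w] [_ /= EBw]; rewrite /W /= rotz; apply/ballU/EBrot.
- apply: measurable_fun_opens => A oA; apply: open_measurable_RC2.
  rewrite openE => p [Wp fp]; apply: filterI; first exact: open_nbhs_nbhs.
  by apply: G_cont; [move: Wp; rewrite /W /= rotz|exact: open_nbhs_nbhs].
Qed.

Let mean_bounded : exists M : R, forall p, (B `*` EB) p -> `|G p| <= M.
Proof.
have [M HM] : exists M : R, forall w, cubeC2 r w -> `|u (z + w)| <= M.
  apply: compact_bounded_fun; first exact: cubeC2_compact.
  move=> w /cubeU Uw.
  apply: (@continuous_comp _ _ _ (fun w => z + w) u); last exact: cu.
  by apply: (@cvgD _ _ _ _ _ (cst z) id); [exact: cvg_cst|exact: cvg_id].
exists (M * r ^+ 4) => -[s w] [_ /= EBw].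
rewrite /G /= rotz normrM ler_pM//; first by apply/HM/(eballC2_cubeC2 r0)/EBrot.
by rewrite ger0_norm ?bump_ge0// bump_le.
Qed.

Let measurable_u1 : measurable_fun EB (fun w => u (z + w) * bump r w).
Proof.
have cz : continuous (fun w : C2 R => z + w).
  by move=> w; apply: (@cvgD _ _ _ _ _ (cst z) id); [exact: cvg_cst|exact: cvg_id].
pose W := [set w | U (z + w)].
have oW : open W by apply: (open_comp _ oU) => p _; exact: cz.
apply: (@measurable_funS _ _ _ _ W).
- exact: open_measurable_C2.
- exact: ballU.
- apply: open_continuous_measurable_C2 => // w /[!inE] Uw.
  have h := @continuous_comp _ _ _ (fun w => z + w) u w (cz w) (cu Uw).
  exact: (continuousM h (@bump_continuous R r w)).
Qed.

Let one_pos : {posnum R} := PosNum (@ltr01 R).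

Let rot_integral s : \int[mu]_(w in EB) (u (z + rot s w) * bump r (rot s w)) =
  \int[mu]_(w in EB) (u (z + w) * bump r w).
Proof.
have H A : measurable A -> mu (rot s @^-1` A) = (one_pos%:num%:E * mu A)%E.
  by move=> mA; rewrite mul1e; exact: lebC2_rot.
have := Rintegral_change_of_variables (@measurable_rot R s) H mEB measurable_u1.
rewrite mul1r => <-; congr (Rintegral _ _ _).
by apply/seteqP; split => w; rewrite /EB /eballC2 /= sqnormC2_rot.
Qed.

(** Rotations preserve the measure, the ball and the bump, so u (z + w) may be
    replaced in the integral by its average over the circle through w, which is
    u z by [circle_mean]. *)
Lemma ball_mean :
  \int[mu]_(w in EB) (u (z + w) * bump r w) = bump_mass r * u z.
Proof.
have p2 : (0 : R) < 2 * pi by rewrite mulr_gt0// pi_gt0.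
have lB : leb B = (2 * pi)%:E by rewrite /B lebesgue_measure_itv /= lte_fin p2 -EFinB subr0.
have fB : (leb B < +oo)%E by rewrite lB ltry.
have [M GM] := mean_bounded.
have Fub := @Rintegral_Fubini_bounded _ _ _ _ R leb mu B EB G M mB mEB fB fEB mean_measurable GM.
have L : \int[leb]_(s in B) \int[mu]_(w in EB) G (s, w) =
    \int[mu]_(w in EB) (u (z + w) * bump r w) * (2 * pi).
  transitivity (\int[leb]_(s in B) \int[mu]_(w in EB) (u (z + w) * bump r w)).
    apply: eq_Rintegral => s _; rewrite -(rot_integral s); apply: eq_Rintegral => w _.
    by rewrite /G /= rotz bump_rot.
  rewrite Rintegral_cst; last exact: mB.
  by congr (_ * _); exact: (congr1 fine lB).
have Rt : \int[mu]_(w in EB) \int[leb]_(s in B) G (s, w) = (2 * pi) * (bump_mass r * u z).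
  transitivity (\int[mu]_(w in EB) ((2 * pi * u z) * bump r w)).
    apply: eq_Rintegral => w /[!inE] EBw.
    have cm : \int[leb]_(s in B) u (z + cos s *: w + sin s *: mulI w) = 2 * pi * u z.
      apply: (circle_mean oU CR) => p q pq; rewrite -addrA; apply: ballU.
      rewrite /EB /eballC2 /= sqnorm_rot.
      rewrite (le_trans _ (_ : sqnormC2 w <= _))// ler_piMl// /sqnormC2.
      by rewrite !addr_ge0// sqr_ge0.
    rewrite -cm -RintegralZr; [by []|exact: mB|].
    apply: continuous_compact_integrable; first exact: segment_compact.
    apply: continuous_in_subspaceT => s _.
    have h1 := @continuous_comp R (R * C2 R)%type (C2 R) (fun s => (s, w)) _ s
      (@continuous_pairl R (C2 R) s w) (@continuous_rot_pair R z (s, w)).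
    apply: (@continuous_comp R (C2 R) R (fun s => z + cos s *: w + sin s *: mulI w) u s h1).
    by apply: cu; rewrite /= rotz; apply/ballU/EBrot.
  rewrite RintegralZl; [by rewrite /bump_mass -/EB; ring|exact: mEB|].
  exact: bump_integrable.
move: Fub; rewrite L Rt mulrC => /(mulfI _); apply.
by rewrite gt_eqF.
Qed.

End Mean.

Lemma Rintegral_support (D D' : set (C2 R)) (f : C2 R -> R) : D' `<=` D ->
  (forall x, D x -> ~ D' x -> f x = 0) -> \int[mu]_(x in D) f x = \int[mu]_(x in D') f x.
Proof.
move=> D'D f0; rewrite Rintegral_mkcond [RHS]Rintegral_mkcond; congr (Rintegral _ _ _).
apply/funext => x; rewrite !patchE; case: ifPn => xD; case: ifPn => xD' //.
- by apply: f0; [exact: set_mem|rewrite notin_setE in xD'].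
- by move: xD; rewrite notin_setE => -[]; apply: D'D; exact: set_mem.
Qed.

(** The bump is at least (r^2 / 2)^2 on the cube of half-side r / 4. *)
Lemma bump_mass_gt0 r : 0 < r -> 0 < bump_mass r.
Proof.
move=> r0; pose q := r / 4; have q0 : 0 < q by rewrite divr_gt0.
pose k := (r ^+ 2 / 2) ^+ 2; have k0 : 0 < k by rewrite exprn_gt0// divr_gt0// exprn_gt0.
have EB : mu.-integrable (eballC2 (r ^+ 2)) (EFin \o bump r).
  by apply: bump_integrable; [exact: measurable_eballC2|apply: lebC2_eball_fin; exact: ltW].
have sq4 w : cubeC2 q w -> sqnormC2 w <= r ^+ 2 / 4.
  have h (t : R) : - q <= t <= q -> t ^+ 2 <= r ^+ 2 / 16.
    by move=> /andP[h1 h2]; rewrite /q in h1 h2 *; nra.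
  case: w => [[a b] [c d]] [[/=]]; rewrite !in_itv /= => /h ha /h hb [/h hc /h hd].
  by rewrite /sqnormC2 /=; lra.
have r2 : 0 < r ^+ 2 by rewrite exprn_gt0.
have sub : cubeC2 q `<=` eballC2 (r ^+ 2).
  by move=> w /sq4; rewrite /eballC2 /= => h; lra.
have kb w : cubeC2 q w -> k <= bump r w.
  move=> /sq4 h; rewrite /k /bump ler_pXn2r ?nnegrE ?divr_ge0 ?(ltW r2) ?le_max ?lexx//.
  by apply/orP; right; lra.
have mq : measurable (cubeC2 q) by exact: measurable_cubeC2.
have mb (D : set (C2 R)) : measurable_fun D (EFin \o bump r).
  by apply/measurable_EFinP; apply: measurable_funTS; apply: continuous_measurable_C2; exact: bump_continuous.
have H : ((k * (q *+ 2) ^+ 4)%:E <= \int[mu]_(w in eballC2 (r ^+ 2)) (bump r w)%:E)%E.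
  apply: (@le_trans _ _ (\int[mu]_(w in cubeC2 q) (bump r w)%:E)%E).
    apply: (@le_trans _ _ (\int[mu]_(w in cubeC2 q) k%:E)%E).
      rewrite integral_cst; last exact: mq.
      by rewrite EFinM -(lebC2_cube (ltW q0)); exact: lexx.
    apply: ge0_le_integral.
    - exact: mq.
    - by move=> w _; rewrite lee_fin ltW.
    - exact: measurable_cst.
    - exact: mb.
    - by move=> w qw; rewrite lee_fin; exact: kb.
  apply: ge0_subset_integral.
  - exact: mq.
  - exact: measurable_eballC2.
  - exact: mb.
  - by move=> w _; rewrite lee_fin bump_ge0.
  - exact: sub.
have fin := integrable_fin_num (mu:=mu) (measurable_eballC2 (r ^+ 2)) EB.
rewrite /bump_mass /Rintegral -lte_fin fineK//.
by apply: lt_le_trans H; rewrite lte_fin mulr_gt0// exprn_gt0// pmulrn_lgt0.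
Qed.

(** The domain of integration V is independent of z: one V serves all points z
    of a neighbourhood, which makes the left-hand side a convolution. *)
Lemma reproducing U V u v z r : open U -> cauchy_riemann U u v -> 0 <= r ->
  measurable V -> V `<=` U -> (forall w, cubeC2 r w -> V (z + w)) ->
  \int[mu]_(w in V) (u w * bump r (w - z)) = bump_mass r * u z.
Proof.
move=> oU CR r0 mV VU cV.
rewrite -(ball_mean oU CR r0); last by move=> w /cV/VU.
pose tau := fun w : C2 R => w + z.
have mtau : measurable_fun [set: C2 R] tau.
  have [m11 m12 m21 m22] := @measurable_coord R.
  by apply: measurable_fun_pair; apply: measurable_fun_pair; apply: measurable_funD.
have H A : measurable A -> mu (tau @^-1` A) = ((PosNum (@ltr01 R))%:num%:E * mu A)%E.
  by move=> mA; rewrite mul1e; exact: lebC2_translation.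
have mf : measurable_fun V (fun w => u w * bump r (w - z)).
  apply: measurable_funM.
    apply: (@measurable_funS _ _ _ _ U) => //; first exact: open_measurable_C2.
    apply: open_continuous_measurable_C2 => // w /[!inE].
    by have [Cu _ _] := CR; exact: C1real_continuous.
  apply: measurable_funTS; apply: continuous_measurable_C2 => w.
  have h1 := @continuous_translate R (- z) w.
  exact: (@continuous_comp _ _ _ (fun w => w - z) (bump r) w h1 (@bump_continuous R r _)).
have := Rintegral_change_of_variables mtau H mV mf; rewrite mul1r => <-.
rewrite (@Rintegral_support _ (eballC2 (r ^+ 2))).
- by apply: eq_Rintegral => w _; rewrite /tau addrK addrC.
- by move=> w /(eballC2_cubeC2 r0)/cV; rewrite /tau /= addrC.
- move=> w _ nEB; rewrite /tau addrK bump_out ?mulr0// ltNge.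
  by apply/negP.
Qed.

End Reproducing.

(** * The Euclidean product on C^2 and differentiability *)

Section QuadraticRemainder.
Context {R : realType}.
Implicit Types (w z a y : C2 R) (r s : R).

Definition dotC2 (l a : C2 R) : R :=
  l.1.1 * a.1.1 + l.1.2 * a.1.2 + (l.2.1 * a.2.1 + l.2.2 * a.2.2).

Lemma dotC2_linear l : linear_for *%R (dotC2 l).
Proof.
move=> k [[a b] [c d]] [[a' b'] [c' d']].
have -> : k *: ((a, b), (c, d)) + ((a', b'), (c', d')) =
  ((k * a + a', k * b + b'), (k * c + c', k * d + d')) :> C2 R by [].
by rewrite /dotC2 /=; ring.
Qed.

HB.instance Definition _ l := GRing.isLinear.Build R (C2 R) R *%R (dotC2 l) (dotC2_linear l).

Lemma continuous_coord (x : C2 R) :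
  [/\ {for x, continuous (fun x : C2 R => x.1.1)}, {for x, continuous (fun x : C2 R => x.1.2)},
      {for x, continuous (fun x : C2 R => x.2.1)} & {for x, continuous (fun x : C2 R => x.2.2)}].
Proof.
split.
- by apply: continuous_comp; exact: cvg_fst.
- by apply: continuous_comp; [exact: cvg_fst|exact: cvg_snd].
- by apply: continuous_comp; [exact: cvg_snd|exact: cvg_fst].
- by apply: continuous_comp; exact: cvg_snd.
Qed.

Lemma dotC2_continuous l : continuous (dotC2 l).
Proof.
move=> x; have [c11 c12 c21 c22] := continuous_coord x.
have cc (k : R) : {for x, continuous (fun _ : C2 R => k)} by exact: cvg_cst.
exact: (continuousD (continuousD (continuousM (cc l.1.1) c11) (continuousM (cc l.1.2) c12))
                    (continuousD (continuousM (cc l.2.1) c21) (continuousM (cc l.2.2) c22))).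
Qed.

Lemma normC2_coord (x : C2 R) :
  [/\ `|x.1.1| <= `|x|, `|x.1.2| <= `|x|, `|x.2.1| <= `|x| & `|x.2.2| <= `|x|].
Proof.
have h1 (T : normedModType R) (p : T * T) : `|p.1| <= `|p| by rewrite prod_normE le_max lexx.
have h2 (T : normedModType R) (p : T * T) : `|p.2| <= `|p| by rewrite prod_normE le_max lexx orbT.
by split; [apply: le_trans (h1 _ x); exact: h1|apply: le_trans (h1 _ x); exact: h2
          |apply: le_trans (h2 _ x); exact: h1|apply: le_trans (h2 _ x); exact: h2].
Qed.

Lemma sqnormC2_le_norm (x : C2 R) : sqnormC2 x <= 4 * `|x| ^+ 2.
Proof.
have [h1 h2 h3 h4] := normC2_coord x.
have h (t : R) : `|t| <= `|x| -> t ^+ 2 <= `|x| ^+ 2.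
  by move=> ht; rewrite -real_normK ?num_real// ler_pXn2r// nnegrE.
by rewrite /sqnormC2; have := h _ h1; have := h _ h2; have := h _ h3; have := h _ h4; lra.
Qed.

(** A quadratic bound on the remainder yields differentiability together with
    the gradient l. *)
Lemma differentiable_quadratic (f : C2 R -> R) x l (C : R) : 0 <= C ->
  (forall a, sqnormC2 a <= 4 -> `|f (x + a) - f x - dotC2 l a| <= C * sqnormC2 a) ->
  differentiable (f : C2 R -> R^o) x /\ forall a, 'D_a (f : C2 R -> R^o) x = dotC2 l a.
Proof.
move=> C0 H.
pose V : normedModType R := C2 R; pose W : normedModType R := R^o.
pose F : V -> W := f; pose L : {linear V -> W} := dotC2 l.
have cL : continuous L by exact: dotC2_continuous.
have E : F \o shift (x : V) = cst (F x) + L +o_ (0 : V) id.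
  apply/eqaddoP => e e0.
  have e1 : 0 < e / (4 * C + 1) by rewrite divr_gt0// ltr_wpDl// mulr_ge0.
  near=> a.
  have a1 : `|a| <= 1 by near: a; exact: (@nbhs0_le _ V _ ltr01).
  have a2 : `|a| <= e / (4 * C + 1) by near: a; exact: (@nbhs0_le _ V _ e1).
  have a0 := normr_ge0 a; have Sa := sqnormC2_le_norm a.
  have S4 : sqnormC2 a <= 4.
    by apply: (le_trans Sa); rewrite -[X in _ <= X]mulr1 ler_wpM2l// expr_le1.
  rewrite /= -[X in `|X| <= _]/(f (a + x) - (f x + dotC2 l a)) opprD addrA [a + x]addrC.
  apply: (le_trans (H a S4)); apply: (le_trans (ler_wpM2l C0 Sa)).
  have C1 : 0 < 4 * C + 1 by rewrite ltr_wpDl// mulr_ge0.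
  rewrite expr2 !mulrA ler_wpM2r//.
  move: a2; rewrite ler_pdivlMr// => a2.
  by apply: le_trans a2; nra.
have dE := diff_unique cL E.
have df : differentiable (f : C2 R -> R^o) x by apply/diff_locallyP; rewrite dE.
by split => // a; rewrite deriveE// dE.
Unshelve. all: by end_near. Qed.

End QuadraticRemainder.

(** * The derivative of the bump function *)

Section Convolution.
Context {R : realType}.
Local Notation mu := (@lebC2 R).
Implicit Types (w z a y : C2 R) (r s : R) (V : set (C2 R)).

(** The derivative of the bump at y along - a, that is, the derivative along a
    of z |-> bump r (w - z) where w - z = y. *)
Definition dbump r a y : R := 4 * Num.max 0 (r ^+ 2 - sqnormC2 y) * dotC2 y a.

(** First-order Taylor expansion of the square of the positive part, whose
    derivative is 2-Lipschitz. *)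
Lemma pos_sqr_remainder (s h : R) :
  `|Num.max 0 (s + h) ^+ 2 - Num.max 0 s ^+ 2 - 2 * Num.max 0 s * h| <= h ^+ 2.
Proof.
by case: (lerP 0 s) => hs; case: (lerP 0 (s + h)) => hsh;
  rewrite ?expr0n /= ler_norml; apply/andP; split; nra.
Qed.

Lemma sqnormC2B y a : sqnormC2 (y - a) = sqnormC2 y - 2 * dotC2 y a + sqnormC2 a.
Proof.
case: y a => [[y1 y2] [y3 y4]] [[a1 a2] [a3 a4]].
have -> : ((y1, y2), (y3, y4)) - ((a1, a2), (a3, a4)) =
  ((y1 - a1, y2 - a2), (y3 - a3, y4 - a4)) :> C2 R by [].
by rewrite /sqnormC2 /dotC2 /=; ring.
Qed.

Lemma sqnormC2_ge0 y : 0 <= sqnormC2 y. Proof. by rewrite !addr_ge0 ?sqr_ge0. Qed.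

Lemma dotC2_cauchy_schwarz y a : dotC2 y a ^+ 2 <= sqnormC2 y * sqnormC2 a.
Proof.
case: y a => [[y1 y2] [y3 y4]] [[a1 a2] [a3 a4]]; rewrite /dotC2 /sqnormC2 /= -subr_ge0.
rewrite (_ : _ - _ = (y1 * a2 - y2 * a1) ^+ 2 + (y1 * a3 - y3 * a1) ^+ 2 + (y1 * a4 - y4 * a1) ^+ 2
  + (y2 * a3 - y3 * a2) ^+ 2 + (y2 * a4 - y4 * a2) ^+ 2 + (y3 * a4 - y4 * a3) ^+ 2); last by ring.
by rewrite !addr_ge0 ?sqr_ge0.
Qed.

Lemma sqnormC2_shift2 y a : 0 <= sqnormC2 y - 4 * dotC2 y a + 4 * sqnormC2 a.
Proof.
case: y a => [[y1 y2] [y3 y4]] [[a1 a2] [a3 a4]]; rewrite /dotC2 /sqnormC2 /=.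
apply: (@le_trans _ _ ((y1 - 2 * a1) ^+ 2 + (y2 - 2 * a2) ^+ 2 + (y3 - 2 * a3) ^+ 2
  + (y4 - 2 * a4) ^+ 2)); first by rewrite !addr_ge0 ?sqr_ge0.
by rewrite le_eqVlt; apply/orP; left; apply/eqP; ring.
Qed.

(** The estimate is uniform in y: if y is far from the origin all three terms
    vanish, and otherwise |y| is bounded in terms of r, which bounds the
    increment of the squared norm linearly in |a|. *)
Lemma bump_remainder r y a : sqnormC2 a <= 4 ->
  `|bump r (y - a) - bump r y - dbump r a y| <= (18 * r ^+ 2 + 72) * sqnormC2 a.
Proof.
move=> a4; have a0 := sqnormC2_ge0 a; have y0 := sqnormC2_ge0 y.
have CS := dotC2_cauchy_schwarz y a; have r2 := sqr_ge0 r.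
rewrite /bump /dbump sqnormC2B.
have pr : sqnormC2 y - 2 * dotC2 y a + sqnormC2 a <= r ^+ 2 -> sqnormC2 y <= 2 * r ^+ 2 + 8.
  by have := sqnormC2_shift2 y a; lra.
set s := r ^+ 2 - sqnormC2 y; set h := 2 * dotC2 y a - sqnormC2 a.
have -> : r ^+ 2 - (sqnormC2 y - 2 * dotC2 y a + sqnormC2 a) = s + h by rewrite /s /h; ring.
have m0 : 0 <= Num.max 0 s by rewrite le_max lexx.
have mr : Num.max 0 s <= r ^+ 2 by rewrite ge_max r2 /s gerBl.
have := pos_sqr_remainder s h.
have -> : 4 * Num.max 0 s * dotC2 y a = 2 * Num.max 0 s * h + 2 * Num.max 0 s * sqnormC2 a.
  by rewrite /h; ring.
have [neg|pos] := boolP ((s <= 0) && (s + h <= 0)).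
  move: neg => /andP[s0 sh0] _.
  by rewrite (max_l s0) (max_l sh0) expr0n /= !mulr0 !mul0r subrr addr0 subrr normr0 mulr_ge0//; lra.
have Y : sqnormC2 y <= 2 * r ^+ 2 + 8.
  have := sqnormC2B y a => E.
  move: pos; rewrite negb_and -!ltNge => /orP[sp|shp]; first by rewrite /s in sp; lra.
  by apply: pr; rewrite /s /h in shp; lra.
move=> H.
have hh : h ^+ 2 <= (16 * r ^+ 2 + 72) * sqnormC2 a.
  have : h ^+ 2 <= 8 * dotC2 y a ^+ 2 + 2 * sqnormC2 a ^+ 2.
    by rewrite /h; have := sqr_ge0 (2 * dotC2 y a + sqnormC2 a); lra.
  move: (sqnormC2 y) (dotC2 y a) (sqnormC2 a) (r ^+ 2) a4 a0 y0 CS r2 Y => Y' D A r2' a4 a0 y0 CS r20 HY.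
  nra.
rewrite opprD addrA; apply: (le_trans (ler_normB _ _)).
rewrite [X in _ + X]ger0_norm; last by rewrite !mulr_ge0.
have : 2 * Num.max 0 s * sqnormC2 a <= 2 * r ^+ 2 * sqnormC2 a by rewrite ler_wpM2r// ler_wpM2l.
lra.
Qed.

Lemma dotC2_le y a (k : R) : `|y| <= k -> `|dotC2 y a| <= 4 * k * `|a|.
Proof.
move=> yk; have [h1 h2 h3 h4] := normC2_coord y; have [g1 g2 g3 g4] := normC2_coord a.
have h (p q : R) : `|p| <= `|y| -> `|q| <= `|a| -> `|p * q| <= k * `|a|.
  by move=> py qa; rewrite normrM ler_pM// (le_trans py).
rewrite /dotC2; apply: (le_trans (ler_normD _ _)).
apply: (@le_trans _ _ ((k * `|a| + k * `|a|) + (k * `|a| + k * `|a|))).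
  by apply: lerD; apply: (le_trans (ler_normD _ _)); apply: lerD; exact: h.
lra.
Qed.

Lemma sqnormC2_lip y y' (k : R) : `|y| <= k -> `|y'| <= k ->
  `|sqnormC2 y - sqnormC2 y'| <= 8 * k * `|y - y'|.
Proof.
move=> yk y'k; have -> : sqnormC2 y - sqnormC2 y' = dotC2 (y + y') (y - y').
  case: y y' {yk y'k} => [[y1 y2] [y3 y4]] [[a1 a2] [a3 a4]].
  have -> : ((y1, y2), (y3, y4)) - ((a1, a2), (a3, a4)) =
    ((y1 - a1, y2 - a2), (y3 - a3, y4 - a4)) :> C2 R by [].
  have -> : ((y1, y2), (y3, y4)) + ((a1, a2), (a3, a4)) =
    ((y1 + a1, y2 + a2), (y3 + a3, y4 + a4)) :> C2 R by [].
  by rewrite /sqnormC2 /dotC2 /=; ring.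
have : `|y + y'| <= 2 * k by apply: (le_trans (ler_normD _ _)); lra.
by move=> /(dotC2_le (y - y')); rewrite !mulrA (_ : 4 * 2 * k = 8 * k)//; ring.
Qed.

Lemma normC2_le_sqnorm y (k : R) : 0 <= k -> sqnormC2 y <= k ^+ 2 -> `|y| <= k.
Proof.
move=> k0 yk; have /(_ y yk) := eballC2_cubeC2 k0.
case: y {yk} => [[a b] [c d]] [[/=]]; rewrite !in_itv /= -!ler_norml => ha hb [hc hd].
by rewrite !prod_normE !ge_max /= ha hb hc.
Qed.

(** Both values vanish unless one of the points lies in the ball of radius r;
    both points are then bounded by r + 1, where each factor is bounded and
    Lipschitz. *)
Lemma dbump_lip r a y y' : 0 <= r -> `|y - y'| <= 1 ->
  `|dbump r a y - dbump r a y'| <= 4 * ((32 * (r + 1) ^+ 2 + 4 * r ^+ 2) * `|a|) * `|y - y'|.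
Proof.
move=> r0 d1; rewrite /dbump.
have [h|h] := boolP ((r ^+ 2 <= sqnormC2 y) && (r ^+ 2 <= sqnormC2 y')).
  move: h => /andP[h h']; rewrite !max_l ?subr_le0// !mulr0 !mul0r subrr normr0.
  by rewrite !mulr_ge0// addr_ge0// mulr_ge0// sqr_ge0.
have [yk y'k] : `|y| <= r + 1 /\ `|y'| <= r + 1.
  move: h; rewrite negb_and -!ltNge => /orP[/ltW|/ltW] /(normC2_le_sqnorm r0) h.
    split; first by lra.
    by rewrite -[y'](subKr y) (le_trans (ler_normB _ _))// lerD.
  split; last by lra.
  by rewrite -[y](subrK y') addrC (le_trans (ler_normD _ _))// lerD.
set m := Num.max 0 _; set m' := Num.max 0 _.
have mm : `|m - m'| <= 8 * (r + 1) * `|y - y'|.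
  apply: le_trans (sqnormC2_lip yk y'k).
  rewrite /m /m'; move: (sqnormC2 y) (sqnormC2 y') => s s'.
  by case: (lerP 0 (r ^+ 2 - s)) => hs; case: (lerP 0 (r ^+ 2 - s')) => hs';
    have := ler_norm (s - s'); have := ler_norm (s' - s); rewrite (distrC s' s) => *;
    rewrite ler_norml; apply/andP; split; lra.
have m'r : `|m'| <= r ^+ 2.
  by rewrite ger0_norm ?le_max ?lexx// ge_max sqr_ge0 /= gerBl sqnormC2_ge0.
have -> : 4 * m * dotC2 y a - 4 * m' * dotC2 y' a = 4 * ((m - m') * dotC2 y a + m' * dotC2 (y - y') a).
  case: (y) (y') a => [[y1 y2] [y3 y4]] [[z1 z2] [z3 z4]] [[a1 a2] [a3 a4]].
  have -> : ((y1, y2), (y3, y4)) - ((z1, z2), (z3, z4)) =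
    ((y1 - z1, y2 - z2), (y3 - z3, y4 - z4)) :> C2 R by [].
  by rewrite /dotC2 /=; ring.
rewrite normrM ger0_norm// -[X in _ <= X]mulrA ler_wpM2l//.
apply: (le_trans (ler_normD _ _)); rewrite !normrM.
have H1 : `|m - m'| * `|dotC2 y a| <= (8 * (r + 1) * `|y - y'|) * (4 * (r + 1) * `|a|).
  by apply: ler_pM => //; exact: dotC2_le.
have H2 : `|m'| * `|dotC2 (y - y') a| <= r ^+ 2 * (4 * `|y - y'| * `|a|).
  by apply: ler_pM => //; exact: dotC2_le.
apply: (le_trans (lerD H1 H2)); rewrite le_eqVlt; apply/orP; left; apply/eqP; ring.
Qed.

End Convolution.

(** * Convolutions with the bump function are C^1 *)

Section Conv.
Context {R : realType}.
Local Notation mu := (@lebC2 R).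
Implicit Types (w z a y : C2 R) (r s : R).
Context (V : set (C2 R)) (g : C2 R -> R) (r : R).
Context (mV : measurable V) (r0 : 0 <= r) (ig : mu.-integrable V (EFin \o g)).

(** The kernel is evaluated at w - z, not z - w: the bump is even, and [dbump]
    is signed accordingly. *)
Definition conv (k : C2 R -> R) z : R := \int[mu]_(w in V) (g w * k (w - z)).

Let N1 : R := \int[mu]_(w in V) `|g w|.

Let mg : measurable_fun V g.
Proof. by apply/measurable_EFinP; exact: (measurable_int mu ig). Qed.

Lemma bounded_mul_integrable (k : C2 R -> R) (C : R) : measurable_fun V k ->
  (forall w, V w -> `|k w| <= C) -> mu.-integrable V (EFin \o (fun w => g w * k w)).
Proof.
move=> mk kC.
have ig' : mu.-integrable V (EFin \o (fun w => C * `|g w|)).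
  apply: lebC2_integrableZ => //; exact: (integrable_norm (mu:=mu) ig).
apply: (integrable_dominated mV _ ig'); first exact: measurable_funM.
by move=> w Vw; rewrite normrM mulrC ler_wpM2r//; exact: kC.
Qed.

Lemma bounded_mul_Rintegral (k : C2 R -> R) (C : R) : measurable_fun V k ->
  (forall w, V w -> `|k w| <= C) -> `|\int[mu]_(w in V) (g w * k w)| <= C * N1.
Proof.
move=> mk kC.
have i1 := bounded_mul_integrable mk kC.
have ia : mu.-integrable V (EFin \o (fun w => `|g w|)) by exact: (integrable_norm (mu:=mu) ig).
apply: le_trans (le_normr_Rintegral (mu:=mu) mV i1) _.
rewrite /N1 -RintegralZl; [|exact: mV|exact: ia].
apply: le_Rintegral => //.
- by have := integrable_norm (mu:=mu) i1.
- exact: lebC2_integrableZ.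
- by move=> w Vw; rewrite normrM mulrC ler_wpM2r//; exact: kC.
Qed.

Let shift_measurable (k : C2 R -> R) z : continuous k -> measurable_fun V (fun w => k (w - z)).
Proof.
move=> ck; apply: measurable_funTS; apply: continuous_measurable_C2 => w.
exact: (@continuous_comp _ _ _ (fun w => w - z) k w (@continuous_translate R (- z) w) (ck _)).
Qed.

Lemma dbump_continuous a : continuous (dbump r a).
Proof.
move=> w.
have c : {for w, continuous (fun w => Num.max 0 (r ^+ 2 - sqnormC2 w))}.
  apply: (@continuous_max _ _ (fun=> 0) (fun w => r ^+ 2 - sqnormC2 w)); first exact: cvg_cst.
  apply: (@continuousB _ _ _ (fun=> r ^+ 2) (@sqnormC2 R)); first exact: cvg_cst.
  exact: sqnormC2_continuous.
have c4 : {for w, continuous (fun _ : C2 R => 4 : R)} by exact: cvg_cst.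
have d : {for w, continuous (fun y => dotC2 y a)}.
  rewrite (_ : (fun y => dotC2 y a) = dotC2 a); first exact: dotC2_continuous.
  by apply/funext => y; rewrite /dotC2; ring.
exact: (continuousM (continuousM c4 c) d).
Qed.

Lemma dbump_bounded a w : `|dbump r a w| <= 16 * r ^+ 2 * (r + 1) * `|a|.
Proof.
rewrite /dbump; have [h|/ltW h] := leP (r ^+ 2) (sqnormC2 w).
  by rewrite max_l ?subr_le0// mulr0 mul0r normr0 !mulr_ge0// ?exprn_ge0// addr_ge0.
have wr : `|w| <= r + 1 by have := normC2_le_sqnorm r0 h; lra.
have m0 : 0 <= Num.max 0 (r ^+ 2 - sqnormC2 w) by rewrite le_max lexx.
have mr : Num.max 0 (r ^+ 2 - sqnormC2 w) <= r ^+ 2 by rewrite ge_max sqr_ge0 /= gerBl sqnormC2_ge0.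
rewrite normrM ger0_norm ?mulr_ge0//.
have -> : 16 * r ^+ 2 * (r + 1) * `|a| = (4 * r ^+ 2) * (4 * (r + 1) * `|a|) by ring.
by rewrite ler_pM ?mulr_ge0// ?ler_wpM2l//; exact: dotC2_le.
Qed.

Let ibump z : mu.-integrable V (EFin \o (fun w => g w * bump r (w - z))).
Proof.
apply: (@bounded_mul_integrable _ (r ^+ 4)); first by apply: shift_measurable; exact: bump_continuous.
by move=> w _; rewrite ger0_norm ?bump_ge0// bump_le.
Qed.

Let idbump a z : mu.-integrable V (EFin \o (fun w => g w * dbump r a (w - z))).
Proof.
apply: (@bounded_mul_integrable _ (16 * r ^+ 2 * (r + 1) * `|a|)).
  by apply: shift_measurable; exact: dbump_continuous.
by move=> w _; exact: dbump_bounded.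
Qed.

Let grad z : C2 R :=
  ((conv (dbump r (e0 : C2 R)) z, conv (dbump r (e1 : C2 R)) z),
   (conv (dbump r (e2 : C2 R)) z, conv (dbump r (e3 : C2 R)) z)).

Lemma conv_dbumpE a z : conv (dbump r a) z = dotC2 (grad z) a.
Proof.
rewrite /dotC2 /grad /= /conv.
have Z (k : R) b : mu.-integrable V (EFin \o (fun w => k * (g w * dbump r b (w - z)))).
  by apply: lebC2_integrableZ => //; exact: idbump.
rewrite ![_ * a.1.1]mulrC ![_ * a.1.2]mulrC ![_ * a.2.1]mulrC ![_ * a.2.2]mulrC.
rewrite -!RintegralZl; [|exact: mV|exact: idbump|exact: mV|exact: idbump|exact: mV|exact: idbump|exact: mV|exact: idbump].
have i1 := lebC2_integrableD mV (Z a.1.1 (e0 : C2 R)) (Z a.1.2 (e1 : C2 R)).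
have i2 := lebC2_integrableD mV (Z a.2.1 (e2 : C2 R)) (Z a.2.2 (e3 : C2 R)).
rewrite -(RintegralD (mu:=mu) mV (Z _ _) (Z _ _)) -(RintegralD (mu:=mu) mV (Z _ _) (Z _ _)).
rewrite -(RintegralD (mu:=mu) mV i1 i2).
apply: eq_Rintegral => w _; rewrite /dbump /dotC2 /=; ring.
Qed.

(** The uniform quadratic remainder of the bump, integrated against g. *)
Lemma conv_remainder z a : sqnormC2 a <= 4 ->
  `|conv (bump r) (z + a) - conv (bump r) z - dotC2 (grad z) a|
    <= ((18 * r ^+ 2 + 72) * N1) * sqnormC2 a.
Proof.
move=> a4; rewrite -conv_dbumpE /conv.
rewrite -(RintegralB (mu:=mu) mV (ibump _) (ibump _)).
have i1 := lebC2_integrableB mV (ibump (z + a)) (ibump z).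
rewrite -(RintegralB (mu:=mu) mV i1 (idbump _ _)).
pose k w := bump r (w - (z + a)) - bump r (w - z) - dbump r a (w - z).
rewrite (@eq_Rintegral _ _ _ mu V (fun w => g w * k w)); last first.
  by move=> w _; rewrite /k; ring.
rewrite mulrAC; apply: bounded_mul_Rintegral.
  by apply: measurable_funB; [apply: measurable_funB|]; apply: shift_measurable;
    [exact: bump_continuous|exact: bump_continuous|exact: dbump_continuous].
by move=> w _; rewrite /k opprD addrA; exact: bump_remainder.
Qed.

(** Differentiation under the integral sign. *)
Lemma conv_differentiable z :
  differentiable (conv (bump r) : C2 R -> R^o) z /\
  forall a, 'D_a (conv (bump r) : C2 R -> R^o) z = conv (dbump r a) z.
Proof.
have N0 : 0 <= N1 by apply: Rintegral_ge0.
have C0 : 0 <= (18 * r ^+ 2 + 72) * N1.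
  by rewrite mulr_ge0// addr_ge0// mulr_ge0// sqr_ge0.
have [dc Dc] := differentiable_quadratic C0 (@conv_remainder z).
by split => // a; rewrite Dc conv_dbumpE.
Qed.

Lemma conv_dbump_continuous a : continuous (conv (dbump r a)).
Proof.
move=> z; apply/cvgrPdist_le => e e_gt0.
have N0 : 0 <= N1 by apply: Rintegral_ge0.
pose C := 4 * ((32 * (r + 1) ^+ 2 + 4 * r ^+ 2) * `|a|).
have C0 : 0 <= C by rewrite !mulr_ge0// addr_ge0// mulr_ge0// sqr_ge0.
have d0 : 0 < e / (C * N1 + 1) by rewrite divr_gt0// ltr_wpDl// mulr_ge0.
near=> t.
have t1 : `|z - t| <= 1 by near: t; exact: cvgr_dist_le.
have t2 : `|z - t| <= e / (C * N1 + 1) by near: t; exact: cvgr_dist_le.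
rewrite /conv -(RintegralB (mu:=mu) mV (idbump _ _) (idbump _ _)).
rewrite (@eq_Rintegral _ _ _ mu V (fun w => g w * (dbump r a (w - z) - dbump r a (w - t)))); last first.
  by move=> w _; ring.
apply: (@le_trans _ _ ((C * `|z - t|) * N1)).
  apply: bounded_mul_Rintegral.
    by apply: measurable_funB; apply: shift_measurable; exact: dbump_continuous.
  move=> w _.
  have E : w - z - (w - t) = t - z by rewrite opprB addrC addrA subrK.
  by apply: le_trans (dbump_lip a r0 _) _; rewrite E distrC.
have C1 : 0 < C * N1 + 1 by rewrite ltr_wpDl// mulr_ge0.
move: t2; rewrite ler_pdivlMr// => t2; apply: le_trans t2.
by rewrite mulrDr mulr1 mulrAC [C * N1 * _]mulrC lerDl.
Unshelve. all: by end_near. Qed.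

Lemma conv_C1real U : C1real U (conv (bump r)).
Proof.
split=> [x _|a]; first exact: (conv_differentiable x).1.
rewrite (_ : (fun x => _) = conv (dbump r a)).
  exact: (continuous_subspaceT (@conv_dbump_continuous a)).
by apply/funext => x; rewrite (conv_differentiable x).2.
Qed.

End Conv.

(** * Calculus of C^1 functions and the exponential weight *)

Section C1calculus.
Context {R : realType}.
Implicit Types (U V : set (C2 R)) (u v : C2 R -> R) (x : C2 R).

Let vC2 : normedModType R := C2 R.
Let vR : normedModType R := R^o.


Lemma near_open U x : open U -> U x -> nbhs x U.
Proof. by move=> oU Ux; exact: (open_nbhs_nbhs (conj oU Ux)). Qed.

(** On an open set, relative continuity of the derivatives is continuity at each
    point. *)
Lemma C1realP U u : open U -> (C1real U u <->
  forall x, U x -> differentiable (u : C2 R -> R^o) x /\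
    forall a, {for x, continuous (fun y => 'D_a (u : C2 R -> R^o) y)}).
Proof.
move=> oU; split=> [[du cu] x Ux|H]; first split; first exact: du.
  by move=> a; exact: (@C1real_continuous_derive R U u a oU (conj du cu)).
split=> [x Ux|a]; first exact: (H x Ux).1.
by rewrite continuous_open_subspace// => x /[!inE] Ux; exact: (H x Ux).2.
Qed.

Lemma eq_on_derive U u v x a : open U -> (forall y, U y -> u y = v y) -> U x ->
  'D_a (u : C2 R -> R^o) x = 'D_a (v : C2 R -> R^o) x.
Proof.
move=> oU uv Ux; apply: near_eq_derive.
by near=> y; apply: uv; near: y; exact: (near_open oU Ux).
Unshelve. all: by end_near. Qed.

Lemma eq_on_differentiable U u v x : open U -> (forall y, U y -> u y = v y) -> U x ->
  differentiable (u : C2 R -> R^o) x -> differentiable (v : C2 R -> R^o) x.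
Proof.
move=> oU uv Ux du.
pose F : vC2 -> vR := u; pose G : vC2 -> vR := v.
have dF : differentiable F (x : vC2) by exact: du.
have cd := diff_continuous dF.
have E0 := diff_locally dF.
have E : G \o shift (x : vC2) = cst (G x) + ('d F x : vC2 -> vR) +o_ (0 : vC2) id.
  apply/eqaddoP => e e0; near=> y.
  have Uyx : U (y + x).
    near: y; have /= := @continuous_translate R x 0 U; rewrite add0r; apply.
    exact: near_open.
  have h : `|(F \o shift (x : vC2) - (cst (F x) + ('d F x : vC2 -> vR))) y| <= e * `|y|.
    by near: y; move/eqaddoP : E0; exact.
  move: h; rewrite /F /G /= -[X in `|X| <= _]/(u (y + x) - (u x + _)) -[X in _ -> `|X| <= _]/(v (y + x) - (v x + _)).
  by rewrite !uv.
have dE := diff_unique cd E.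
by apply/diff_locallyP; rewrite dE.
Unshelve. all: by end_near. Qed.

Lemma C1real_ext U u v : open U -> (forall y, U y -> u y = v y) -> C1real U u -> C1real U v.
Proof.
move=> oU uv /(C1realP _ oU) Cu; apply/(C1realP _ oU) => x Ux.
have [du cu] := Cu x Ux; split; first exact: (eq_on_differentiable oU uv Ux).
move=> a; have := cu a; rewrite /prop_for /continuous_at (eq_on_derive a oU uv Ux).
apply: cvg_trans; apply: near_eq_cvg; near=> y.
apply: (eq_on_derive _ oU uv); near: y; exact: (near_open oU Ux).
Unshelve. all: by end_near. Qed.

Lemma C1realM U u v : open U -> C1real U u -> C1real U v ->
  C1real U (fun x => u x * v x) /\ forall x a, U x ->
   'D_a (fun x => u x * v x : R^o) x = u x * 'D_a (v : C2 R -> R^o) x + v x * 'D_a (u : C2 R -> R^o) x.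
Proof.
move=> oU Cu Cv.
have D x a : U x -> 'D_a (fun x => u x * v x : R^o) x =
    u x * 'D_a (v : C2 R -> R^o) x + v x * 'D_a (u : C2 R -> R^o) x.
  move=> Ux; apply: (@deriveM R (C2 R) u v x a); apply: diff_derivable; [exact: Cu.1|exact: Cv.1].
split; [apply/(C1realP _ oU) => x Ux; split|exact: D].
  exact: (@differentiableM R (C2 R) u v x (Cu.1 x Ux) (Cv.1 x Ux)).
move=> a; rewrite /prop_for /continuous_at (D x a Ux).
have cu := C1real_continuous oU Cu Ux; have cv := C1real_continuous oU Cv Ux.
have cdu := @C1real_continuous_derive R U u a oU Cu x Ux.
have cdv := @C1real_continuous_derive R U v a oU Cv x Ux.
have := continuousD (continuousM cu cdv) (continuousM cv cdu).
apply: cvg_trans; apply: near_eq_cvg; near=> y.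
apply/esym/D; near: y; exact: (near_open oU Ux).
Unshelve. all: by end_near. Qed.

Lemma C1realD U u v : open U -> C1real U u -> C1real U v ->
  C1real U (fun x => u x + v x) /\ forall x a, U x ->
   'D_a (fun x => u x + v x : R^o) x = 'D_a (u : C2 R -> R^o) x + 'D_a (v : C2 R -> R^o) x.
Proof.
move=> oU Cu Cv.
have D x a : U x -> 'D_a (fun x => u x + v x : R^o) x =
    'D_a (u : C2 R -> R^o) x + 'D_a (v : C2 R -> R^o) x.
  move=> Ux; apply: (@deriveD R (C2 R) R^o u v x a); apply: diff_derivable; [exact: Cu.1|exact: Cv.1].
split; [apply/(C1realP _ oU) => x Ux; split|exact: D].
  exact: (@differentiableD R (C2 R) R^o u v x (Cu.1 x Ux) (Cv.1 x Ux)).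
move=> a; rewrite /prop_for /continuous_at (D x a Ux).
have cdu := @C1real_continuous_derive R U u a oU Cu x Ux.
have cdv := @C1real_continuous_derive R U v a oU Cv x Ux.
have := continuousD cdu cdv.
apply: cvg_trans; apply: near_eq_cvg; near=> y.
apply/esym/D; near: y; exact: (near_open oU Ux).
Unshelve. all: by end_near. Qed.

Lemma derive_cstC2 (k : R) x a : 'D_a ((fun=> k) : C2 R -> R^o) x = 0 :> R.
Proof. exact: (@derive_cst R vC2 vR k x a). Qed.

Lemma C1real_cst U (k : R) : open U -> C1real U (fun=> k).
Proof.
move=> oU; apply/(C1realP _ oU) => x Ux; split; first exact: differentiable_cst.
move=> a; have -> : (fun y => 'D_a ((fun=> k) : C2 R -> R^o) y) = (fun=> 0 : R).
  by apply/funext => y; exact: derive_cstC2.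
exact: cvg_cst.
Qed.

Lemma C1realZ U u (k : R) : open U -> C1real U u ->
  C1real U (fun x => k * u x) /\ forall x a, U x ->
   'D_a (fun x => k * u x : R^o) x = k * 'D_a (u : C2 R -> R^o) x.
Proof.
move=> oU Cu; have [C D] := C1realM oU (C1real_cst k oU) Cu.
by split => // x a Ux; rewrite D// derive_cstC2 mulr0 addr0.
Qed.

(** The real exponential e^(Re (conj(z1 l) z1 + conj(z2 l) z2)). *)
Definition expw (l : C2 R) x : R := expR (dotC2 l x).

Lemma C1real_expw U l : open U -> C1real U (expw l) /\
  forall x a, 'D_a (expw l : C2 R -> R^o) x = dotC2 l a * expw l x.
Proof.
move=> oU.
pose L : {linear vC2 -> vR} := dotC2 l.
have cL : continuous L by exact: dotC2_continuous.
have dL x : differentiable L (x : vC2) by exact: linear_differentiable.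
have dE y : differentiable (expR : R -> R) y by apply/derivable1_diffP/derivable_expR.
have dEL x : differentiable (expR \o L : vC2 -> vR) x by apply: differentiable_comp.
have D x a : 'D_a (expw l : C2 R -> R^o) x = dotC2 l a * expw l x.
  have -> : 'D_a (expw l : C2 R -> R^o) x = 'd (expR \o L : vC2 -> vR) x a.
    exact: (deriveE a (dEL x)).
  have -> : 'd (expR \o L : vC2 -> vR) x a = 'd (expR : R -> R) (L x) ('d L x a).
    exact: (congr1 (fun h : vC2 -> vR => h a) (diff_comp (dL x) (dE (L x)))).
  have -> : 'd L x a = dotC2 l a.
    exact: (congr1 (fun h : vC2 -> vR => h a) (diff_lin x cL)).
  have := @diff1E R R expR (L x) (dE (L x)) => ->.
  by rewrite derive1E derive_val.
split=> //; apply/(C1realP _ oU) => x Ux; split; first exact: dEL.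
move=> a; rewrite (_ : (fun y => _) = fun y => dotC2 l a * expw l y); last by apply/funext => y; exact: D.
have h1 : {for x, continuous (fun _ : C2 R => dotC2 l a)} by exact: cvg_cst.
have h2 : {for x, continuous (expw l)} by exact: (differentiable_continuous (dEL x)).
exact: (continuousM h1 h2).
Qed.

End C1calculus.

(** * Linearity and reweighting of the Cauchy-Riemann equations *)

Section HolCalculus.
Context {R : realType}.
Local Notation Re := (@complex.Re R).
Local Notation Im := (@complex.Im R).
Implicit Types (U V : set (C2 R)) (u v : C2 R -> R) (x a l : C2 R) (f g : C2 R -> R[i]).

Definition gradC2 u x : C2 R :=
  (('D_(e0 : C2 R) (u : C2 R -> R^o) x, 'D_(e1 : C2 R) (u : C2 R -> R^o) x),
   ('D_(e2 : C2 R) (u : C2 R -> R^o) x, 'D_(e3 : C2 R) (u : C2 R -> R^o) x)).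

Lemma C2_basis a : a = a.1.1 *: (e0 : C2 R) + a.1.2 *: (e1 : C2 R)
  + a.2.1 *: (e2 : C2 R) + a.2.2 *: (e3 : C2 R).
Proof.
case: a => [[a b] [c d]].
have -> : a *: (e0 : C2 R) + b *: (e1 : C2 R) + c *: (e2 : C2 R) + d *: (e3 : C2 R) =
  ((a * 1 + b * 0 + c * 0 + d * 0, a * 0 + b * 1 + c * 0 + d * 0),
   (a * 0 + b * 0 + c * 1 + d * 0, a * 0 + b * 0 + c * 0 + d * 1)) :> C2 R by [].
by congr ((_, _), (_, _)); ring.
Qed.

Lemma derive_grad u x a : differentiable (u : C2 R -> R^o) x ->
  'D_a (u : C2 R -> R^o) x = dotC2 (gradC2 u x) a.
Proof.
move=> du; rewrite /dotC2 /gradC2 /= !deriveE// {1}(C2_basis a) !linearD !linearZ /= addrA.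
by congr (_ + _ + _ + _); exact: mulrC.
Qed.

(** The equations for the pair (0, 0) are the Cauchy-Riemann equations in the
    two coordinate directions, which extend to all directions by linearity of
    the differential. *)
Lemma cauchy_riemann_Hol U f :
  cauchy_riemann U (fun x => Re (f x)) (fun x => Im (f x)) <-> Hol (fun=> 0) (fun=> 0) U f.
Proof.
split=> [[Cu Cv H]|[[Cu Cv] H]]; split; [by split| |exact: Cu|exact: Cv|].
- move=> x Ux; rewrite !mul0r oppr0; split.
    have [h1 h2] := H x (e0 : C2 R) Ux.
    have E : mulI (e0 : C2 R) = e1 by rewrite /mulI /e0 /e1 /= oppr0.
    rewrite E in h1 h2.
    by apply: complexE; rewrite ?ReD ?ImD ?ReI ?ImI /= ?h1 ?h2 ?subrr ?addrN.
  have [h1 h2] := H x (e2 : C2 R) Ux.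
  have E : mulI (e2 : C2 R) = e3 by rewrite /mulI /e2 /e3 /= oppr0.
  rewrite E in h1 h2.
  by apply: complexE; rewrite ?ReD ?ImD ?ReI ?ImI /= ?h1 ?h2 ?subrr ?addrN.
- move=> x w Ux; have [h1 h2] := H x Ux.
  rewrite !mul0r oppr0 in h1 h2.
  have r1 : 'D_(e0 : C2 R) (fun x => Re (f x) : R^o) x - 'D_(e1 : C2 R) (fun x => Im (f x) : R^o) x = 0.
    by have := congr1 Re h1; rewrite /dbar1 ReD ReI.
  have i1 : 'D_(e0 : C2 R) (fun x => Im (f x) : R^o) x + 'D_(e1 : C2 R) (fun x => Re (f x) : R^o) x = 0.
    by have := congr1 Im h1; rewrite /dbar1 ImD ImI.
  have r2 : 'D_(e2 : C2 R) (fun x => Re (f x) : R^o) x - 'D_(e3 : C2 R) (fun x => Im (f x) : R^o) x = 0.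
    by have := congr1 Re h2; rewrite /dbar2 ReD ReI.
  have i2 : 'D_(e2 : C2 R) (fun x => Im (f x) : R^o) x + 'D_(e3 : C2 R) (fun x => Re (f x) : R^o) x = 0.
    by have := congr1 Im h2; rewrite /dbar2 ImD ImI.
  rewrite !(derive_grad _ (Cu.1 x Ux)) !(derive_grad _ (Cv.1 x Ux)).
  rewrite /dotC2 /gradC2 /mulI /=.
  have aux (p0 p1 p2 p3 q0 q1 q2 q3 a b c d : R) :
      p0 - q1 = 0 -> q0 + p1 = 0 -> p2 - q3 = 0 -> q2 + p3 = 0 ->
      p0 * - b + p1 * a + (p2 * - d + p3 * c) = - (q0 * a + q1 * b + (q2 * c + q3 * d)) /\
      q0 * - b + q1 * a + (q2 * - d + q3 * c) = p0 * a + p1 * b + (p2 * c + p3 * d).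
    move=> /subr0_eq -> /eqP; rewrite addr_eq0 => /eqP -> /subr0_eq ->.
    by move=> /eqP; rewrite addr_eq0 => /eqP ->; split; ring.
  exact: (aux _ _ _ _ _ _ _ _ _ _ _ _ r1 i1 r2 i2).
Qed.

Lemma C1_lin U (c : R[i]) f g : open U -> C1 U f -> C1 U g ->
  C1 U (fun x => c * f x + g x) /\ forall x a, U x ->
    partialC a (fun x => c * f x + g x) x = c * partialC a f x + partialC a g x.
Proof.
move=> oU [fr fi] [gr gi].
have [c1 d1] := C1realZ (Re c) oU fr; have [c2 d2] := C1realZ (- Im c) oU fi.
have [c3 d3] := C1realZ (Re c) oU fi; have [c4 d4] := C1realZ (Im c) oU fr.
have [c5 d5] := C1realD oU c1 c2; have [c6 d6] := C1realD oU c3 c4.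
have [c7 d7] := C1realD oU c5 gr; have [c8 d8] := C1realD oU c6 gi.
have er : (fun x => Re (c * f x + g x)) = fun x => Re c * Re (f x) + - Im c * Im (f x) + Re (g x).
  by apply/funext => x; rewrite ReD ReM mulNr.
have ei : (fun x => Im (c * f x + g x)) = fun x => Re c * Im (f x) + Im c * Re (f x) + Im (g x).
  by apply/funext => x; rewrite ImD ImM.
split; first by split; [rewrite er|rewrite ei].
move=> x a Ux; apply: complexE; rewrite ?ReD ?ImD ?ReM ?ImM /=.
  by rewrite er d7// d5// d1// d2// mulNr.
by rewrite ei d8// d6// d3// d4.
Qed.

Lemma Hol_lin U (alpha beta : R[i]) (c : R[i]) f g : open U ->
  Hol (fun=> alpha) (fun=> beta) U f -> Hol (fun=> alpha) (fun=> beta) U g ->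
  Hol (fun=> alpha) (fun=> beta) U (fun x => c * f x + g x).
Proof.
move=> oU [Cf Hf] [Cg Hg]; have [C D] := C1_lin c oU Cf Cg; split=> // x Ux.
have [f1 f2] := Hf x Ux; have [g1 g2] := Hg x Ux.
have A (p q r s i : R[i]) : c * p + q + i * (c * r + s) = c * (p + i * r) + (q + i * s) by ring.
have B (p q k : R[i]) : c * - (k * p) + - (k * q) = - (k * (c * p + q)) by ring.
rewrite /dbar1 /dbar2 !(D x _ Ux); split; apply: etrans (A _ _ _ _ _) _.
  rewrite -/(dbar1 f x) -/(dbar1 g x) f1 g1; exact: B.
rewrite -/(dbar2 f x) -/(dbar2 g x) f2 g2; exact: B.
Qed.

Lemma Hol0 U (alpha beta : R[i]) : open U -> Hol (fun=> alpha) (fun=> beta) U (fun=> 0).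
Proof.
move=> oU; split; first by split; exact: C1real_cst.
move=> x Ux; rewrite /dbar1 /dbar2 /partialC /= !derive_cstC2 !mulr0 oppr0.
by split; apply: complexE; rewrite ?ReD ?ImD ?ReI ?ImI /= ?oppr0 addr0.
Qed.

(** The dbar derivatives of [expw l] are [z1 l] and [z2 l] times [expw l], so
    the weight shifts the pair of coefficients. With l = (alpha, beta) it
    reduces every pair to (0, 0). *)
Lemma Hol_expw U (alpha beta : R[i]) l f : open U ->
  Hol (fun=> alpha) (fun=> beta) U f ->
  Hol (fun=> alpha - z1 l) (fun=> beta - z2 l) U (fun x => (expw l x)%:C * f x).
Proof.
move=> oU [[fr fi] Hf]; have [Cl Dl] := @C1real_expw R U l oU.
have [c1 d1] := C1realM oU Cl fr; have [c2 d2] := C1realM oU Cl fi.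
have er : (fun x => Re ((expw l x)%:C * f x)) = fun x => expw l x * Re (f x).
  by apply/funext => x; rewrite ReZ.
have ei : (fun x => Im ((expw l x)%:C * f x)) = fun x => expw l x * Im (f x).
  by apply/funext => x; rewrite ImZ.
have D x a : U x -> partialC a (fun x => (expw l x)%:C * f x) x =
   (expw l x)%:C * (partialC a f x + (dotC2 l a)%:C * f x).
  move=> Ux; apply: complexE; rewrite ?ReZ ?ImZ /=.
    by rewrite er d1// Dl ReD ReZ /=; ring.
  by rewrite ei d2// Dl ImD ImZ /=; ring.
split; first by split; [rewrite er|rewrite ei].
move=> x Ux; have [f1 f2] := Hf x Ux.
have l0 : dotC2 l (e0 : C2 R) = l.1.1 by rewrite /dotC2 /=; ring.
have l1 : dotC2 l (e1 : C2 R) = l.1.2 by rewrite /dotC2 /=; ring.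
have l2 : dotC2 l (e2 : C2 R) = l.2.1 by rewrite /dotC2 /=; ring.
have l3 : dotC2 l (e3 : C2 R) = l.2.2 by rewrite /dotC2 /=; ring.
have zE (p q : R) : p +i* q = p%:C + 'i * q%:C.
  by apply: complexE; rewrite ?ReD ?ImD ?ReI ?ImI /=; ring.
have A (E p q a b y i : R[i]) : E * (p + a * y) + i * (E * (q + b * y)) = E * ((p + i * q) + (a + i * b) * y) by ring.
have B (E k m y : R[i]) : E * (- (k * y) + m * y) = - ((k - m) * (E * y)) by ring.
rewrite /dbar1 /dbar2 !(D x _ Ux) l0 l1 l2 l3; split; apply: etrans (A _ _ _ _ _ _ _) _.
  rewrite -/(dbar1 f x) f1 -zE -/(z1 l); exact: B.
rewrite -/(dbar2 f x) f2 -zE -/(z2 l); exact: B.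
Qed.

End HolCalculus.

(** * Local estimates between L1 and L2 norms *)

Section Complete.
Context {R : realType}.
Local Notation Re := (@complex.Re R).
Local Notation Im := (@complex.Im R).
Local Notation mu := (@lebC2 R).
Implicit Types (U V : set (C2 R)) (k : C2 R -> R) (x z w l : C2 R) (f g : C2 R -> R[i]).

Lemma cubeC2_norm r w : cubeC2 r w <-> `|w| <= r.
Proof.
case: w => [[a b] [c d]]; rewrite /cubeC2 /= !in_itv /= -!ler_norml; split.
  by move=> [[ha hb] [hc hd]]; rewrite !prod_normE !ge_max /= ha hb hc.
by rewrite !prod_normE !ge_max /= => /andP[/andP[-> ->] /andP[-> ->]].
Qed.

Lemma bounded_lebC2_lty V r : measurable V -> 0 <= r -> (forall w, V w -> `|w| <= r) ->
  (mu V < +oo)%E.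
Proof.
move=> mV r0 Vr; apply: (@le_lt_trans _ _ (mu (cubeC2 r))); last by rewrite lebC2_cube// ltry.
apply: le_measure; rewrite ?inE; [exact: mV|exact: measurable_cubeC2|].
by move=> w /Vr /cubeC2_norm.
Qed.

(** Cauchy-Schwarz against the constant 1. *)
Lemma L1_L2 V k : measurable V -> (mu V < +oo)%E -> measurable_fun V k ->
  mu.-integrable V (EFin \o (fun x => k x ^+ 2)) ->
  mu.-integrable V (EFin \o (fun x => `|k x|)) /\
  (\int[mu]_(x in V) `|k x|) ^+ 2 <= (\int[mu]_(x in V) (k x ^+ 2)) * fine (mu V).
Proof.
move=> mV fV mk ik2.
have i1 : mu.-integrable V (EFin \o (fun=> 1 : R)).
  apply: measurable_bounded_integrable; [exact: mV|exact: fV|exact: measurable_cst|].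
  by exists 1; split; [exact: num_real|move=> K K1 w _; rewrite normr1 ltW].
have ik : mu.-integrable V (EFin \o (fun x => `|k x|)).
  have i2 := lebC2_integrableD mV ik2 i1.
  apply: (integrable_dominated mV _ i2).
    by apply: measurableT_comp => //; exact: normr_measurable.
  move=> x _; rewrite normr_id -real_normK ?num_real//.
  by have := sqr_ge0 (`|k x| - 1); have := sqr_ge0 (`|k x|); nra.
split=> //; apply: quadratic_ge0_sqr_le.
  by apply: Rintegral_ge0 => x _; exact: sqr_ge0.
move=> t.
have it : mu.-integrable V (EFin \o (fun x => t ^+ 2 * k x ^+ 2)) by exact: lebC2_integrableZ.
have it2 : mu.-integrable V (EFin \o (fun x => 2 * t * `|k x|)) by exact: lebC2_integrableZ.
have it3 := lebC2_integrableD mV it it2.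
have -> : fine (mu V) = \int[mu]_(x in V) 1 by rewrite Rintegral_cst ?mul1r.
rewrite -!RintegralZl; [|exact: mV|exact: ik|exact: mV|exact: ik2].
rewrite -(RintegralD (mu:=mu) mV it it2) -(RintegralD (mu:=mu) mV it3 i1).
apply: Rintegral_ge0 => x _.
have -> : t ^+ 2 * k x ^+ 2 + 2 * t * `|k x| + 1 = (t * `|k x| + 1) ^+ 2.
  by rewrite -(real_normK (num_real (k x))); ring.
exact: sqr_ge0.
Qed.

Section Patch.
Context (U : set (C2 R)) (l : C2 R).
Context (oU : open U).

(** V is a ball around z0. Its points are bounded, so the weight is bounded
    above and below on it; r is half its radius, so that the cubes of half-side
    r around the points of ball z0 r stay inside it. *)
Lemma local_patch z0 : U z0 -> exists (r : R) (V : set (C2 R)) (M : R),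
  [/\ 0 < r, open V /\ (mu V < +oo)%E, V `<=` U,
      forall z w, ball z0 r z -> cubeC2 r w -> V (z + w) &
      0 < M /\ forall w, V w -> M^-1 <= expw l w <= M].
Proof.
move=> Uz0; have /nbhs_ballP[e /= e0 eU] := near_open oU Uz0.
pose r := e / 2; have r0 : 0 < r by rewrite divr_gt0.
pose V : set (C2 R) := ball z0 e.
pose rho := `|z0| + e.
have Vrho w : V w -> `|w| <= rho.
  rewrite /V -ball_normE /= => h; rewrite /rho -[w](subKr z0).
  by apply: (le_trans (ler_normB _ _)); rewrite lerD2l ltW.
have rho0 : 0 <= rho by rewrite addr_ge0// ltW.
have oV : open V by exact: ball_open.
exists r, V, (expR (4 * `|l| * rho)); split => //.
- by split => //; apply: (@bounded_lebC2_lty _ rho) => //; exact: open_measurable_C2.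
- move=> z w; rewrite /V -!ball_normE /= => zr /cubeC2_norm wr.
  rewrite opprD addrA; apply: (le_lt_trans (ler_normB _ _)).
  by rewrite [e]splitr ltr_leD.
- split; first exact: expR_gt0.
  move=> w /Vrho wr; rewrite -expRN /expw !ler_expR -ler_norml.
  by apply: (le_trans (dotC2_le _ (lexx _))); rewrite ler_wpM2l// mulr_ge0.
Qed.

End Patch.

Section Kernel.
Context (U V : set (C2 R)) (l : C2 R) (r M : R).
Context (oU : open U) (oV : open V) (r0 : 0 < r) (fV : (mu V < +oo)%E) (VU : V `<=` U)
  (M0 : 0 < M) (lM : forall w, V w -> M^-1 <= expw l w <= M).

Let mV : measurable V. Proof. exact: open_measurable_C2. Qed.
Let mU : measurable U. Proof. exact: open_measurable_C2. Qed.

Definition sqint f : R := \int[mu]_(x in U) (sqn (f x) * 1).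

Lemma measurable_expw : measurable_fun V (expw l).
Proof.
apply: measurable_funTS; apply: continuous_measurable_C2 => x.
have [C _] := @C1real_expw R setT l openT.
exact: (C1real_continuous openT C).
Qed.

(** On a patch the weight is bounded, and the L1 norm is controlled by the L2
    norm on V, hence on U. *)
Lemma patch_L1 f k : L2 (fun=> 1) U f -> measurable_fun U k ->
  (forall x, k x ^+ 2 <= sqn (f x)) ->
  mu.-integrable V (EFin \o (fun x => expw l x * k x)) /\
  (\int[mu]_(x in V) `|expw l x * k x|) ^+ 2 <= M ^+ 2 * fine (mu V) * sqint f.
Proof.
move=> Lf mkU kf.
have mk : measurable_fun V k by exact: measurable_funS mkU.
have [_ _ if2] := (L2P (@measurable_cst _ _ _ _ U (1 : R)) (fun x _ => ler01) f).1 Lf.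
have if2V : mu.-integrable V (EFin \o (fun x => sqn (f x) * 1)).
  by apply: integrableS if2.
have ik2 : mu.-integrable V (EFin \o (fun x => k x ^+ 2)).
  apply: (integrable_dominated mV _ if2V); first exact: measurable_funX.
  by move=> x _; rewrite ger0_norm ?sqr_ge0// mulr1.
have [ik kS] := L1_L2 mV fV mk ik2.
have mEk : measurable_fun V (fun x => expw l x * k x) by apply: measurable_funM => //; exact: measurable_expw.
have iMk : mu.-integrable V (EFin \o (fun x => M * `|k x|)) by exact: lebC2_integrableZ.
have EM x : V x -> `|expw l x * k x| <= M * `|k x|.
  by move=> Vx; rewrite normrM ler_wpM2r// ger0_norm ?expR_ge0//; have /andP[] := lM Vx.
have iEk : mu.-integrable V (EFin \o (fun x => expw l x * k x)).
  exact: (integrable_dominated mV mEk iMk).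
split=> //.
have iaEk : mu.-integrable V (EFin \o (fun x => `|expw l x * k x|)) by exact: (integrable_norm (mu:=mu) iEk).
have h1 : \int[mu]_(x in V) `|expw l x * k x| <= M * \int[mu]_(x in V) `|k x|.
  rewrite -RintegralZl; [|exact: mV|exact: ik].
  by apply: le_Rintegral; [exact: mV|exact: iaEk|exact: iMk|exact: EM].
have h2 : \int[mu]_(x in V) (k x ^+ 2) <= sqint f.
  rewrite /sqint [X in _ <= X]Rintegral_mkcond Rintegral_mkcond.
  apply: le_Rintegral; first exact: measurableT.
  - by have := (integrable_mkcond (mu:=mu) _ mV).1 ik2; rewrite restrict_EFin.
  - by have := (integrable_mkcond (mu:=mu) _ mU).1 if2; rewrite restrict_EFin.
  - move=> x _; rewrite !patchE; case: ifPn => xV.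
      by rewrite (mem_set (VU (set_mem xV))) mulr1.
    by case: ifPn => // _; rewrite mulr1 sqn_ge0.
have I0 : 0 <= \int[mu]_(x in V) `|expw l x * k x| by apply: Rintegral_ge0.
apply: (@le_trans _ _ ((M * \int[mu]_(x in V) `|k x|) ^+ 2)).
  by rewrite ler_pXn2r// nnegrE// (le_trans I0).
rewrite exprMn -mulrA ler_wpM2l ?sqr_ge0//; apply: (le_trans kS).
by rewrite mulrC ler_wpM2l// fine_ge0.
Qed.

End Kernel.
End Complete.

(** * Point evaluations on Bergman spaces are bounded *)

Section BergmanHilbert.
Context {R : realType}.
Local Notation Re := (@complex.Re R).
Local Notation Im := (@complex.Im R).
Local Notation mu := (@lebC2 R).
Implicit Types (V : set (C2 R)) (x z w : C2 R) (f g : C2 R -> R[i]) (k : R[i] -> R).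
Context (U : set (C2 R)) (alpha beta : R[i]).
Context (oU : open U).

Let one : C2 R -> R := fun=> 1.
Let l : C2 R := mkC2 alpha beta.
Let A := Bergman (fun=> alpha) (fun=> beta) one U.
Let mU : measurable U. Proof. exact: open_measurable_C2. Qed.
Let mone : measurable_fun U one. Proof. exact: measurable_cst. Qed.
Let one0 x : U x -> 0 <= one x. Proof. by move=> _; exact: ler01. Qed.
Let z1l : z1 l = alpha. Proof. by rewrite /l; case: alpha. Qed.
Let z2l : z2 l = beta. Proof. by rewrite /l; case: beta. Qed.

Let E k f x : R := expw l x * k (f x).

Lemma Hol_cauchy_riemann f : Hol (fun=> alpha) (fun=> beta) U f ->
  cauchy_riemann U (E Re f) (E Im f).
Proof.
move=> /(Hol_expw l oU); rewrite z1l z2l !subrr => /cauchy_riemann_Hol.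
rewrite (_ : (fun x => Re _) = E Re f); last by apply/funext => x; rewrite ReZ.
by rewrite (_ : (fun x => Im _) = E Im f)//; apply/funext => x; rewrite ImZ.
Qed.

Lemma cauchy_riemann_Hol_weighted f : cauchy_riemann U (E Re f) (E Im f) ->
  Hol (fun=> alpha) (fun=> beta) U f.
Proof.
move=> CR.
have : Hol (fun=> 0) (fun=> 0) U (fun x => (expw l x)%:C * f x).
  apply/cauchy_riemann_Hol.
  rewrite (_ : (fun x => Re _) = E Re f); last by apply/funext => x; rewrite ReZ.
  by rewrite (_ : (fun x => Im _) = E Im f)//; apply/funext => x; rewrite ImZ.
move=> /(Hol_expw (- l) oU).
have -> : z1 (- l) = - alpha by rewrite -z1l.
have -> : z2 (- l) = - beta by rewrite -z2l.
rewrite !sub0r !opprK.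
have -> // : (fun x => (expw (- l) x)%:C * ((expw l x)%:C * f x)) = f.
apply/funext => x; rewrite mulrA -rmorphM /= /expw -expRD.
have -> : dotC2 (- l) x + dotC2 l x = 0 by rewrite /dotC2 /=; ring.
by rewrite expR0 mul1r.
Qed.

(** What is used of the two functions Re and Im in order to treat the components
    of a Bergman function simultaneously; the last clause is the reproducing
    formula. *)
Definition real_part k := [/\ forall a b : R[i], k (a - b) = k a - k b,
  forall a, k a ^+ 2 <= sqn a,
  forall f, L2 one U f -> measurable_fun U (fun x => k (f x)) &
  forall f V z r, Hol (fun=> alpha) (fun=> beta) U f -> 0 <= r -> measurable V ->
    V `<=` U -> (forall w, cubeC2 r w -> V (z + w)) ->
    conv V (E k f) (bump r) z = bump_mass r * E k f z].

Lemma real_part_Re : real_part Re.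
Proof.
split=> [a b|a|f [] //|f V z r Hf r0 mV VU zV]; first by rewrite ReD ReN.
- by rewrite /sqn lerDl sqr_ge0.
- exact: (reproducing oU (Hol_cauchy_riemann Hf)).
Qed.

Lemma real_part_Im : real_part Im.
Proof.
split=> [a b|a|f [] //|f V z r Hf r0 mV VU zV]; first by rewrite ImD ImN.
- by rewrite /sqn lerDr sqr_ge0.
- exact: (reproducing oU (cauchy_riemann_sym (Hol_cauchy_riemann Hf))).
Qed.

Lemma sqint_ge0 f : 0 <= sqint U f.
Proof. by apply: Rintegral_ge0 => x _; rewrite mulr1 sqn_ge0. Qed.

Section OnePatch.
Context (V : set (C2 R)) (r M : R) (z0 : C2 R).
Context (r0 : 0 < r) (oV : open V) (fV : (mu V < +oo)%E) (VU : V `<=` U)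
  (zV : forall z w, ball z0 r z -> cubeC2 r w -> V (z + w))
  (M0 : 0 < M) (lM : forall w, V w -> M^-1 <= expw l w <= M).

Let mV : measurable V. Proof. exact: open_measurable_C2. Qed.

Lemma patch_rep k f z : real_part k -> Hol (fun=> alpha) (fun=> beta) U f -> ball z0 r z ->
  E k f z = (bump_mass r)^-1 * conv V (E k f) (bump r) z.
Proof.
move=> [_ _ _ rep] Hf zr.
rewrite (rep f V z r Hf (ltW r0) mV VU (fun w => zV zr (w := w))).
by rewrite mulKf// gt_eqF// bump_mass_gt0.
Qed.

Lemma patch_integrable k f : real_part k -> L2 one U f ->
  mu.-integrable V (EFin \o E k f) /\
  (\int[mu]_(x in V) `|E k f x|) ^+ 2 <= M ^+ 2 * fine (mu V) * sqint U f.
Proof.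
move=> [_ ksq mk _] Lf.
have mkf := mk f Lf.
by apply: patch_L1 => // x; exact: ksq.
Qed.

Lemma patch_eval k f : real_part k -> A f ->
  k (f z0) ^+ 2 <= (r ^+ 4 / bump_mass r * M) ^+ 2 * (M ^+ 2 * fine (mu V)) * sqint U f.
Proof.
move=> rk [Hf Lf]; have [iEk Nk] := patch_integrable rk Lf.
have z0r : ball z0 r z0 by exact: ballxx.
have m0 := @bump_mass_gt0 R r r0.
have Vz0 : V z0.
  by rewrite -[z0]addr0; apply: zV => //; apply/cubeC2_norm; rewrite normr0 ltW.
have /andP[E1 _] := lM Vz0.
have rep := patch_rep rk Hf z0r.
have bd : `|conv V (E k f) (bump r) z0| <= r ^+ 4 * \int[mu]_(x in V) `|E k f x|.
  apply: (bounded_mul_Rintegral mV iEk).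
    apply: measurable_funTS; apply: continuous_measurable_C2 => w.
    exact: (@continuous_comp _ _ _ (fun w => w - z0) (bump r) w (@continuous_translate R (- z0) w) (@bump_continuous R r _)).
  by move=> w _; rewrite ger0_norm ?bump_ge0// bump_le.
set N := \int[mu]_(x in V) _ in Nk bd.
have N0 : 0 <= N by apply: Rintegral_ge0.
have kz : `|k (f z0)| <= (r ^+ 4 / bump_mass r * M) * N.
  have kE : k (f z0) = (expw l z0)^-1 * E k f z0 by rewrite /E mulKf// gt_eqF// expR_gt0.
  have eM : (expw l z0)^-1 <= M by rewrite -[M]invrK lef_pV2// posrE ?invr_gt0// expR_gt0.
  rewrite kE rep !normrM (ger0_norm (_ : 0 <= (expw l z0)^-1)) ?invr_ge0 ?expR_ge0//.
  rewrite (ger0_norm (_ : 0 <= (bump_mass r)^-1)) ?invr_ge0 ?(ltW m0)//.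
  have -> : r ^+ 4 / bump_mass r * M * N = M * ((bump_mass r)^-1 * (r ^+ 4 * N)) by ring.
  apply: ler_pM => //; first by rewrite invr_ge0 expR_ge0.
    by rewrite mulr_ge0// invr_ge0 ltW.
  by rewrite ler_wpM2l// invr_ge0 ltW.
have c0 : 0 <= r ^+ 4 / bump_mass r * M.
  by rewrite !mulr_ge0 ?exprn_ge0 ?invr_ge0// ltW.
rewrite -mulrA; apply: (@le_trans _ _ ((r ^+ 4 / bump_mass r * M) ^+ 2 * N ^+ 2)).
  by rewrite -exprMn -real_normK ?num_real// ler_pXn2r// nnegrE mulr_ge0.
by rewrite ler_wpM2l// sqr_ge0.
Qed.

End OnePatch.

(** The weighted function at z is its convolution with the bump on a patch,
    which is bounded by the L1 norm on the patch. *)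
Lemma Bergman_eval_bound z : U z -> exists C : R, forall f, A f -> sqn (f z) <= C * sqint U f.
Proof.
move=> Uz; have [r [V [M [r0 [oV fV] VU zV [M0 lM]]]]] := local_patch l oU Uz.
exists (2 * ((r ^+ 4 / bump_mass r * M) ^+ 2 * (M ^+ 2 * fine (mu V)))) => f Af.
have h1 := patch_eval r0 oV fV VU zV M0 lM real_part_Re Af.
have h2 := patch_eval r0 oV fV VU zV M0 lM real_part_Im Af.
by rewrite /sqn; lra.
Qed.

End BergmanHilbert.

(** * Square-integrable limits of Cauchy sequences *)

Section BergmanComplete.
Context {R : realType}.
Local Notation Re := (@complex.Re R).
Local Notation Im := (@complex.Im R).
Local Notation mu := (@lebC2 R).
Implicit Types (V : set (C2 R)) (x z w : C2 R) (f g : C2 R -> R[i]) (k : R[i] -> R).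
Context (U : set (C2 R)) (alpha beta : R[i]).
Context (oU : open U).

Let one : C2 R -> R := fun=> 1.
Let l : C2 R := mkC2 alpha beta.
Let A := Bergman (fun=> alpha) (fun=> beta) one U.
Let mU : measurable U. Proof. exact: open_measurable_C2. Qed.
Let mone : measurable_fun U one. Proof. exact: measurable_cst. Qed.
Let one0 x : U x -> 0 <= one x. Proof. by move=> _; exact: ler01. Qed.
Let E k f x : R := expw l x * k (f x).

Lemma cauchy_cvg_real (a : nat -> R) :
  (forall e : R, 0 < e -> exists N, forall m n, (N <= m)%N -> (N <= n)%N -> `|a m - a n| < e) ->
  cvgn a.
Proof.
move=> H; apply/cauchy_cvgP/cauchy_exP => e e0.
have [N NH] := H e e0; exists (a N); exists N => // n /= Nn.
by rewrite -ball_normE /=; exact: NH.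
Qed.

Lemma limn_einf_le (a : nat -> \bar R) (c : \bar R) : (forall n, (a n <= c)%E) -> (limn_einf a <= c)%E.
Proof.
move=> ac; rewrite limn_einf_lim; apply: lime_le; first exact: is_cvg_einfs.
apply: nearW => n; apply: le_trans (ac n); apply: ereal_inf_lbound.
by exists n => //=.
Qed.

(** Fatou along pointwise convergence: a bound on the L2 norms passes to the
    limit. *)
Lemma sqn_fatou (u : nat -> C2 R -> R[i]) f (c : R) :
  (forall n, measurable_fun U (fun x => Re (u n x))) ->
  (forall n, measurable_fun U (fun x => Im (u n x))) ->
  (forall x, U x -> (fun n => Re (u n x)) @ \oo --> Re (f x)) ->
  (forall x, U x -> (fun n => Im (u n x)) @ \oo --> Im (f x)) ->
  (forall n, (\int[mu]_(x in U) (sqn (u n x) * 1)%:E <= c%:E)%E) ->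
  (\int[mu]_(x in U) (sqn (f x) * 1)%:E <= c%:E)%E.
Proof.
move=> mr mi cr ci uc.
pose F n x := (sqn (u n x) * 1)%:E.
have mF n : measurable_fun U (F n).
  by apply/measurable_EFinP; exact: (measurable_sqn mone).
have F0 n x : U x -> (0 <= F n x)%E by move=> _; rewrite lee_fin mulr1 sqn_ge0.
have := @fatou _ _ R mu U mU F mF F0.
have -> : (\int[mu]_(x in U) limn_einf (F^~ x) = \int[mu]_(x in U) (sqn (f x) * 1)%:E)%E.
  apply: eq_integral => x /[!inE] Ux.
  suff h : F^~ x @ \oo --> (sqn (f x) * 1)%:E by have [-> _] := cvg_limn_einf_sup h.
  apply/cvg_EFin; first by apply: nearW.
  rewrite /F /comp /=; apply: cvgM; last exact: cvg_cst.
  rewrite /sqn; under eq_fun do rewrite !expr2.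
  rewrite !expr2.
  by apply: cvgD; apply: cvgM; [exact: cr|exact: cr|exact: ci|exact: ci].
move=> h; apply: (le_trans h); exact: limn_einf_le.
Qed.

Lemma sqint_finE f : L2 one U f -> (\int[mu]_(x in U) (sqn (f x) * 1)%:E = (sqint U f)%:E)%E.
Proof.
move=> /(L2P mone one0 f).1[_ _ fi]; rewrite /sqint /Rintegral fineK//.
exact: (integrable_fin_num (mu:=mu) mU fi).
Qed.

Lemma L2_of_sqint f (c : R) : measurable_fun U (fun x => Re (f x)) ->
  measurable_fun U (fun x => Im (f x)) ->
  (\int[mu]_(x in U) (sqn (f x) * 1)%:E <= c%:E)%E -> L2 one U f /\ sqint U f <= c.
Proof.
move=> mr mi fc.
have Lf : L2 one U f.
  split => //; apply: le_lt_trans (ltry c); apply: le_trans fc.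
  by rewrite le_eqVlt; apply/orP; left; apply/eqP; apply: eq_integral => x _; rewrite normc_sqn.
by split => //; rewrite -lee_fin -sqint_finE.
Qed.

Lemma L2_sub f g : L2 one U f -> L2 one U g -> L2 one U (fun x => f x - g x).
Proof.
move=> Lf Lg; have := L2_lin mU mone one0 (-1) Lg Lf.
by congr L2; apply/funext => x; rewrite mulN1r addrC.
Qed.

Lemma ipnorm_sqint f (e : R) : 0 < e -> (ipnorm (inner one U) f < e) = (sqint U f < e ^+ 2).
Proof.
move=> e0; rewrite /ipnorm inner_self//=.
rewrite -[X in _ < X](ger0_norm (ltW e0)) -sqrtr_sqr ltr_sqrt//.
by rewrite exprn_gt0.
Qed.

Section Limit.
Context (u : nat -> C2 R -> R[i]).
Context (uA : forall n, A (u n))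
  (uC : forall eps : R, 0 < eps -> exists N, forall m n, (N <= m)%N -> (N <= n)%N ->
       sqint U (fun x => u m x - u n x) < eps).

Let A_sub f g : A f -> A g -> A (fun x => f x - g x).
Proof.
move=> [Hf Lf] [Hg Lg]; split; last exact: L2_sub.
have -> : (fun x => f x - g x) = (fun x => -1 * g x + f x).
  by apply/funext => x; rewrite mulN1r addrC.
exact: Hol_lin.
Qed.

Let part_cvg k x : real_part U alpha beta k -> U x -> cvgn (fun n => k (u n x)).
Proof.
move=> [kB ksq _ _] Ux; apply: cauchy_cvg_real => e e0.
have [C CP] := Bergman_eval_bound alpha beta oU Ux.
pose C1 := `|C| + 1; have C10 : 0 < C1 by rewrite ltr_wpDl.
have [N NP] := uC (divr_gt0 (exprn_gt0 2 e0) C10).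
exists N => m n mN nN.
have := CP _ (A_sub (uA m) (uA n)); have := NP m n mN nN.
rewrite ltr_pdivlMr// => h1 h2.
have S0 := sqint_ge0 U (fun x => u m x - u n x).
have h3 : k (u m x - u n x) ^+ 2 < e ^+ 2.
  apply: (le_lt_trans (ksq _)); apply: (le_lt_trans h2); apply: le_lt_trans h1.
  by rewrite mulrC ler_wpM2l// /C1; have := ler_norm C; lra.
by rewrite -kB -(@ltr_pXn2r _ 2)// ?nnegrE ?(ltW e0)// real_normK ?num_real.
Qed.

Let f : C2 R -> R[i] := fun x => lim ((fun n => Re (u n x)) @ \oo) +i* lim ((fun n => Im (u n x)) @ \oo).

Let f_cvg k : k = Re \/ k = Im -> forall x, U x -> (fun n => k (u n x)) @ \oo --> k (f x).
Proof.
by move=> [] -> x Ux; [exact: (part_cvg (real_part_Re alpha beta oU) Ux)|exact: (part_cvg (real_part_Im alpha beta oU) Ux)].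
Qed.

Let real_partP k : k = Re \/ k = Im -> real_part U alpha beta k.
Proof. by move=> [] ->; [exact: real_part_Re|exact: real_part_Im]. Qed.

Let mf k : k = Re \/ k = Im -> measurable_fun U (fun x => k (f x)).
Proof.
move=> kRI; have [_ _ mk _] := real_partP kRI.
apply: (@measurable_fun_cvg _ _ _ U (fun n x => k (u n x))).
  by move=> n; apply: mk; have [] := uA n.
exact: f_cvg.
Qed.

Let dist_small (e : R) : 0 < e -> exists N, forall n, (N <= n)%N ->
  L2 one U (fun x => u n x - f x) /\ sqint U (fun x => u n x - f x) <= e.
Proof.
move=> e0; have [N NP] := uC e0; exists N => n nN.
have mk k : k = Re \/ k = Im -> measurable_fun U (fun x => k (u n x - f x)).
  move=> kRI; have [kB _ mk _] := real_partP kRI.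
  rewrite (_ : (fun x => _) = fun x => k (u n x) - k (f x)); last by apply/funext => x; rewrite kB.
  by apply: measurable_funB; [apply: mk; have [] := uA n|exact: mf].
apply: L2_of_sqint; [by apply: mk; left|by apply: mk; right|].
apply: (@sqn_fatou (fun m x => u n x - u (N + m)%N x)).
- move=> m; have [_ [+ _ _]] := A_sub (uA n) (uA (N + m)%N); exact.
- move=> m; have [_ [_ + _]] := A_sub (uA n) (uA (N + m)%N); exact.
- move=> x Ux; have := f_cvg (or_introl erefl) Ux => h.
  under eq_fun do rewrite ReD ReN.
  rewrite ReD ReN; apply: cvgB; first exact: cvg_cst.
  by rewrite -(cvg_shiftn N) in h; under eq_fun do rewrite addnC.
- move=> x Ux; have := f_cvg (or_intror erefl) Ux => h.
  under eq_fun do rewrite ImD ImN.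
  rewrite ImD ImN; apply: cvgB; first exact: cvg_cst.
  by rewrite -(cvg_shiftn N) in h; under eq_fun do rewrite addnC.
- move=> m; have [_ L] := A_sub (uA n) (uA (N + m)%N).
  by rewrite sqint_finE// lee_fin ltW// NP// leq_addr.
Qed.

Let Lf : L2 one U f.
Proof.
have [N NP] := dist_small ltr01; have [Lnf _] := NP N (leqnn N).
have [_ LN] := uA N.
have := L2_sub LN Lnf.
by congr L2; apply/funext => x; rewrite subKr.
Qed.

(** Bounded evaluations make the sequence Cauchy at each point. Fatou, applied
    to u n - u (N + m) as m grows, gives convergence to the pointwise limit in
    the L2 norm. *)
Lemma L2_limit : exists f, [/\ L2 one U f,
  forall k, k = Re \/ k = Im -> forall x, U x -> (fun n => k (u n x)) @ \oo --> k (f x) &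
  forall e : R, 0 < e -> exists N, forall n, (N <= n)%N ->
    L2 one U (fun x => u n x - f x) /\ sqint U (fun x => u n x - f x) <= e].
Proof. by exists f; split; [exact: Lf|exact: f_cvg|exact: dist_small]. Qed.

End Limit.
End BergmanComplete.

(** * Bergman spaces are Hilbert spaces with a kernel *)

Section BergmanLimit.
Context {R : realType}.
Local Notation Re := (@complex.Re R).
Local Notation Im := (@complex.Im R).
Local Notation mu := (@lebC2 R).
Implicit Types (V : set (C2 R)) (x z w : C2 R) (f g : C2 R -> R[i]) (k : R[i] -> R).
Context (U : set (C2 R)) (alpha beta : R[i]).
Context (oU : open U).

Let one : C2 R -> R := fun=> 1.
Let l : C2 R := mkC2 alpha beta.
Let A := Bergman (fun=> alpha) (fun=> beta) one U.
Let mU : measurable U. Proof. exact: open_measurable_C2. Qed.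
Let mone : measurable_fun U one. Proof. exact: measurable_cst. Qed.
Let one0 x : U x -> 0 <= one x. Proof. by move=> _; exact: ler01. Qed.
Let E k f x : R := expw l x * k (f x).
Let vC2 : normedModType R := C2 R.

Section Limit.
Context (u : nat -> C2 R -> R[i]) (f : C2 R -> R[i]).
Context (uA : forall n, A (u n)) (Lf : L2 one U f)
  (f_cvg : forall k, k = Re \/ k = Im -> forall x, U x -> (fun n => k (u n x)) @ \oo --> k (f x))
  (dist_small : forall e : R, 0 < e -> exists N, forall n, (N <= n)%N ->
    L2 one U (fun x => u n x - f x) /\ sqint U (fun x => u n x - f x) <= e).

Section OnePatch.
Context (V : set (C2 R)) (r M : R) (z0 : C2 R).
Context (r0 : 0 < r) (oV : open V) (fV : (mu V < +oo)%E) (VU : V `<=` U)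
  (zV : forall z w, ball z0 r z -> cubeC2 r w -> V (z + w))
  (M0 : 0 < M) (lM : forall w, V w -> M^-1 <= expw l w <= M).

Let mV : measurable V. Proof. exact: open_measurable_C2. Qed.

Let ballU z : ball z0 r z -> U z.
Proof.
move=> zr; apply: VU; rewrite -[z]addr0; apply: zV => //.
by apply/cubeC2_norm; rewrite normr0 ltW.
Qed.

(** On a patch, L2 convergence implies L1 convergence, and the kernel is
    bounded. *)
Lemma conv_cvg k (kap : C2 R -> R) (C : R) z : real_part U alpha beta k ->
  continuous kap -> (forall w, `|kap w| <= C) ->
  (fun n => conv V (E k (u n)) kap z) @ \oo --> conv V (E k f) kap z.
Proof.
move=> rk ckap kapC; have [kB _ _ _] := rk.
have mk : measurable_fun V (fun w => kap (w - z)).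
  apply: measurable_funTS; apply: continuous_measurable_C2 => w.
  exact: (@continuous_comp _ _ _ (fun w => w - z) kap w (@continuous_translate R (- z) w) (ckap _)).
pose K := C ^+ 2 * (M ^+ 2 * fine (mu V)).
have K0 : 0 <= K by apply: mulr_ge0; [exact: sqr_ge0|apply: mulr_ge0; [exact: sqr_ge0|exact: fine_ge0]].
apply/cvgrPdist_le => e e0.
have e1 : 0 < e ^+ 2 / (K + 1) by rewrite divr_gt0 ?exprn_gt0// ltr_wpDl.
have [N NP] := dist_small e1; exists N => // n /= nN.
have [Ld dd] := NP n nN.
have [iu _] := patch_integrable oU oV fV VU lM rk (uA n).2.
have [iF _] := patch_integrable oU oV fV VU lM rk Lf.
have [id Nd] := patch_integrable oU oV fV VU lM rk Ld.
rewrite distrC /conv -(RintegralB (mu:=mu) mV); last 2 first.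
- exact: (bounded_mul_integrable mV iu mk (fun w _ => kapC _)).
- exact: (bounded_mul_integrable mV iF mk (fun w _ => kapC _)).
have -> : (fun w => E k (u n) w * kap (w - z) - E k f w * kap (w - z)) =
  (fun w => E k (fun x => u n x - f x) w * kap (w - z)).
  by apply/funext => w; rewrite /E kB; ring.
have bd := bounded_mul_Rintegral mV id mk (fun w _ => kapC _).
rewrite -(@ler_pXn2r _ 2)// ?nnegrE ?(ltW e0)//.
apply: (@le_trans _ _ ((C * \int[mu]_(x in V) `|E k (fun x => u n x - f x) x|) ^+ 2)).
  by rewrite ler_pXn2r ?nnegrE//; apply: le_trans bd.
rewrite exprMn; apply: (@le_trans _ _ (K * sqint U (fun x => u n x - f x))).
  by rewrite /K -mulrA ler_wpM2l ?sqr_ge0.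
apply: (@le_trans _ _ ((K + 1) * (e ^+ 2 / (K + 1)))).
  apply: ler_pM => //; first exact: sqint_ge0.
  by rewrite lerDl.
by rewrite mulrC divfK// gt_eqF// ltr_wpDl.
Qed.

Let RI k : k = Re \/ k = Im -> real_part U alpha beta k.
Proof. by move=> [] ->; [exact: real_part_Re|exact: real_part_Im]. Qed.

(** Both sides of the reproducing formula for u n converge. *)
Lemma limit_rep k z : k = Re \/ k = Im -> ball z0 r z ->
  E k f z = (bump_mass r)^-1 * conv V (E k f) (bump r) z.
Proof.
move=> kRI zr; have rk := RI kRI.
have h1 : (fun n => E k (u n) z) @ \oo --> E k f z.
  by apply: cvgM; [exact: cvg_cst|exact: f_cvg (ballU zr)].
have h2 : (fun n => E k (u n) z) @ \oo --> (bump_mass r)^-1 * conv V (E k f) (bump r) z.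
  have -> : (fun n => E k (u n) z) = (fun n => (bump_mass r)^-1 * conv V (E k (u n)) (bump r) z).
    apply/funext => n; exact: (patch_rep r0 oV VU zV rk (uA n).1 zr).
  apply: cvgM; first exact: cvg_cst.
  apply: (@conv_cvg k (bump r) (r ^+ 4)) => //; first exact: bump_continuous.
  by move=> w; rewrite ger0_norm ?bump_ge0// bump_le.
exact: (cvg_unique _ h1 h2).
Qed.

Let smooth k g z a : L2 one U g -> real_part U alpha beta k ->
  (forall z, ball z0 r z -> E k g z = (bump_mass r)^-1 * conv V (E k g) (bump r) z) ->
  ball z0 r z ->
  C1real (ball z0 r) (E k g) /\
  'D_a (E k g : C2 R -> R^o) z = (bump_mass r)^-1 * conv V (E k g) (dbump r a) z.
Proof.
move=> Lg rk rep zr; have [ig _] := patch_integrable oU oV fV VU lM rk Lg.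
have ob : open (ball (z0 : vC2) r) by exact: ball_open.
have [c1 c2] := C1realZ (bump_mass r)^-1 ob (conv_C1real mV (ltW r0) ig (ball z0 r)).
split; first by apply: C1real_ext c1 => // y yr; rewrite rep.
rewrite (eq_on_derive a ob rep zr) c2//; congr (_ * _).
by have [_] := conv_differentiable mV (ltW r0) ig z; exact.
Qed.

(** Both the u n and their limit are convolutions with the bump, so their
    derivatives are convolutions with [dbump], to which [conv_cvg] applies. *)
Lemma limit_derive k z a : k = Re \/ k = Im -> ball z0 r z ->
  C1real (ball z0 r) (E k f) /\
  (fun n => 'D_a (E k (u n) : C2 R -> R^o) z) @ \oo --> ('D_a (E k f : C2 R -> R^o) z : R).
Proof.
move=> kRI zr; have rk := RI kRI.
have [c1 ->] := smooth a Lf rk (fun z => limit_rep (z := z) kRI) zr; split=> //.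
have -> : (fun n => 'D_a (E k (u n) : C2 R -> R^o) z) =
   (fun n => (bump_mass r)^-1 * conv V (E k (u n)) (dbump r a) z).
  apply/funext => n; apply: (smooth a (uA n).2 rk _ zr).2 => y yr.
  exact: (patch_rep r0 oV VU zV rk (uA n).1 yr).
apply: cvgM; first exact: cvg_cst.
apply: (@conv_cvg k (dbump r a) _ z rk (dbump_continuous (a := a))).
exact: (dbump_bounded (ltW r0)).
Qed.

End OnePatch.

Lemma limit_C1 k z a : k = Re \/ k = Im -> U z ->
  [/\ differentiable (E k f : C2 R -> R^o) z,
    {for z, continuous (fun y => 'D_a (E k f : C2 R -> R^o) y)} &
    (fun n => 'D_a (E k (u n) : C2 R -> R^o) z) @ \oo --> ('D_a (E k f : C2 R -> R^o) z : R)].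
Proof.
move=> kRI Uz; have [r [V [M [r0 [oV fV] VU zV [M0 lM]]]]] := local_patch l oU Uz.
have zr : ball z r z by exact: ballxx.
have [c1 h] := limit_derive r0 oV fV VU zV lM a kRI zr.
have ob : open (ball (z : vC2) r) by exact: ball_open.
by have [d c] := (C1realP (E k f) ob).1 c1 z zr; split.
Qed.

(** The derivatives of the weighted functions converge pointwise, so the Cauchy-
    Riemann equations pass to the limit. *)
Lemma limit_Hol : Hol (fun=> alpha) (fun=> beta) U f.
Proof.
apply: cauchy_riemann_Hol_weighted => //.
have C k : k = Re \/ k = Im -> C1real U (E k f).
  move=> kRI; apply/(C1realP _ oU) => x Ux.
  split=> [|a]; first by have [] := limit_C1 0 kRI Ux.
  by have [] := limit_C1 a kRI Ux.
split; [by apply: C; left|by apply: C; right|] => x w Ux.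
have CR n : cauchy_riemann U (E Re (u n)) (E Im (u n)).
  exact: (Hol_cauchy_riemann oU (uA n).1).
have cv k a (kRI : k = Re \/ k = Im) := let: And3 _ _ h := limit_C1 a kRI Ux in h.
split.
- have CRn n : - 'D_w (E Im (u n) : C2 R -> R^o) x = 'D_(mulI w) (E Re (u n) : C2 R -> R^o) x.
    by have [_ _ /(_ x w Ux)[->]] := CR n.
  apply: (cvg_unique _ (cv Re (mulI w) (or_introl erefl))) => //.
  apply: cvg_trans (cvgN (cv Im w (or_intror erefl))).
  by apply: near_eq_cvg; apply: nearW => n; exact: CRn.
- have CRn n : 'D_w (E Re (u n) : C2 R -> R^o) x = 'D_(mulI w) (E Im (u n) : C2 R -> R^o) x.
    by have [_ _ /(_ x w Ux)[_ ->]] := CR n.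
  apply: (cvg_unique _ (cv Im (mulI w) (or_intror erefl))) => //.
  apply: cvg_trans (cv Re w (or_introl erefl)).
  by apply: near_eq_cvg; apply: nearW => n; exact: CRn.
Qed.

End Limit.

Lemma Bergman_sqint_eq0 f z : A f -> U z -> sqint U f = 0 -> f z = 0.
Proof.
move=> Af Uz f0; have [C CP] := Bergman_eval_bound alpha beta oU Uz.
have := CP f Af; rewrite f0 mulr0 /sqn => h.
have [a0 b0] := (sqr_ge0 (Re (f z)), sqr_ge0 (Im (f z))).
by apply: complexE => /=; apply/eqP; rewrite -sqrf_eq0; apply/eqP; lra.
Qed.

Theorem Bergman_hilbert : hilbert_space U A (inner one U).
Proof.
split.
- by split; [exact: Hol0|exact: L2_0].
- by move=> c f g [Hf Lf] [Hg Lg]; split; [exact: Hol_lin|exact: L2_lin].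
- by move=> c f g h [_ Lf] [_ Lg] [_ Lh]; exact: inner_lin.
- by move=> f g [_ Lf] [_ Lg]; exact: inner_herm.
- by move=> f _; exact: inner_ge0.
- move=> f Af; rewrite inner_self//; split=> [[f0] x Ux|f0]; first exact: Bergman_sqint_eq0.
  rewrite -[RHS](rmorph0 (real_complex R)); congr (_%:C).
  rewrite (@eq_Rintegral _ _ _ _ _ (fun=> 0)); first by rewrite Rintegral_cst// mul0r.
  by move=> x /[!inE] Ux; rewrite f0// /sqn /= expr0n /= addr0 mul0r.
- move=> u uA uC.
  have uC' (e : R) : 0 < e -> exists N, forall m n, (N <= m)%N -> (N <= n)%N ->
       sqint U (fun x => u m x - u n x) < e.
    move=> e0; have s0 : 0 < Num.sqrt e by rewrite sqrtr_gt0.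
    have [N NP] := uC _ s0; exists N => m n mN nN.
    by have := NP m n mN nN; rewrite ipnorm_sqint// sqr_sqrtr// ltW.
  have [f [Lf fc fd]] := L2_limit oU uA uC'.
  exists f; first by split=> //; exact: (limit_Hol uA Lf fc fd).
  move=> e e0.
  have e1 : 0 < e ^+ 2 / 2 by rewrite divr_gt0// exprn_gt0.
  have [N NP] := fd _ e1; exists N => n nN; rewrite ipnorm_sqint//.
  by apply: le_lt_trans (NP n nN).2 _; rewrite ltr_pdivrMr// ltr_pMr ?exprn_gt0// ltr1n.
Qed.

Lemma Bergman_kernel_exists : is_Bergman_kernel one U A (Bergman_kernel one U A).
Proof.
apply: Bergman_kernelP; first exact: Bergman_hilbert.
move=> z Uz; have [C CP] := Bergman_eval_bound alpha beta oU Uz.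
by exists C => f Af; rewrite inner_self//; exact: CP.
Qed.

End BergmanLimit.

(** * Quaternionic affine maps of C^2 *)

Section QuaternionMaps.
Context {R : realType}.
Local Notation Re := (@complex.Re R).
Local Notation Im := (@complex.Im R).
Context (theta : R).
Implicit Types (x y v : C2 R) (p q : quat R) (c w : R[i]) (t : R).
Local Notation toH := (toH theta).
Local Notation ofH := (ofH theta).

Let cs := cos2Dsin2 theta.

Lemma toHD x y : toH (x + y) = toH x + toH y.
Proof.
case: x y => [[x0 x1] [x2 x3]] [[y0 y1] [y2 y3]].
by apply: quat_eq => /=; ring.
Qed.

Lemma ofHD p q : ofH (p + q) = ofH p + ofH q.
Proof. by apply: (can_inj (toHK theta)); rewrite toHD !ofHK. Qed.

Lemma toHZ t x : toH (t *: x) = CtoH t%:C * toH x.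
Proof. 
case: x => [[x0 x1] [x2 x3]].
have -> : t *: ((x0, x1), (x2, x3)) = ((t * x0, t * x1), (t * x2, t * x3)) :> C2 R by [].
by apply: quat_eq => /=; ring.
Qed.

Lemma CtoHM c w : CtoH (c * w) = CtoH c * CtoH w :> quat R.
Proof. by apply: quat_eq; rewrite /= ?ReM ?ImM; ring. Qed.

Lemma CtoHV c : c != 0 -> CtoH c^-1 = (CtoH c)^-1 :> quat R.
Proof.
move=> c0; apply: (@mulrI _ (CtoH c)); first by rewrite quat_unitqE CtoH_neq0.
by rewrite -CtoHM mulfV// divrr// quat_unitqE CtoH_neq0.
Qed.

Lemma CtoH_realC t q : CtoH t%:C * q = q * CtoH t%:C.
Proof. by apply: quat_eq => /=; ring. Qed.

Lemma quat_conjM p q : quat_conj (p * q) = quat_conj q * quat_conj p.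
Proof. by apply: quat_eq => /=; ring. Qed.

Lemma quat_conjK : involutive (@quat_conj R).
Proof. by move=> p; apply: quat_eq => /=; rewrite ?opprK. Qed.

Lemma quat_conj_CtoH c : quat_conj (CtoH c) = CtoH c^* :> quat R.
Proof. by case: c => x y; apply: quat_eq => //=; rewrite oppr0. Qed.

Lemma quat_conj_eq0 p : (quat_conj p == 0) = (p == 0).
Proof.
apply/eqP/eqP => [h|->]; last by apply: quat_eq => /=; rewrite ?oppr0.
by rewrite -[p]quat_conjK h; apply: quat_eq => /=; rewrite ?oppr0.
Qed.

Lemma quat_conjV p : p != 0 -> quat_conj p^-1 = (quat_conj p)^-1.
Proof.
move=> p0; apply: (@mulrI _ (quat_conj p)); first by rewrite quat_unitqE quat_conj_eq0.
rewrite -quat_conjM mulVr ?quat_unitqE// divrr ?quat_unitqE ?quat_conj_eq0//.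
by apply: quat_eq => /=; rewrite ?oppr0.
Qed.

Lemma quat_normM p q : quat_norm (p * q) = quat_norm p * quat_norm q.
Proof. 
have n0 (r : quat R) : 0 <= quat_norm r by exact: sqrtr_ge0.
apply: (@pexpIrn _ 2) => //; rewrite ?nnegrE ?mulr_ge0//.
by rewrite exprMn !quat_norm_sqr /=; ring.
Qed.

Lemma q0C p q : q0 (p * q) = q0 (q * p). Proof. by rewrite /=; ring. Qed.

(** The identification with H is isometric, because i e^(i theta) j is a unit
    orthogonal to C. *)
Lemma dotC2_toH x y : dotC2 x y = q0 (toH x * quat_conj (toH y)).
Proof.
case: x y => [[x0 x1] [x2 x3]] [[y0 y1] [y2 y3]].
have -> : q0 (toH ((x0, x1), (x2, x3)) * quat_conj (toH ((y0, y1), (y2, y3)))) =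
  x0 * y0 + x1 * y1 + (cos theta ^+ 2 + sin theta ^+ 2) * (x2 * y2 + x3 * y3).
  by rewrite /=; ring.
by rewrite cs /dotC2 /=; ring.
Qed.

Lemma sqnormC2_toH x : sqnormC2 x = quat_norm (toH x) ^+ 2.
Proof.
have -> : sqnormC2 x = dotC2 x x by rewrite /sqnormC2 /dotC2; ring.
by rewrite dotC2_toH quat_norm_sqr /=; ring.
Qed.

Lemma z1_mkC2 c w : z1 (mkC2 c w) = c. Proof. by case: c. Qed.
Lemma z2_mkC2 c w : z2 (mkC2 c w) = w. Proof. by case: w. Qed.

Lemma toH_mkC2M c x : toH (mkC2 (z1 x * c) (z2 x * c)) = toH x * CtoH c.
Proof.
case: c x => [c d] [[x0 x1] [x2 x3]].
by apply: quat_eq => /=; ring.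
Qed.

(** The map x |-> p x q of H, read on C^2. *)
Definition quatmap p q x : C2 R := ofH (p * toH x * q).

Lemma toH_quatmap p q x : toH (quatmap p q x) = p * toH x * q.
Proof. by rewrite /quatmap ofHK. Qed.

Lemma quatmap_linear p q : linear (quatmap p q).
Proof.
move=> t x y; apply: (can_inj (toHK theta)).
rewrite toH_quatmap !toHD !toHZ toH_quatmap toH_quatmap.
by rewrite mulrDr mulrDl mulrA -CtoH_realC -!mulrA.
Qed.

HB.instance Definition _ p q :=
  GRing.isLinear.Build R (C2 R) (C2 R) *:%R (quatmap p q) (quatmap_linear p q).

Lemma quatmap_comp p q p' q' x :
  quatmap p q (quatmap p' q' x) = quatmap (p * p') (q' * q) x.
Proof. by rewrite /quatmap ofHK !mulrA. Qed.

Lemma quatmap1 x : quatmap 1 1 x = x.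
Proof. by rewrite /quatmap mul1r mulr1 toHK. Qed.

Lemma quatmapK p q : p != 0 -> q != 0 -> cancel (quatmap p q) (quatmap p^-1 q^-1).
Proof.
move=> p0 q0 x; rewrite quatmap_comp mulVr ?quat_unitqE// mulrV ?quat_unitqE//.
exact: quatmap1.
Qed.

(** The Euclidean product is the real part of x conj(y), which is invariant
    under cyclic permutations of the factors. *)
Lemma quatmap_adjoint p q x v :
  dotC2 x (quatmap p q v) = dotC2 (quatmap (quat_conj p) (quat_conj q) x) v.
Proof.
rewrite !dotC2_toH !toH_quatmap !quat_conjM.
by rewrite -!mulrA [RHS]q0C -!mulrA.
Qed.

Lemma sqnormC2_quatmap p q x :
  sqnormC2 (quatmap p q x) = (quat_norm p * quat_norm q) ^+ 2 * sqnormC2 x.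
Proof. by rewrite !sqnormC2_toH toH_quatmap !quat_normM; ring. Qed.

Let g p q e : C2 R -> R := dotC2 (quatmap (quat_conj p) (quat_conj q) e).

Let quatmapE p q : quatmap p q = fun x =>
  ((g p q (e0 : C2 R) x, g p q (e1 : C2 R) x), (g p q (e2 : C2 R) x, g p q (e3 : C2 R) x)).
Proof.
apply/funext => x; rewrite /g -!quatmap_adjoint.
by case: (quatmap p q x) => [[a b] [c d]]; rewrite /dotC2 /=; congr ((_, _), (_, _)); ring.
Qed.

Lemma quatmap_continuous p q : continuous (quatmap p q).
Proof.
have cg e x : {for x, continuous (g p q e)} by exact: dotC2_continuous.
have pairC (T : topologicalType) (h k : C2 R -> T) x : {for x, continuous h} ->
    {for x, continuous k} -> {for x, continuous (fun x => (h x, k x))}.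
  by move=> ch ck; apply: (@cvg_pair _ _ _ _ (nbhs (h x)) (nbhs (k x))).
by rewrite quatmapE => x; apply: (pairC); apply: (pairC); exact: cg.
Qed.

Lemma measurable_quatmap p q : measurable_fun setT (quatmap p q).
Proof.
have mg e : measurable_fun setT (g p q e).
  by apply: continuous_measurable_C2; exact: dotC2_continuous.
by rewrite quatmapE; apply: measurable_fun_pair; apply: measurable_fun_pair.
Qed.

Lemma measurable_quataff p q v : measurable_fun setT (fun x => quatmap p q x + v).
Proof.
exact: (measurableT_comp measurable_add_C2
  (measurable_fun_pair (measurable_quatmap p q) (measurable_cst v))).
Qed.

Lemma quataff_continuous p q v : continuous (fun x => quatmap p q x + v).
Proof.
move=> x; exact: (@continuous_comp _ _ _ (quatmap p q) (fun y => y + v) x (@quatmap_continuous p q x) (@continuous_translate R v _)).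
Qed.

(** x |-> p x q is a similarity of ratio |p| |q|. *)
Lemma quatmap_measure p q (v : C2 R) (E : set (C2 R)) : p != 0 -> q != 0 -> measurable E ->
  lebC2 ((fun x => quatmap p q x + v) @^-1` E) =
  (((quat_norm p * quat_norm q) ^+ 4)^-1%:E * lebC2 E)%E.
Proof.
move=> p0 q0 mE.
have np r : r != 0 -> 0 < quat_norm r :> R.
  move=> /quat_norm_neq0; rewrite expf_eq0 /= => n0.
  by rewrite lt_neqAle eq_sym n0 sqrtr_ge0.
have mv : measurable ((fun x : C2 R => x + v) @^-1` E).
  rewrite -[X in measurable X]setTI.
  exact: (measurableT_comp measurable_add_C2
    (measurable_fun_pair (@measurable_id _ (C2 R) setT) (measurable_cst v))).
have := @lebC2_similarity R (quatmap p q) (quatmap p^-1 q^-1)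
  (quat_norm p * quat_norm q) _ (measurable_quatmap p q) (measurable_quatmap p^-1 q^-1)
  (quatmapK p0 q0) _ (raddfD _) (mulr_gt0 (np p p0) (np q q0)) (sqnormC2_quatmap p q) mv.
rewrite lebC2_translation// => -> //.
have V0 r : r != 0 -> r^-1 != 0 :> quat R by rewrite -!quat_unitqE unitrV.
by have := quatmapK (V0 p p0) (V0 q q0); rewrite !invrK.
Qed.

Lemma quataff_derive p q v u x a :
  'D_a ((fun x => u (quatmap p q x + v)) : C2 R -> R^o) x =
  'D_(quatmap p q a) (u : C2 R -> R^o) (quatmap p q x + v).
Proof.
rewrite /derive; set F := (fun h => _); set G := (fun h => _).
suff -> : F = G by [].
apply/funext => h; rewrite /F /G /= quatmap_linear.
by rewrite addrA.
Qed.

Lemma quataff_differentiable p q v u x :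
  differentiable (u : C2 R -> R^o) (quatmap p q x + v) ->
  differentiable ((fun x => u (quatmap p q x + v)) : C2 R -> R^o) x.
Proof.
move=> du; pose V : normedModType R := C2 R; pose W : normedModType R := R^o.
pose L : {linear V -> V} := quatmap p q.
apply: (@differentiable_comp _ V V W (fun x => L x + v) u x _ du).
apply: (@differentiableD R V V L (cst v) x); last exact: differentiable_cst.
exact: (@linear_differentiable R V V L x (@quatmap_continuous p q)).
Qed.

Lemma quataff_C1real p q v u (U V : set (C2 R)) : open U -> open V ->
  (forall x, V x -> U (quatmap p q x + v)) -> C1real U u ->
  C1real V (fun x => u (quatmap p q x + v)).
Proof.
move=> oU oV VU /(C1realP _ oU) C; apply/(C1realP _ oV) => x Vx.
have [d c] := C _ (VU x Vx); split=> [|a]; first exact: quataff_differentiable.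
have -> : (fun y => 'D_a ((fun x => u (quatmap p q x + v)) : C2 R -> R^o) y) =
  (fun y => 'D_(quatmap p q a) (u : C2 R -> R^o) (quatmap p q y + v)).
  by apply/funext => y; exact: quataff_derive.
exact: (@continuous_comp _ _ _ (fun x => quatmap p q x + v)
  (fun y => 'D_(quatmap p q a) (u : C2 R -> R^o) y) x (@quataff_continuous p q v x) (c _)).
Qed.

Lemma quataff_grad p q v u x : differentiable (u : C2 R -> R^o) (quatmap p q x + v) ->
  gradC2 (fun x => u (quatmap p q x + v)) x =
  quatmap (quat_conj p) (quat_conj q) (gradC2 u (quatmap p q x + v)).
Proof.
move=> du; rewrite {1}/gradC2 !quataff_derive !(derive_grad _ du) !quatmap_adjoint.
case: (quatmap _ _ (gradC2 _ _)) => [[a b] [c d]].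
by rewrite /dotC2 /=; congr ((_, _), (_, _)); ring.
Qed.

(** This form shows how the dbar derivatives behave under composition with x |->
    p x q: gradients are multiplied by conj(p) and conj(q), and i can be moved
    past conj(q) when q is complex. *)
Lemma toH_dbar f x : toH (mkC2 (dbar1 f x) (dbar2 f x)) =
  toH (gradC2 (fun y => Re (f y)) x) + toH (gradC2 (fun y => Im (f y)) x) * CtoH 'i.
Proof.
rewrite /dbar1 /dbar2 /partialC /gradC2.
set a0 := 'D_ _ _ _; set a1 := 'D_ _ _ _; set a2 := 'D_ _ _ _; set a3 := 'D_ _ _ _.
set b0 := 'D_ _ _ _; set b1 := 'D_ _ _ _; set b2 := 'D_ _ _ _; set b3 := 'D_ _ _ _.
move: a0 a1 a2 a3 b0 b1 b2 b3 => a0 a1 a2 a3 b0 b1 b2 b3.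
by apply: quat_eq => /=; ring.
Qed.

Lemma CtoHC c w : CtoH c * CtoH w = CtoH w * CtoH c :> quat R.
Proof. by rewrite -!CtoHM mulrC. Qed.

(** Each gradient is transformed by the adjoint of x |-> p x c. Its right factor
    conj(c) is complex, so it commutes with i, which gives the dbar derivatives
    of the composite, and with the values of f, which gives the new
    coefficients. *)
Lemma quataff_Hol p c v (U V : set (C2 R)) (delta1 delta2 : R[i]) f :
  open U -> open V -> (forall x, V x -> U (quatmap p (CtoH c) x + v)) ->
  Hol (fun=> delta1) (fun=> delta2) U f ->
  let nu := quatmap (quat_conj p) (CtoH c^*) (mkC2 delta1 delta2) in
  Hol (fun=> z1 nu) (fun=> z2 nu) V (fun x => f (quatmap p (CtoH c) x + v)).
Proof.
move=> oU oV VU [[cr ci] H] nu; split.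
  by split; [exact: (quataff_C1real oU oV VU cr)|exact: (quataff_C1real oU oV VU ci)].
move=> x Vx; set y := quatmap p (CtoH c) x + v.
have [h1 h2] := H y (VU x Vx).
have dr := ((C1realP _ oU).1 cr _ (VU x Vx)).1.
have di := ((C1realP _ oU).1 ci _ (VU x Vx)).1.
have key : mkC2 (dbar1 (fun x => f (quatmap p (CtoH c) x + v)) x)
    (dbar2 (fun x => f (quatmap p (CtoH c) x + v)) x) = mkC2 (z1 nu * - f y) (z2 nu * - f y).
  apply: (can_inj (toHK theta)).
  rewrite toH_dbar (quataff_grad dr) (quataff_grad di) !toH_quatmap quat_conj_CtoH.
  rewrite -[X in _ + X]mulrA CtoHC mulrA -mulrDl -[X in _ + X]mulrA -mulrDr -/y.
  rewrite -toH_dbar h1 h2 toH_mkC2M // toH_quatmap.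
  rewrite -[RHS]mulrA [X in _ = _ * X]CtoHC mulrA -[X in _ = X * _]mulrA -toH_mkC2M.
  congr (_ * toH _ * _).
  by rewrite z1_mkC2 z2_mkC2 !mulrN.
have k1 := congr1 z1 key; have k2 := congr1 z2 key.
by move: k1 k2; rewrite !z1_mkC2 !z2_mkC2 !mulrN.
Qed.

End QuaternionMaps.

(** * Weighted composition operators *)

Section WeightedComposition.
Context {R : realType}.
Local Notation Re := (@complex.Re R).
Local Notation Im := (@complex.Im R).
Local Notation mu := (@lebC2 R).
Implicit Types (f g : C2 R -> R[i]).

Definition wcomp (c : C2 R -> R[i]) (tau : C2 R -> C2 R) f z : R[i] := c z * f (tau z).

(** The integral does not see null sets. *)
Lemma ae_eq_on_inner (gamma : C2 R -> R) (U : set (C2 R)) f g g' :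
  measurable U -> measurable_fun U gamma -> (forall x, U x -> 0 <= gamma x) ->
  L2 gamma U f -> L2 gamma U g -> L2 gamma U g' -> ae_eq_on U g g' ->
  inner gamma U f g = inner gamma U f g'.
Proof.
move=> mU mg g0 Lf Lg Lg' gg.
have E (k : R[i] -> R) :
    mu.-integrable U (EFin \o (fun x => k ((f x)^* * g x * (gamma x)%:C))) ->
    mu.-integrable U (EFin \o (fun x => k ((f x)^* * g' x * (gamma x)%:C))) ->
    \int[mu]_(x in U) k ((f x)^* * g x * (gamma x)%:C) =
    \int[mu]_(x in U) k ((f x)^* * g' x * (gamma x)%:C).
  move=> i1 i2; congr fine; refine (@ae_eq_integral _ _ R mu U _ _ mU (measurable_int mu i1) (measurable_int mu i2) _).
  case: gg => N [mN N0 gN]; exists N; split=> // x /= h.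
  by apply: gN => /= gx; apply: h => Ux; rewrite gx.
by congr (_ +i* _); apply: E; (try exact: L2_integrable_Re); exact: L2_integrable_Im.
Qed.

Section OneWay.
Context (tau : C2 R -> C2 R) (k : {posnum R}).
Context (mtau : measurable_fun setT tau)
  (tauk : forall A, measurable A -> mu (tau @^-1` A) = (k%:num%:E * mu A)%E).
Context (U : set (C2 R)) (c : C2 R -> R[i]) (g1 g2 : C2 R -> R).
Context (mU : measurable U) (mcr : measurable_fun setT (fun z => Re (c z)))
  (mci : measurable_fun setT (fun z => Im (c z)))
  (mg1 : measurable_fun setT g1) (mg2 : measurable_fun setT g2)
  (g10 : forall z, 0 <= g1 z) (g20 : forall z, 0 <= g2 z)
  (cg : forall z, sqn (c z) * g2 z = k%:num^-1 * g1 (tau z)).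

Let V := tau @^-1` U.
Let mV : measurable V.
Proof. by rewrite -[V]setTI; exact: mtau. Qed.

Let mcomp (h : C2 R -> R) : measurable_fun U h -> measurable_fun V (fun z => h (tau z)).
Proof.
move=> mh; apply: (@measurable_comp _ _ _ _ _ _ U h V tau) => //.
- by move=> _ [x Vx <-].
- exact: measurable_funTS.
Qed.

(** The identity relating the weights says that |c|^2 g2 is g1 o tau times the
    Jacobian of tau, so this is the change of variables formula. *)
Lemma wcomp_L2 f : L2 g1 U f -> L2 g2 V (wcomp c tau f).
Proof.
move=> Lf; have [mr mi fi] := Lf.
have cr := measurable_funTS mcr (D := V); have ci := measurable_funTS mci (D := V).
split.
- rewrite (_ : (fun x => _) = fun z => Re (c z) * Re (f (tau z)) - Im (c z) * Im (f (tau z))).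
    apply: measurable_funB; apply: measurable_funM => //; [exact: (mcomp mr)|exact: (mcomp mi)].
  by apply/funext => z; rewrite ReM.
- rewrite (_ : (fun x => _) = fun z => Re (c z) * Im (f (tau z)) + Im (c z) * Re (f (tau z))).
    apply: measurable_funD; apply: measurable_funM => //; [exact: (mcomp mi)|exact: (mcomp mr)].
  by apply/funext => z; rewrite ImM.
- pose h y : \bar R := (((k%:num)^-1)%R%:E * (sqn (f y) * g1 y)%:E)%E.
  have -> : (\int[mu]_(x in V) (ComplexField.Normc.normc (wcomp c tau f x) ^+ 2 * g2 x)%:E =
             \int[mu]_(x in V) h (tau x))%E.
    apply: eq_integral => x _; rewrite /h -EFinM; congr (_%:E).
    by rewrite normc_sqn /wcomp sqnM mulrAC cg -mulrA [g1 _ * _]mulrC.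
  have mh : measurable_fun U (EFin \o (fun y => sqn (f y) * g1 y)).
    by apply/measurable_EFinP; apply: measurable_sqn => //; exact: measurable_funTS.
  have h0 y : (0 <= (sqn (f y) * g1 y)%:E)%E by rewrite lee_fin mulr_ge0// sqn_ge0.
  have ki0 : (0 <= ((k%:num)^-1)%R%:E)%E by rewrite lee_fin invr_ge0.
  have mh' : measurable_fun U h by exact: measurable_funeM.
  rewrite (ge0_integral_change_of_variables mtau tauk mU mh'); last first.
    by move=> x _; apply: mule_ge0; [exact: ki0|exact: h0].
  rewrite /h ge0_integralZl//.
  rewrite muleA -EFinM mulfV// mul1e.
  rewrite (_ : (\int[mu]_(x in U) _)%E = (\int[mu]_(x in U) (ComplexField.Normc.normc (f x) ^+ 2 * g1 x)%:E)%E)//.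
  by apply: eq_integral => x _; rewrite /= normc_sqn.
Qed.

Lemma wcomp_inner f g : L2 g1 U f -> L2 g1 U g ->
  inner g2 V (wcomp c tau f) (wcomp c tau g) = inner g1 U f g.
Proof.
move=> Lf Lg.
have mr := L2_integrable_Re mU (measurable_funTS mg1) (fun x _ => g10 x) Lf Lg.
have mi := L2_integrable_Im mU (measurable_funTS mg1) (fun x _ => g10 x) Lf Lg.
have E z : (wcomp c tau f z)^* * wcomp c tau g z * (g2 z)%:C =
    (k%:num^-1)%:C * ((f (tau z))^* * g (tau z) * (g1 (tau z))%:C).
  rewrite /wcomp.
  have -> : (c z * f (tau z))^* * (c z * g (tau z)) * (g2 z)%:C =
    (sqn (c z) * g2 z)%:C * ((f (tau z))^* * g (tau z)).
    by apply: complexE; rewrite !(ReM, ImM, ReJ, ImJ) /sqn /=; ring.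
  have -> : (sqn (c z) * g2 z)%:C = (k%:num^-1)%:C * (g1 (tau z))%:C.
    by rewrite cg; apply: complexE; rewrite ?ReM ?ImM /=; ring.
  by rewrite -[LHS]mulrA [X in _ * X = _]mulrC.
have K (h : C2 R -> R) : mu.-integrable U (EFin \o h) ->
    \int[mu]_(x in V) (k%:num^-1 * h (tau x)) = \int[mu]_(x in U) h x.
  move=> ih; have mh : measurable_fun U h.
    by apply/measurable_EFinP; exact: (measurable_int mu ih).
  have mkh : measurable_fun U (fun y => k%:num^-1 * h y) by apply: measurable_funM.
  rewrite (Rintegral_change_of_variables mtau tauk mU mkh) RintegralZl//.
  by rewrite mulrA mulfV// mul1r.
rewrite /inner /integralC; congr (_ +i* _).
- rewrite -K//; apply: eq_Rintegral => x _; rewrite E ReM /=; ring.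
- rewrite -K//; apply: eq_Rintegral => x _; rewrite E ImM /=; ring.
Qed.

(** Preimages of null sets under tau are null. *)
Lemma wcomp_ae f g : ae_eq_on U f g -> ae_eq_on V (wcomp c tau f) (wcomp c tau g).
Proof.
move=> [N [mN N0 fN]]; exists (tau @^-1` N); split.
- by rewrite -[X in measurable X]setTI; exact: mtau.
- by rewrite -[LHS]/(mu _) tauk// -[X in (_ * X)%E]/(mu N) N0 mule0.
- move=> z /= h; apply: fN => /= fg; apply: h => Vz.
  by rewrite /wcomp fg.
Qed.

End OneWay.
End WeightedComposition.

(** * Transfer of Hilbert structure, kernel and projection *)

Section Transfer.
Context {R : realType}.
Local Notation Re := (@complex.Re R).
Local Notation Im := (@complex.Im R).
Local Notation mu := (@lebC2 R).
Implicit Types (f g h : C2 R -> R[i]).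
Context (tau tau' : C2 R -> C2 R) (k k' : {posnum R}).
Context (mtau : measurable_fun setT tau) (mtau' : measurable_fun setT tau')
  (tauk : forall A, measurable A -> mu (tau @^-1` A) = (k%:num%:E * mu A)%E)
  (tauk' : forall A, measurable A -> mu (tau' @^-1` A) = (k'%:num%:E * mu A)%E)
  (kk' : k%:num * k'%:num = 1)
  (tauK : cancel tau tau') (tauK' : cancel tau' tau).
Context (U V : set (C2 R)) (c : C2 R -> R[i]) (gamma : C2 R -> R).
Let c' y : R[i] := (c (tau' y))^-1.
Let one : C2 R -> R := fun=> 1.
Context (mU : measurable U) (mV : measurable V) (tauUV : tau @^-1` U = V)
  (mcr : measurable_fun setT (fun z => Re (c z)))
  (mci : measurable_fun setT (fun z => Im (c z)))
  (mcr' : measurable_fun setT (fun z => Re (c' z)))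
  (mci' : measurable_fun setT (fun z => Im (c' z)))
  (mgam : measurable_fun setT gamma) (gam0 : forall z, 0 <= gamma z)
  (c0 : forall z, c z != 0) (cgam : forall z, sqn (c z) * gamma z = k%:num^-1).

Let J := wcomp c tau.
Let J' := wcomp c' tau'.

Let tauVU : tau' @^-1` V = U.
Proof. by rewrite -tauUV; apply/seteqP; split=> y /=; rewrite tauK'. Qed.

Let mone : measurable_fun setT one. Proof. exact: measurable_cst. Qed.
Let one0 z : 0 <= one z. Proof. exact: ler01. Qed.

Let JK f : J' (J f) = f.
Proof.
by apply/funext => y; rewrite /J /J' /wcomp /c' tauK' mulKf.
Qed.

Let JK' f : J (J' f) = f.
Proof.
by apply/funext => y; rewrite /J /J' /wcomp /c' tauK mulVKf.
Qed.

Let cg z : sqn (c z) * gamma z = k%:num^-1 * one (tau z).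
Proof. by rewrite mulr1. Qed.

Let cg' y : sqn (c' y) * one y = k'%:num^-1 * gamma (tau' y).
Proof.
have s1 : sqn (c (tau' y)) * sqn (c' y) = 1.
  by rewrite -sqnM mulfV// /sqn /= expr1n expr0n addr0.
have k'E : k'%:num^-1 = k%:num.
  by apply: (@mulIf _ k'%:num) => //; rewrite mulVf// kk'.
have s0 : sqn (c (tau' y)) != 0.
  by apply/eqP => s0; move: s1; rewrite s0 mul0r => /eqP; rewrite eq_sym oner_eq0.
rewrite mulr1 k'E; apply: (mulfI s0); rewrite s1 mulrCA cgam mulfV//.
Qed.

Let J_L2 f : L2 one U f -> L2 gamma V (J f).
Proof. by rewrite -tauUV; exact: (wcomp_L2 mtau tauk mU mcr mci mone one0 cg). Qed.

Let J'_L2 f : L2 gamma V f -> L2 one U (J' f).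
Proof.
rewrite -[in L2 one U]tauVU.
exact: (wcomp_L2 mtau' tauk' mV mcr' mci' mgam gam0 cg').
Qed.

Let J_inner f g : L2 one U f -> L2 one U g -> inner gamma V (J f) (J g) = inner one U f g.
Proof.
by rewrite -[in inner gamma V]tauUV; exact: (wcomp_inner mtau tauk mU mone one0 cg).
Qed.

Let J_ae f g : ae_eq_on U f g -> ae_eq_on V (J f) (J g).
Proof. by rewrite -tauUV; exact: (wcomp_ae mtau tauk). Qed.

Let J'_ae f g : ae_eq_on V f g -> ae_eq_on U (J' f) (J' g).
Proof. by rewrite -[in ae_eq_on U]tauVU; exact: (wcomp_ae mtau' tauk'). Qed.

Lemma wcomp_bijective_L2 :
  bijective_mod (L2 one U) (ae_eq_on U) (L2 gamma V) (ae_eq_on V) J.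
Proof.
split=> [f|f g _ _|h Lh]; first exact: J_L2.
  split=> [fg|fg]; first exact: (J_ae fg).
  by have := J'_ae fg; rewrite !JK.
exists (J' h); first exact: J'_L2.
rewrite JK'; exists set0; split; [exact: measurable0|exact: measure0|].
by move=> x /= nh; apply: nh.
Qed.

Context (HU HV : set (C2 R -> R[i])).
Let AU := HU `&` L2 one U.
Let AV := HV `&` L2 gamma V.
Context (HV0 : HV (fun=> 0))
  (HVlin : forall (a : R[i]) f g, HV f -> HV g -> HV (fun x => a * f x + g x))
  (JH : forall f, HU f -> HV (J f)) (JH' : forall h, HV h -> HU (J' h))
  (hU : hilbert_space U AU (inner one U)).

Let mgamV : measurable_fun V gamma. Proof. exact: measurable_funTS. Qed.
Let gam0V z : V z -> 0 <= gamma z. Proof. by []. Qed.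

Let AUL2 : AU `<=` L2 one U. Proof. by move=> f []. Qed.
Let AVL2 : AV `<=` L2 gamma V. Proof. by move=> f []. Qed.

Let AV0 : AV (fun=> 0). Proof. by split=> //; exact: L2_0. Qed.

Let AVlin (a : R[i]) f g : AV f -> AV g -> AV (fun x => a * f x + g x).
Proof. by move=> [Hf Lf] [Hg Lg]; split; [exact: HVlin|exact: L2_lin]. Qed.

Let JA f : AU f -> AV (J f).
Proof. by move=> [Hf Lf]; split; [exact: JH|exact: J_L2]. Qed.

Let JA' h : AV h -> AU (J' h).
Proof. by move=> [Hh Lh]; split; [exact: JH'|exact: J'_L2]. Qed.

Let J_eq f g : eq_on U f g -> eq_on V (J f) (J g).
Proof. by rewrite -tauUV => fg z Vz; rewrite /J /wcomp fg. Qed.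

Let J'_eq f g : eq_on V f g -> eq_on U (J' f) (J' g).
Proof. by rewrite -tauVU => fg z Vz; rewrite /J' /wcomp fg. Qed.

Lemma wcomp_isometric_isomorphism :
  isometric_isomorphism U AU (inner one U) V AV (inner gamma V) J.
Proof.
split.
- split=> [f|f g _ _|h Ah]; first exact: JA.
    by split=> [|/J'_eq]; [exact: J_eq|rewrite !JK].
  by exists (J' h); [exact: JA'|rewrite JK'].
- by move=> a f g _ _ z _; rewrite /J /wcomp; ring.
- by move=> f g /AUL2 Lf /AUL2 Lg; exact: J_inner.
Qed.

Lemma wcomp_hilbert_space : hilbert_space V AV (inner gamma V).
Proof.
apply: (hilbert_transport hU wcomp_isometric_isomorphism AV0 AVlin).
- by move=> a f g h /AVL2 Lf /AVL2 Lg /AVL2 Lh; exact: inner_lin.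
- by move=> f g /AVL2 Lf /AVL2 Lg; exact: inner_herm.
- by move=> f _; exact: inner_ge0.
- by move=> *; exact: eq_on_inner.
Qed.

Context (kerU : is_Bergman_kernel one U AU (Bergman_kernel one U AU)).
Let B := Bergman_kernel one U AU.
Let B' z w : R[i] := c z * B (tau z) (tau w) * (c w)^*.

Let tauV z : V z -> U (tau z). Proof. by rewrite -tauUV. Qed.

Let G z w : R[i] := (B (tau z) w)^*.

Let AG z : V z -> AU (G z).
Proof. by move=> Vz; exact: kerU.1 (tauV Vz). Qed.

Let inner_J z g : V z -> L2 gamma V g ->
  integralC V (fun w => B' z w * g w * (gamma w)%:C) = c z * inner gamma V (J (G z)) g.
Proof.
move=> Vz Lg; rewrite -inner_kernel.
have LJ : L2 gamma V (J (G z)) by exact: J_L2 (AUL2 (AG Vz)).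
have L0 : L2 gamma V (fun=> 0) by exact: L2_0.
have -> : (fun w => (B' z w)^*) = (fun w => (c z)^* * J (G z) w + 0).
  apply/funext => w; rewrite addr0 /B' /J /wcomp /G !rmorphM /=.
  by rewrite [((c w)^*)^*]conjcK; ring.
have L1 : L2 gamma V (fun w => (c z)^* * J (G z) w + 0) by exact: L2_lin.
rewrite (inner_herm mV mgamV gam0V Lg L1) (inner_lin mV mgamV gam0V _ LJ L0 Lg).
have -> : inner gamma V g (fun=> 0) = 0.
  by rewrite /inner /integralC; congr (_ +i* _);
    (rewrite (@eq_Rintegral _ _ _ _ _ (fun=> 0)); [by rewrite Rintegral_cst// mul0r|
     by move=> x _; rewrite mulr0 mul0r]).
rewrite addr0 rmorphM /= (inner_herm mV mgamV gam0V Lg LJ).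
by rewrite [((c z)^*)^*]conjcK; congr (_ * _); rewrite [LHS]conjcK.
Qed.

Let kerV' : is_Bergman_kernel gamma V AV B'.
Proof.
split=> [z Vz|h z Ah Vz].
  have -> : (fun w => (B' z w)^*) = (fun w => (c z)^* * J (G z) w + 0).
    apply/funext => w; rewrite addr0 /B' /J /wcomp /G !rmorphM /=.
    by rewrite [((c w)^*)^*]conjcK; ring.
  by apply: AVlin => //; apply: JA; exact: AG.
rewrite inner_J//; last exact: AVL2.
rewrite -{2}(JK' h) J_inner; [|exact: AUL2 (AG Vz)|exact: J'_L2 (AVL2 Ah)].
rewrite /G inner_kernel -(kerU.2 _ _ (JA' Ah) (tauV Vz)).
by rewrite -[LHS]/(h z) -{1}(JK' h).
Qed.

Lemma wcomp_kernel : is_Bergman_kernel gamma V AV (Bergman_kernel gamma V AV).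
Proof. exact: (xgetPex (fun _ _ => 0) (ex_intro _ B' kerV')). Qed.

Lemma wcomp_kernelE z w : V z -> V w ->
  Bergman_kernel gamma V AV z w = c z * B (tau z) (tau w) * (c w)^*.
Proof.
exact: (Bergman_kernel_unique wcomp_hilbert_space wcomp_kernel kerV').
Qed.

Lemma wcomp_projection g : L2 gamma V g ->
  eq_on V (Bergman_projection gamma V AV g)
    (J (Bergman_projection one U AU (inverse_mod (L2 one U) (ae_eq_on V) J g))).
Proof.
move=> Lg z Vz; set f := inverse_mod _ _ _ _.
have [Lf fg] : L2 one U f /\ ae_eq_on V (J f) g.
  have [_ _ surj] := wcomp_bijective_L2; have [f0 Lf0 e0] := surj g Lg.
  pose P := [set f' | L2 one U f' /\ ae_eq_on V (J f') g].
  exact: (@xgetPex _ (fun=> 0) P (ex_intro _ f0 (conj Lf0 e0))).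
rewrite /Bergman_projection.
have -> : integralC V (fun w => Bergman_kernel gamma V AV z w * g w * (gamma w)%:C) =
    integralC V (fun w => B' z w * g w * (gamma w)%:C).
  rewrite -!inner_kernel; apply: eq_on_inner => // w Vw.
  by rewrite wcomp_kernelE.
rewrite inner_J// /J /wcomp; congr (_ * _).
have LJ : L2 gamma V (J (G z)) by exact: J_L2 (AUL2 (AG Vz)).
rewrite -(ae_eq_on_inner mV mgamV gam0V LJ (J_L2 Lf) Lg fg) J_inner//; last exact: AUL2 (AG Vz).
by rewrite /G inner_kernel.
Qed.

(** J and its inverse, which is of the same form, preserve the inner product.
    Hence c(z) B(tau z, tau w) conj(c(w)) reproduces the functions J f, and it
    is the kernel by uniqueness. As an inner product with a kernel function, the
    projection is carried over too; its argument may be changed on a null set,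
    so it may be written J f with f the chosen preimage. *)
Theorem wcomp_transfer :
  [/\ hilbert_space V AV (inner gamma V),
      isometric_isomorphism U AU (inner one U) V AV (inner gamma V) J,
      is_Bergman_kernel gamma V AV (Bergman_kernel gamma V AV) &
      forall z w, V z -> V w ->
        Bergman_kernel gamma V AV z w = c z * Bergman_kernel one U AU (tau z) (tau w) * (c w)^*] /\
  bijective_mod (L2 one U) (ae_eq_on U) (L2 gamma V) (ae_eq_on V) J /\
  forall g, L2 gamma V g -> eq_on V (Bergman_projection gamma V AV g)
    (J (Bergman_projection one U AU (inverse_mod (L2 one U) (ae_eq_on V) J g))).
Proof.
split; last by split; [exact: wcomp_bijective_L2|exact: wcomp_projection].
by split; [exact: wcomp_hilbert_space|exact: wcomp_isometric_isomorphism
  |exact: wcomp_kernel|exact: wcomp_kernelE].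
Qed.

End Transfer.

(** * The exponential factor of the isometry *)

Section Final.
Context {R : realType}.
Local Notation Re := (@complex.Re R).
Local Notation Im := (@complex.Im R).
Implicit Types (l x z : C2 R) (K w c : R[i]).

Definition expwC l K z : R[i] := (expw l z)%:C * K.

Lemma measurable_expwC l K : measurable_fun setT (fun z => Re (expwC l K z)) /\
  measurable_fun setT (fun z => Im (expwC l K z)).
Proof.
have me : measurable_fun [set: C2 R] (expw l) by exact: measurable_expw.
split.
- rewrite (_ : (fun x => _) = fun z => expw l z * Re K); first exact: measurable_funM.
  by apply/funext => z; rewrite ReZ.
- rewrite (_ : (fun x => _) = fun z => expw l z * Im K); first exact: measurable_funM.
  by apply/funext => z; rewrite ImZ.
Qed.

Lemma expwN l z : expw (- l) z * expw l z = 1.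
Proof.
rewrite /expw -expRD (_ : _ + _ = 0) ?expR0//.
by rewrite /dotC2 /=; ring.
Qed.

Lemma expwC_inv l K z : (expwC l K z)^-1 = expwC (- l) K^-1 z.
Proof.
have e0 : (expw l z)%:C != 0 by apply/eqP => -[] /eqP; rewrite gt_eqF// expR_gt0.
rewrite /expwC invfM; congr (_ * _); apply: (mulIf e0).
by rewrite mulVf// -rmorphM /= expwN.
Qed.

Lemma expwC_neq0 l K z : K != 0 -> expwC l K z != 0.
Proof.
move=> K0; rewrite mulf_neq0//; apply/eqP => -[] /eqP.
by rewrite gt_eqF// expR_gt0.
Qed.

Lemma sqn_expwC l K z : sqn (expwC l K z) * expR (- 2 * dotC2 l z) = sqn K.
Proof.
rewrite /expwC sqnM /sqn /= expr0n addr0 mulrAC.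
have -> : expw l z ^+ 2 * expR (- 2 * dotC2 l z) = 1.
  rewrite expr2 /expw -!expRD (_ : _ + _ = 0) ?expR0//; ring.
by rewrite mul1r.
Qed.

Lemma Re_mkC2 (c1 c2 : R[i]) x : Re (c1^* * z1 x + c2^* * z2 x) = dotC2 (mkC2 c1 c2) x.
Proof.
case: x c1 c2 => [[x0 x1] [x2 x3]] [a b] [c d].
by rewrite /dotC2 /=; ring.
Qed.

Lemma sqn_neq0 c : c != 0 -> sqn c != 0.
Proof.
apply: contra_neq; case: c => x y; rewrite /sqn /= => /eqP.
by rewrite paddr_eq0 ?sqr_ge0// !sqrf_eq0 => /andP[/eqP -> /eqP ->].
Qed.

Lemma quat_norm_CtoH c : quat_norm (CtoH c) ^+ 2 = sqn c.
Proof. by rewrite quat_norm_sqr /sqn /=; ring. Qed.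

Lemma Hol_expwC (U : set (C2 R)) alpha beta l K f : open U ->
  Hol (fun=> alpha) (fun=> beta) U f ->
  Hol (fun=> alpha - z1 l) (fun=> beta - z2 l) U (fun z => expwC l K z * f z).
Proof.
move=> oU /(Hol_expw l oU) Hf.
have := Hol_lin K oU Hf (Hol0 (alpha - z1 l) (beta - z2 l) oU).
congr (Hol _ _ _); apply/funext => z; rewrite /expwC; ring.
Qed.

Lemma affC2E theta (a b : quat R) (d : R[i]) : d != 0 ->
  affC2 theta a b d = fun x => quatmap theta a (CtoH d^-1) x + ofH theta (b * CtoH d^-1).
Proof.
move=> d0; apply/funext => x.
by rewrite /affC2 /affH /quatmap -ofHD CtoHV// mulrDl.
Qed.

Lemma affC2_invE theta (a b : quat R) (d : R[i]) :
  affC2_inv theta a b d = fun x => quatmap theta a^-1 (CtoH d) x + ofH theta (- (a^-1 * b)).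
Proof.
apply/funext => x.
by rewrite /affC2_inv /affH_inv /quatmap -ofHD mulrBr mulrA.
Qed.

End Final.

(** * The isometry between the two Bergman spaces *)

Theorem corollary4p5 (R : realType) (theta : R) (alpha beta chi xi : R[i])
    (a b : quat R) (d : R[i]) (Omega Xi : set (C2 R)) :
  0 <= theta -> theta < 2 * pi ->
  a != 0 -> d != 0 ->
  domain Omega -> domain Xi ->
  let T : C2 R -> C2 R := affC2 theta a b d in
  let Tinv : C2 R -> C2 R := affC2_inv theta a b d in
  T @` Xi = Omega ->
  let A_T : C2 R -> quat R := fun=> CtoH d^* in
  let B_T : quat R := quat_conj a in
  let C_T : C2 R -> R[i] := fun=> (quat_norm a ^+ 2 / ComplexField.Normc.normc d)%:C * d^-1 in
  let rho_T : C2 R -> R := fun=> 1 in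
  let delta_T : C2 R -> quat R := fun w =>
    B_T^-1 * (CtoH chi + unitH theta * CtoH xi) * A_T (Tinv w) in
  let delta1 : C2 R -> R[i] := fun w => z1 (ofH theta (delta_T w)) in
  let delta2 : C2 R -> R[i] := fun w => z2 (ofH theta (delta_T w)) in
  let gamma_T : C2 R -> R := fun z =>
    expR (- 2 * complex.Re ((chi - alpha)^* * z1 z + (xi - beta)^* * z2 z))
      * rho_T z in
  let one : C2 R -> R := fun=> 1 in
  let A_Omega := Bergman delta1 delta2 one Omega in
  let A_Xi := Bergman (fun=> alpha) (fun=> beta) gamma_T Xi in
  let J_T : (C2 R -> R[i]) -> C2 R -> R[i] := fun f z =>
    (expR (complex.Re ((chi - alpha)^* * z1 z + (xi - beta)^* * z2 z)))%:C
      * C_T z * f (T z) in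
  let B_Omega := Bergman_kernel one Omega A_Omega in
  let B_Xi := Bergman_kernel gamma_T Xi A_Xi in
  let J_T_inv := inverse_mod (L2 one Omega) (ae_eq_on Xi) J_T in
  (hilbert_space Omega A_Omega (inner one Omega) /\
   hilbert_space Xi A_Xi (inner gamma_T Xi) /\
   isometric_isomorphism Omega A_Omega (inner one Omega)
                         Xi A_Xi (inner gamma_T Xi) J_T) /\
  (is_Bergman_kernel one Omega A_Omega B_Omega /\
   is_Bergman_kernel gamma_T Xi A_Xi B_Xi /\
   forall z zeta : C2 R, Xi z -> Xi zeta ->
     B_Xi z zeta =
       (expR (complex.Re ((chi - alpha)^* * (z1 z + z1 zeta)
                          + (xi - beta)^* * (z2 z + z2 zeta))))%:C
         * C_T z * B_Omega (T z) (T zeta) * (C_T zeta)^*) /\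
  (bijective_mod (L2 one Omega) (ae_eq_on Omega)
                 (L2 gamma_T Xi) (ae_eq_on Xi) J_T /\
   forall g : C2 R -> R[i], L2 gamma_T Xi g ->
     eq_on Xi (Bergman_projection gamma_T Xi A_Xi g)
              (J_T (Bergman_projection one Omega A_Omega (J_T_inv g)))).
Proof.
move=> _ _ a0 d0 [_ oO _] [_ oX _] T Tinv TX A_T B_T C_T rho_T delta_T delta1 delta2
  gamma_T one A_Omega A_Xi J_T B_Omega B_Xi J_T_inv.
have D0 : CtoH d != 0 by exact: CtoH_neq0.
have Di0 : CtoH d^-1 != 0 by apply: CtoH_neq0; rewrite invr_eq0.
have ai0 : a^-1 != 0 by rewrite -!quat_unitqE unitrV in a0 *.
have TE := affC2E theta a b d0; have T'E := affC2_invE theta a b d.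
have TK : cancel T Tinv by exact: affC2K.
have TK' : cancel Tinv T by exact: affC2_invK.
have TXO : T @^-1` Omega = Xi.
  rewrite -TX; apply/seteqP; split=> z /=; last by exists z.
  by move=> [y Xy /(can_inj TK) <-].
have XO z : Xi z -> Omega (T z) by rewrite -TXO.
have OX y : Omega y -> Xi (Tinv y) by rewrite -TXO /= TK'.
pose l := mkC2 (chi - alpha) (xi - beta).
pose K : R[i] := (quat_norm a ^+ 2 / ComplexField.Normc.normc d)%:C * d^-1.
have sd0 := sqn_neq0 d0.
have nd0 : ComplexField.Normc.normc d ^+ 2 = sqn d := normc_sqn d.
have K0 : K != 0.
  rewrite mulf_neq0 ?invr_eq0//; apply/eqP => -[] /eqP; rewrite mulf_eq0 invr_eq0.
  rewrite (negbTE (quat_norm_neq0 a0)) /= => /eqP n0.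
  by move: nd0 sd0; rewrite n0 expr0n /= => <-; rewrite eqxx.
have weightE z : (expR (complex.Re ((chi - alpha)^* * z1 z + (xi - beta)^* * z2 z)))%:C
    * C_T z = expwC l K z by rewrite Re_mkC2.
have gammaE : gamma_T = fun z => expR (- 2 * dotC2 l z).
  by apply/funext => z; rewrite /gamma_T Re_mkC2 mulr1.
have JE : J_T = wcomp (expwC l K) T.
  by apply/funext => f; apply/funext => z; rewrite /J_T weightE.
pose s := quat_norm a * quat_norm (CtoH d^-1).
pose s' := quat_norm a^-1 * quat_norm (CtoH d).
have np (r : quat R) : r != 0 -> 0 < quat_norm r.
  move=> /quat_norm_neq0; rewrite expf_eq0 /= => n0.
  by rewrite lt_neqAle eq_sym n0 sqrtr_ge0.
have s0 : 0 < (s ^+ 4)^-1 by rewrite invr_gt0 exprn_gt0// mulr_gt0// np.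
have s'0 : 0 < (s' ^+ 4)^-1 by rewrite invr_gt0 exprn_gt0// mulr_gt0// np.
have ss' : (s ^+ 4)^-1 * (s' ^+ 4)^-1 = 1.
  have V4 (x y : R) : (x ^+ 4)^-1 * (y ^+ 4)^-1 = ((x * y) ^+ 4)^-1 by rewrite exprMn [RHS]invfM.
  rewrite V4.
  have -> : s * s' = quat_norm (a * a^-1) * quat_norm (CtoH d^-1 * CtoH d).
    by rewrite !quat_normM /s /s'; ring.
  have -> : quat_norm (CtoH d^-1 * CtoH d) = 1.
    by rewrite -CtoHM mulVf// /quat_norm /= expr1n !expr0n /= !addr0 sqrtr1.
  by rewrite divrr// /quat_norm /= expr1n !expr0n /= !addr0 sqrtr1 mulr1 expr1n invr1.
(* |C_T|^2 is the inverse of the factor by which preimages under T scale the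
   measure *)
have sK : sqn K = s ^+ 4.
  have -> : s ^+ 4 = (quat_norm a ^+ 2) ^+ 2 * (sqn d^-1) ^+ 2.
    by rewrite -quat_norm_CtoH /s; ring.
  rewrite /K sqnM {1}/sqn /= [0 ^+ 2]expr0n addr0 exprMn exprVn nd0.
  have -> : sqn d^-1 = (sqn d)^-1.
    by apply: (mulIf sd0); rewrite mulVf// -sqnM mulVf// /sqn /= expr1n expr0n addr0.
  by rewrite -mulrA expr2.
have mT : measurable_fun setT T by rewrite /T TE; exact: measurable_quataff.
have mT' : measurable_fun setT Tinv by rewrite /Tinv T'E; exact: measurable_quataff.
have Tk A : measurable A -> lebC2 (T @^-1` A) = ((PosNum s0)%:num%:E * lebC2 A)%E.
  by rewrite /T TE; exact: quatmap_measure.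
have Tk' A : measurable A -> lebC2 (Tinv @^-1` A) = ((PosNum s'0)%:num%:E * lebC2 A)%E.
  by rewrite /Tinv T'E; exact: quatmap_measure.
(* the preimage of (chi, xi) under the adjoint of the linear part of T *)
pose delta := quatmap theta (quat_conj a)^-1 (CtoH d^*) (mkC2 chi xi).
have deltaE w : ofH theta (delta_T w) = delta.
  by rewrite /delta_T /delta /quatmap /toH z1_mkC2 z2_mkC2.
have A_OmegaE : A_Omega = Bergman (fun=> z1 delta) (fun=> z2 delta) one Omega.
  by congr Bergman; apply/funext => w; rewrite /delta1 /delta2 deltaE.
have mO : measurable Omega by exact: open_measurable_C2.
have mX : measurable Xi by exact: open_measurable_C2.
have [mr mi] := measurable_expwC l K; have [mr' mi'] := measurable_expwC (- l) K^-1.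
have invE y : (expwC l K (Tinv y))^-1 = expwC (- l) K^-1 (Tinv y) by exact: expwC_inv.
have mgam : measurable_fun setT gamma_T.
  rewrite gammaE (_ : (fun z => _) = expw (-2 *: l)); first exact: measurable_expw.
  apply/funext => z; rewrite /expw; congr expR.
  have -> : -2 *: l = ((-2 * l.1.1, -2 * l.1.2), (-2 * l.2.1, -2 * l.2.2)) by [].
  by rewrite /dotC2 /=; ring.
have JH f : Hol (fun=> z1 delta) (fun=> z2 delta) Omega f ->
    Hol (fun=> alpha) (fun=> beta) Xi (wcomp (expwC l K) T f).
  move=> Hf; have XO' := XO; rewrite /T TE in XO'.
  have := quataff_Hol oO oX XO' Hf.
  have -> : mkC2 (z1 delta) (z2 delta) = delta by case: (delta) => [[? ?] [? ?]].
  have -> : quatmap theta (quat_conj a) (CtoH (d^-1)^*) delta = mkC2 chi xi.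
    rewrite /delta quatmap_comp divrr ?quat_unitqE ?quat_conj_eq0//.
    by rewrite -CtoHM -rmorphM /= mulfV// rmorph1 quatmap1.
  cbv zeta; rewrite z1_mkC2 z2_mkC2 => /(Hol_expwC l K oX).
  by rewrite /l z1_mkC2 z2_mkC2 !subKr /wcomp /T TE.
have JH' h : Hol (fun=> alpha) (fun=> beta) Xi h ->
    Hol (fun=> z1 delta) (fun=> z2 delta) Omega (wcomp (fun y => (expwC l K (Tinv y))^-1) Tinv h).
  move=> Hh; have OX' := OX; rewrite /Tinv T'E in OX'.
  have := Hol_expwC (- l) K^-1 oX Hh.
  have -> : alpha - z1 (- l) = chi.
    by rewrite -[z1 (- l)]/(- z1 l) /l z1_mkC2 opprK addrC subrK.
  have -> : beta - z2 (- l) = xi.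
    by rewrite -[z2 (- l)]/(- z2 l) /l z2_mkC2 opprK addrC subrK.
  move=> /(quataff_Hol oX oO OX'); rewrite quat_conjV// -/delta.
  congr (Hol _ _ _ _); apply/funext => y.
  by rewrite /wcomp invE /Tinv T'E.
have hO : hilbert_space Omega A_Omega (inner one Omega).
  by rewrite A_OmegaE; exact: Bergman_hilbert.
have kO : is_Bergman_kernel one Omega A_Omega B_Omega.
  by rewrite /B_Omega A_OmegaE; exact: Bergman_kernel_exists.
rewrite A_OmegaE in hO kO.
have [mc mc'] : measurable_fun setT (fun y => complex.Re (expwC l K (Tinv y))^-1) /\
    measurable_fun setT (fun y => complex.Im (expwC l K (Tinv y))^-1).
  have -> : (fun y => complex.Re (expwC l K (Tinv y))^-1) =
      (fun z => complex.Re (expwC (- l) K^-1 z)) \o Tinv.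
    by apply/funext => y; rewrite /= invE.
  have -> : (fun y => complex.Im (expwC l K (Tinv y))^-1) =
      (fun z => complex.Im (expwC (- l) K^-1 z)) \o Tinv.
    by apply/funext => y; rewrite /= invE.
  by split; [exact: (measurableT_comp mr' mT')|exact: (measurableT_comp mi' mT')].
have gam0 z : 0 <= gamma_T z by rewrite gammaE expR_ge0.
have cgam z : sqn (expwC l K z) * gamma_T z = (PosNum s0)%:num^-1.
  by rewrite gammaE sqn_expwC sK /= invrK.
have Xlin (e : R[i]) f g : Hol (fun=> alpha) (fun=> beta) Xi f ->
    Hol (fun=> alpha) (fun=> beta) Xi g ->
    Hol (fun=> alpha) (fun=> beta) Xi (fun x => e * f x + g x) by exact: Hol_lin.
have [[hX iso kX kE] [bij proj]] := @wcomp_transfer R T Tinv (PosNum s0) (PosNum s'0)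
  mT mT' Tk Tk' ss' TK TK' Omega Xi (expwC l K) gamma_T mO mX TXO mr mi mc mc' mgam gam0
  (fun z => expwC_neq0 l z K0) cgam _ _ (Hol0 alpha beta oX) Xlin JH JH' hO kO.
rewrite /J_T_inv /B_Omega /B_Xi A_OmegaE JE.
split; first by split.
split; last by split.
split; first by [].
split=> // z zeta Xz Xzeta; rewrite kE//.
have -> : complex.Re ((chi - alpha)^* * (z1 z + z1 zeta) + (xi - beta)^* * (z2 z + z2 zeta)) =
    dotC2 l z + dotC2 l zeta.
  by rewrite /l -!Re_mkC2 -ReD; congr complex.Re; ring.
rewrite expRD /expwC /C_T -/K /expw.
apply: complexE; rewrite !(ReM, ImM, ReJ, ImJ) /=; ring.
Qed.
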